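(* Let $\mu=\mu_1\times\dots\times\mu_K$ be a product-form probability distribution on $(S,\mathcal{S})$, let $\gamma$ be a finite unsigned measure on $(S,\mathcal{S})$ absolutely continuous with respect to $\mu$, and let $w:=d\gamma/d\mu$. Let $\gamma^N(\varphi):=\mu^N(w\varphi)$ and $\gamma^N_\times(\varphi):=\mu^N_\times(w\varphi)$. If $\varphi$ is $\gamma$-integrable, then $\gamma^N_\times(\varphi)$ is an unbiased estimator of $\gamma(\varphi)$, that is, $\mathbb{E}[\gamma^N_\times(\varphi)]=\gamma(\varphi)$ for all $N>0$. If, furthermore, $w\varphi\in L^2_\mu$, then $\gamma^N_\times(\varphi)$ is strongly consistent ($\gamma^N_\times(\varphi)\to\gamma(\varphi)$ almost surely as $N\to\infty$), asymptotically normal ($N^{1/2}[\gamma^N_\times(\varphi)-\gamma(\varphi)]\Rightarrow\mathcal{N}(0,\sigma^2_{\gamma,\times}(\varphi))$ as $N\to\infty$), and its finite sample and asymptotic variances are bounded above by those of $\gamma^N(\varphi)$: $$\mathrm{Var}(\gamma^N_\times(\varphi))=\mathrm{Var}(\mu^N_\times(w\varphi))\leq\mathrm{Var}(\mu^N(w\varphi))=\mathrm{Var}(\gamma^N(\varphi))\quad\forall N>0,$$ $$\sigma^2_{\gamma,\times}(\varphi)=\sigma^2_\times(w\varphi)\leq\sigma^2(w\varphi)=\sigma^2_\gamma(\varphi),$$ where $$\mathrm{Var}(\mu^N_\times(w\varphi))=\sum_{\emptyset\neq A\subseteq[K]}\frac{1}{N^{|A|}}\sum_{B\subseteq A}(-1)^{|A|-|B|}\mu_B([\mu_{B^c}(w\varphi)-\mu(w\varphi)]^2),\qquad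 \sigma^2_\times(w\varphi)=\sum_{k=1}^K\mu_k([\mu_{\{k\}^c}(w\varphi)-\mu(w\varphi)]^2).$$
   Context: $K>1$ is an integer, $[K]:=\{1,\dots,K\}$. For $k\in[K]$, $\mu_k$ is a probability distribution on a measurable space $(S_k,\mathcal{S}_k)$; $S:=S_1\times\dots\times S_K$ with product sigma-algebra $\mathcal{S}$. $\mu(\psi):=\int\psi\,d\mu$ (similarly $\gamma(\psi)$); $L^2_\mu$ is the space of square $\mu$-integrable real-valued functions. $X^1,X^2,\dots$ are i.i.d. with law $\mu$, $X^n=(X^n_1,\dots,X^n_K)$; $\mu^N(\psi):=N^{-1}\sum_{n=1}^N\psi(X^n)$; $\mu^N_\times(\psi):=N^{-K}\sum_{\mathbf{n}\in[N]^K}\psi(X^{\mathbf{n}})$ with $X^{\mathbf{n}}:=(X^{n_1}_1,\dots,X^{n_K}_K)$. For $A\subseteq[K]$: $A^c:=[K]\setminus A$, $\mu_A:=\prod_{k\in A}\mu_k$, and $\mu_A(\psi)$ is the function on $\prod_{k\notin A}S_k$ obtained by integrating out the arguments of $\psi$ indexed by $A$ with respect to $\mu_A$ ($\mu_\emptyset(\psi):=\psi$); such partial integrals are assumed well-defined at every point. $\sigma^2(\psi):=\mu([\psi-\mu(\psi)]^2)$. $\sigma^2_{\gamma,\times}(\varphi)$ and $\sigma^2_\gamma(\varphi)$ denote the asymptotic variances (variances of the Gaussian limits after centring and scaling by $N^{1/2}$) of $\gamma^N_\times(\varphi)$ and $\gamma^N(\varphi)$, respectively. $\Rightarrow$ denotes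 convergence in distribution. *)

(* Defs.v *)
(* MathComp-Analysis *)
From HB Require Import structures.
From mathcomp Require Import all_boot all_order all_algebra.
From mathcomp Require Import all_classical all_reals all_analysis.

Set Implicit Arguments.
Unset Strict Implicit.
Unset Printing Implicit Defensive.

Import Order.TTheory GRing.Theory Num.Theory.
Import numFieldNormedType.Exports.

Local Open Scope classical_set_scope.
Local Open Scope ring_scope.

Definition prod_display (I : Type) (d : I -> measure_display) :
  measure_display.
Proof. exact: default_measure_display. Qed.

Section product_space.
Context (I : finType) (d : I -> measure_display).
Variable S : forall i, measurableType (d i).

Definition prod_space : Type := forall i, S i.

HB.instance Definition _ := Pointed.copy prod_space (forall i, S i).

Definition prod_measurable : set (set prod_space) :=
  <<s \bigcup_i preimage_set_system setT (fun x : prod_space => x i) measurable >>.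

Let prod0 : prod_measurable set0.
Proof. exact: sigma_algebra0. Qed.

Let prodC A : prod_measurable A -> prod_measurable (~` A).
Proof. exact: sigma_algebraC. Qed.

Let prod_bigcup (F : (set prod_space)^nat) :
  (forall n, prod_measurable (F n)) -> prod_measurable (\bigcup_n F n).
Proof. exact: sigma_algebra_bigcup. Qed.

HB.instance Definition _ := @isMeasurable.Build (prod_display d)
  prod_space prod_measurable prod0 prodC prod_bigcup.

Lemma measurable_coord i : measurable_fun setT (fun x : prod_space => x i).
Proof.
move=> _ A mA; apply: sub_sigma_algebra; exists i => //.
by exists A => //; rewrite setTI.
Qed.

Lemma measurable_to_prod d' (T : measurableType d') (f : T -> prod_space) :
  (forall i, measurable_fun setT (fun t => f t i)) -> measurable_fun setT f.
Proof.
move=> mf; apply: (measurability (\bigcup_i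
  preimage_set_system setT (fun x : prod_space => x i) measurable)) => //.
move=> _ [_ [i _ [A mA <-]] <-]; rewrite !setTI.
by rewrite -[X in measurable X]setTI; apply: mf.
Qed.

Definition box (A : forall i, set (S i)) : set prod_space :=
  [set x | forall i, A i (x i)].

Lemma measurable_box A : (forall i, measurable (A i)) -> measurable (box A).
Proof.
move=> mA.
have -> : box A = \bigcap_(i in [set` enum I]) ((fun x : prod_space => x i) @^-1` A i).
  by apply/seteqP; split=> [x xA i _|x xA i]; [exact: xA|apply: xA => /=; rewrite mem_enum].
apply: fin_bigcap_measurable => [|i _]; first exact: finite_seq.
by rewrite -[X in measurable X]setTI; apply: measurable_coord.
Qed.

Definition set_coord i (p : prod_space * S i) : prod_space := dfwith p.1 i p.2.

Lemma measurable_set_coord i : measurable_fun setT (@set_coord i).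
Proof.
apply: measurable_to_prod => j; have [ij|ij] := eqVneq i j.
  by case: _ / ij; under eq_fun do rewrite /set_coord dfwithin; exact: measurable_snd.
under eq_fun do rewrite /set_coord dfwithout//.
apply: (@measurableT_comp _ _ _ _ _ _ (fun x : prod_space => x j) _ fst); [exact: measurable_coord|exact: measurable_fst].
Qed.

HB.instance Definition _ i := isMeasurableFun.Build _ _ _ _ (@set_coord i)
  (@measurable_set_coord i).

Variables (R : realType) (mu : forall i, probability (S i) R).

(* Law of the point whose coordinates listed in s are drawn independently from
   the mu i, the other coordinates being those of the default point *)
Fixpoint prod_prob_seq (s : seq I) : probability prod_space R :=
  if s is i :: s' then
    distribution ((prod_prob_seq s' \x mu i)%E : probability _ R) (@set_coord i)
  else (\d_(point : prod_space) : probability prod_space R).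

Definition prod_prob : probability prod_space R := prod_prob_seq (enum I).

Lemma prod_prob_seq_box s A : uniq s -> (forall i, measurable (A i)) ->
  (forall i, i \notin s -> A i = setT) ->
  prod_prob_seq s (box A) = (\prod_(i <- s) mu i (A i))%E.
Proof.
elim: s A => [|i s ih] A /=.
  move=> _ mA A1; rewrite big_nil.
  suff -> : box A = setT by rewrite diracT.
  by apply/seteqP; split => // x _ i; rewrite A1.
move=> /andP[iNs us] mA A1; rewrite big_cons muleC.
pose A' := dfwith A i setT.
have mA' j : measurable (A' j).
  by rewrite /A'; case: dfwithP => // *; exact: measurableT.
have prA : @set_coord i @^-1` box A = box A' `*` A i.
  apply/seteqP; split=> [[x y] xyA|[x y] [xA yA] j] /=.
    split; last by have := xyA i; rewrite /set_coord dfwithin.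
    move=> j; rewrite /A'; case: dfwithP => // k ik.
    by have := xyA k; rewrite /set_coord dfwithout.
  rewrite /set_coord/=; case: dfwithP => // k ik.
  by have := xA k; rewrite /A' dfwithout.
rewrite /distribution /pushforward/= prA product_measure1E//; last exact: measurable_box.
congr (_ * _)%E; have -> : (\prod_(j <- s) mu j (A j) = \prod_(j <- s) mu j (A' j))%E.
  apply: eq_big_seq => j js; rewrite /A' dfwithout//.
  by apply: contraNneq iNs => ->.
apply: ih => // j js; rewrite /A'; have [ij|ij] := eqVneq i j.
  by case: _ / ij; rewrite dfwithin.
by rewrite dfwithout// A1// inE negb_or eq_sym ij.
Qed.

Lemma prod_prob_box A : (forall i, measurable (A i)) ->
  prod_prob (box A) = (\prod_i mu i (A i))%E.
Proof.
move=> mA; rewrite /prod_prob prod_prob_seq_box ?enum_uniq ?big_enum//.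
by move=> i; rewrite mem_enum.
Qed.

End product_space.

Section partial_integration.
Context (I : finType) (d : I -> measure_display).
Variables (S : forall i, measurableType (d i)) (R : realType).
Variable mu : forall i, probability (S i) R.
Implicit Types (A B : {set I}) (psi : prod_space S -> R).

Definition sub_space A := prod_space (fun i : {i : I | i \in A} => S (val i)).

Definition sub_prob A : probability (sub_space A) R :=
  prod_prob (fun i : {i : I | i \in A} => mu (val i)).

Definition glue A (x : sub_space A) (y : sub_space (~: A)) : prod_space S :=
  fun i => match boolP (i \in A) with
           | AltTrue iA => x (exist _ i iA)
           | AltFalse iNA => y (exist _ i (etrans (finset.in_setC i A) iNA))
           end.

(* the integral of psi over the coordinates outside A, that is,
   mu_{A^c}(psi) as a function of the remaining coordinates *)
Definition integrate_out_compl A psi : sub_space A -> R :=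
  fun x => \int[sub_prob (~: A)]_y psi (glue x y).

(* all the partial integrals of psi are well defined at every point *)
Definition partially_integrable psi := forall A (x : sub_space A),
  (sub_prob (~: A)).-integrable setT (fun y => (psi (glue x y))%:E).

Definition mean psi : R := \int[prod_prob mu]_x psi x.

(* mu_A([mu_{A^c}(psi) - mu(psi)]^2) *)
Definition sq_dev A psi : R :=
  \int[sub_prob A]_x (integrate_out_compl psi x - mean psi) ^+ 2.

Definition sigma2 psi : R := \int[prod_prob mu]_x (psi x - mean psi) ^+ 2.

(* mu_k is read as the law sub_prob [set k] on the one-factor product *)
Definition sigma2_times psi : R := \sum_i sq_dev [set i]%SET psi.

Definition var_times (N : nat) psi : R :=
  \sum_(A : {set I} | A != finset.set0) (N%:R ^+ #|A|)^-1 *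
    \sum_(B : {set I} | B \subset A) (-1) ^+ (#|A| - #|B|) * sq_dev B psi.

End partial_integration.

Section estimators.
Context (I : finType) (d : I -> measure_display).
Variables (S : forall i, measurableType (d i)) (R : realType) (Omega : Type).
Variable X : nat -> Omega -> prod_space S.
Implicit Types (psi w phi : prod_space S -> R) (N : nat).

(* The sample X^1, ..., X^N is X 0, ..., X N.-1. *)
Definition muN N psi (omega : Omega) : R :=
  N%:R^-1 * \sum_(n < N) psi (X n omega).

Definition muN_times N psi (omega : Omega) : R :=
  (N%:R ^+ #|I|)^-1 *
    \sum_(n : {ffun I -> 'I_N}) psi (fun i => X (n i) omega i).

Definition gammaN w N phi : Omega -> R := muN N (w \* phi).

Definition gammaN_times w N phi : Omega -> R := muN_times N (w \* phi).

End estimators.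

Section probability_notions.
Context d (Omega : measurableType d) (R : realType) (P : probability Omega R).

Definition mutually_independent d' (T : measurableType d')
    (X : nat -> {mfun Omega >-> T}) :=
  forall (J : seq nat) (A : nat -> set T), uniq J ->
    (forall n, measurable (A n)) ->
    P (\bigcap_(n in [set` J]) X n @^-1` A n) =
    (\prod_(n <- J) P (X n @^-1` A n))%E.

Definition iid_with_law d' (T : measurableType d')
    (X : nat -> {mfun Omega >-> T}) (law : probability T R) :=
  (forall n A, measurable A -> distribution P (X n) A = law A) /\
  mutually_independent X.

Definition cvg_in_distribution (Y : nat -> Omega -> R)
    (law : probability (measurableTypeR R) R) :=
  forall f : R -> R, continuous f -> (exists M, forall x, `|f x| <= M) ->
    ('E_P[f \o Y N] @[N --> \oo] --> \int[law]_x (f x)%:E)%E.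

(* parametrized by the variance v >= 0; [normal_prob m 0] is a uniform law,
   not the point mass at m *)
Definition gaussian (m v : R) : probability (measurableTypeR R) R :=
  if v == 0 then (\d_(m : measurableTypeR R) : probability _ R)
  else normal_prob m (Num.sqrt v).

Definition scaled_error (Y : nat -> Omega -> R) (c : R) (N : nat) : Omega -> R :=
  fun omega => Num.sqrt N%:R * (Y N omega - c).

(* variance of the Gaussian limit of the centred and scaled Y N (a limit law is
   unique); 0 if there is no such limit *)
Definition asymptotic_variance (Y : nat -> Omega -> R) (c : R) : R :=
  xget 0 [set v : R | 0 <= v /\
    cvg_in_distribution (scaled_error Y c) (gaussian 0 v)].

End probability_notions.

(* Main.v *)
Require Import Defs.
From HB Require Import structures.
From mathcomp Require Import all_boot all_order all_algebra.
From mathcomp Require Import all_classical all_reals all_analysis.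
From mathcomp Require Import measurable_realfun.
From mathcomp Require Import ring lra.

Set Implicit Arguments.
Unset Strict Implicit.
Unset Printing Implicit Defensive.

Import Order.TTheory GRing.Theory Num.Theory.
Import numFieldNormedType.Exports.

Local Open Scope classical_set_scope.
Local Open Scope ring_scope.

(** Write [psi = w * phi] and [mu = \prod_i mu i]. Changing measure turns
    [gamma phi] into [mu psi], so everything is about the two averages of [psi]:
    the standard one, over [X 0, ..., X (N-1)], and the product one, over all
    points [mpoint X n] whose [i]-th coordinate is that of [X (n i)].

    Unbiasedness holds because every [mpoint X n] has law [mu]: its coordinates
    are independent, whether or not they come from the same sample point.

    Second moments rest on one fact ([expectation_mpointM]): for centred [psi]
    the covariance of [psi (mpoint X n)] and [psi (mpoint X m)] depends only on
    the set [D] of coordinates where [n] and [m] agree, and equals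
    [c D = sq_dev mu D psi]. Given the coordinates in [D], the two points are
    conditionally independent, whence the square of the partial integral.
    Counting the pairs with agreement set [D] gives
      [Var (muN_times) = N^-K * \sum_D c D * (N-1)^(K-|D|)],
    and expanding [(N-1)^(K-|D|)] gives the alternating sum of the statement
    ([sum_moebius]). The same count shows that the covariance of the two
    averages is again [Var (muN_times)], so that
      [Var (muN) - Var (muN_times) = E (muN - muN_times)^2 >= 0].

    Asymptotics come from the Hajek projection [hajek mu psi], the sum over [k]
    of the centred partial integrals that keep only the [k]-th coordinate. Its
    second moment is [sigma2_times mu psi], and the product average minus its
    mean differs from the standard average of the projection by a remainder
    whose second moment is at most [C / N^2] ([remainder_sqr_le]), since only the
    sets [D] with at least two elements contribute positively to it. This bound is summable, so the
    remainder tends to [0] almost surely, and still does so in quadratic mean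
    after scaling by [sqrt N]. Hence the product average inherits its strong law
    and its central limit theorem from i.i.d. averages. The inequality of the
    asymptotic variances says that a projection has a smaller norm.

    The limit theorems for i.i.d. square-integrable variables are obtained
    without characteristic functions. The strong law uses second moments along
    the squares [N = n^2] and controls the gaps between consecutive squares. The
    central limit theorem is first proved for the test functions
    [x |-> heat s (x - a)], where [heat] is the heat kernel up to a constant
    factor: replacing the summands one at a time while increasing the time
    parameter (Lindeberg) costs little, because the heat equation cancels the
    second-order terms. A Gaussian law is characterised on these test functions
    by the semigroup property ([Rintegral_gaussian_heat]). Finally, every
    compactly supported continuous function is a uniform limit of mixtures of
    such kernels, and a cutoff argument extends the convergence to bounded
    continuous functions ([heat_cvg_in_distribution]). Evaluating a kernel at
    its centre also shows that the limiting variance is unique, which identifies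
    [asymptotic_variance]. *)

(** * Products of integrals and square-integrable functions *)

Section tensor.
Context d1 d2 (T1 : measurableType d1) (T2 : measurableType d2) (R : realType).
Variables (m1 : {sigma_finite_measure set T1 -> \bar R})
  (m2 : {sigma_finite_measure set T2 -> \bar R}).
Variables (f : T1 -> R) (g : T2 -> R).
Hypothesis intf : m1.-integrable setT (EFin \o f).
Hypothesis intg : m2.-integrable setT (EFin \o g).

Lemma integrable_tensor :
  (m1 \x m2)%E.-integrable setT (fun z => (f z.1 * g z.2)%:E).
Proof.
have mf : measurable_fun setT f by apply/measurable_EFinP; exact: measurable_int intf.
have mg : measurable_fun setT g by apply/measurable_EFinP; exact: measurable_int intg.
apply/integrable12ltyP => /=.
  by apply/measurable_EFinP; apply: measurable_funM => //; exact: measurableT_comp.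
have -> : (fun x => \int[m2]_y `|(f x * g y)%:E|)%E =
          (fun x => `|(f x)%:E| * (\int[m2]_y `|(g y)%:E|))%E.
  apply/funext => x; rewrite -ge0_integralZl//.
    by apply: eq_integral => y _; rewrite EFinM abseM.
  exact/measurableT_comp/measurable_EFinP.
rewrite ge0_integralZr//; last 2 first.
- exact/measurableT_comp/measurable_EFinP.
- exact: integral_ge0.
apply: lte_mul_pinfty; first exact: integral_ge0.
  by rewrite ge0_fin_numE//; [case/integrableP: intf|exact: integral_ge0].
by case/integrableP: intg.
Qed.

Lemma Rintegral_tensor :
  \int[(m1 \x m2)%E]_z (f z.1 * g z.2) = \int[m1]_x f x * \int[m2]_y g y.
Proof.
rewrite [LHS]/Rintegral -integral12_prod_meas1//; last exact: integrable_tensor.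
rewrite /fubini_F/= (eq_integral (fun x => (f x)%:E * (\int[m2]_y (g y)%:E))%E); last first.
  by move=> x _; rewrite -integralZl.
have fG : (\int[m2]_y (g y)%:E \is a fin_num)%E by exact: integrable_fin_num intg.
have fF : (\int[m1]_y (f y)%:E \is a fin_num)%E by exact: integrable_fin_num intf.
by rewrite -(fineK fG) integralZr// -(fineK fF).
Qed.

End tensor.

(** [product_measure1E] with both factors seen as probabilities; stated apart
    because unification does not find this instance on the product probability. *)
Lemma product_probabilityE d1 d2 (T1 : measurableType d1) (T2 : measurableType d2)
    (R : realType) (P1 : probability T1 R) (P2 : probability T2 R) A B :
  measurable A -> measurable B -> ((P1 \x P2) (A `*` B) = P1 A * P2 B)%E.
Proof. exact: product_measure1E. Qed.

Section Lfun2.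
Context d (T : measurableType d) (R : realType) (P : probability T R).
Implicit Types f g : T -> R.

Lemma Lfun2P f : measurable_fun setT f ->
  P.-integrable setT (fun x => (f x ^+ 2)%:E) -> f \in Lfun P 2%:E.
Proof.
move=> mf /integrableP[_ foo]; rewrite inE/=; apply/andP; split; rewrite inE//=.
rewrite /finite_norm unlock poweR_lty//; apply: le_lt_trans foo.
rewrite le_eqVlt; apply/orP; left; apply/eqP; apply: eq_integral => x _.
by rewrite abse_EFin poweR_EFin powR_mulrn// -normrX.
Qed.

Lemma Lfun2_measurable f : f \in Lfun P 2%:E -> measurable_fun setT f.
Proof. by rewrite inE => /andP[+ _]; rewrite inE. Qed.

Lemma Lfun2_integrable f : f \in Lfun P 2%:E -> P.-integrable setT (EFin \o f).
Proof. by move=> f2; apply/Lfun1_integrable; apply: Lfun_subset12; rewrite ?fin_num_measure. Qed.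

Lemma Lfun2_integrableM f g : f \in Lfun P 2%:E -> g \in Lfun P 2%:E ->
  P.-integrable setT (fun x => (f x * g x)%:E).
Proof. by move=> f2 g2; have /Lfun1_integrable := Lfun2_mul_Lfun1 f2 g2. Qed.

Lemma Lfun2_cst c : (fun=> c) \in Lfun P 2%:E.
Proof. exact: Lfun_cst. Qed.

Lemma Lfun2D f g : f \in Lfun P 2%:E -> g \in Lfun P 2%:E ->
  (fun x => f x + g x) \in Lfun P 2%:E.
Proof.
have p1 : (1 <= (2%:E : \bar R))%E by rewrite lee1n.
by have [_ fgD] := Lfun_addr_closed P p1; exact: fgD.
Qed.

Lemma Lfun2Zl c f : f \in Lfun P 2%:E -> (fun x => c * f x) \in Lfun P 2%:E.
Proof.
move=> f2; have -> : (fun x => c * f x) = c \o* f by apply/funext => x /=; rewrite mulrC.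
by apply: Lfun_scale => //; rewrite ler1n.
Qed.

Lemma Lfun2B f g : f \in Lfun P 2%:E -> g \in Lfun P 2%:E ->
  (fun x => f x - g x) \in Lfun P 2%:E.
Proof.
move=> f2 g2; have -> : (fun x => f x - g x) = (fun x => f x + (-1) * g x).
  by apply/funext => x; rewrite mulN1r.
by apply: Lfun2D => //; exact: Lfun2Zl.
Qed.

Lemma Lfun2_sum (J : Type) (s : seq J) (Q : pred J) (f : J -> T -> R) :
  (forall j, Q j -> f j \in Lfun P 2%:E) ->
  (fun x => \sum_(j <- s | Q j) f j x) \in Lfun P 2%:E.
Proof.
move=> f2; elim: s => [|j s ih].
  have -> : (fun x => \sum_(j <- [::] | Q j) f j x) = fun=> 0.
    by apply/funext => x; rewrite big_nil.
  exact: Lfun2_cst.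
have -> : (fun x => \sum_(j <- j :: s | Q j) f j x) =
    if Q j then (fun x => f j x + \sum_(j <- s | Q j) f j x)
    else (fun x => \sum_(j <- s | Q j) f j x).
  by apply/funext => x; rewrite big_cons; case: ifP.
by case: ifPn => [Qj|//]; exact: Lfun2D (f2 j Qj) ih.
Qed.

Lemma Rintegral_sum (J : Type) (s : seq J) (Q : pred J) (f : J -> T -> R) :
  (forall j, Q j -> P.-integrable setT (EFin \o f j)) ->
  \int[P]_x (\sum_(j <- s | Q j) f j x) = \sum_(j <- s | Q j) \int[P]_x f j x.
Proof.
move=> intf; have iS (r : seq J) : P.-integrable setT
    (EFin \o (fun x => \sum_(j <- r | Q j) f j x)).
  have := @integrable_sum _ _ _ P _ measurableT _ r Q (fun j => EFin \o f j) intf.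
  by congr (integrable _ _ _); apply/funext => x /=; rewrite sumEFin.
elim: s => [|j s ih]; first by under eq_Rintegral do rewrite big_nil; rewrite Rintegral_cst// mul0r big_nil.
under eq_Rintegral do rewrite big_cons; rewrite big_cons.
by case: ifPn => [Qj|//]; rewrite RintegralD// ?ih//; exact: intf.
Qed.

Lemma Rintegral_sumM (J K : Type) (r : seq J) (s : seq K) (Q : pred J) (Q' : pred K)
    (f : J -> T -> R) (g : K -> T -> R) :
  (forall j, Q j -> f j \in Lfun P 2%:E) -> (forall k, Q' k -> g k \in Lfun P 2%:E) ->
  \int[P]_x ((\sum_(j <- r | Q j) f j x) * (\sum_(k <- s | Q' k) g k x)) =
  \sum_(j <- r | Q j) \sum_(k <- s | Q' k) \int[P]_x (f j x * g k x).
Proof.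
move=> f2 g2.
under eq_Rintegral do rewrite mulr_suml.
rewrite Rintegral_sum; last first.
  by move=> j Qj; apply: Lfun2_integrableM; [exact: f2|exact: Lfun2_sum].
apply: eq_bigr => j Qj; under eq_Rintegral do rewrite mulr_sumr.
by rewrite Rintegral_sum// => k Qk; apply: Lfun2_integrableM; [exact: f2|exact: g2].
Qed.

Lemma Rintegral_cst1 (c : R) : \int[P]_x c = c.
Proof. by rewrite Rintegral_cst// [X in _ * fine X]probability_setT mulr1. Qed.

End Lfun2.

(** * Laws and independence *)
Section laws.
Context d (T : measurableType d) (R : realType) (P : probability T R).

(** The law is a bare set function, so that the definition applies to random
    elements that are not bundled with their measurability, and to laws given as
    products or images of measures. *)
Definition has_law d' (T' : measurableType d') (U : T -> T')
    (nu : set T' -> \bar R) :=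
  measurable_fun setT U /\ forall B, measurable B -> P (U @^-1` B) = nu B.

Section transfer.
Context d' (T' : measurableType d') (U : T -> T').
Variable nu : {measure set T' -> \bar R}.
Hypothesis lawU : has_law U nu.

Let mU : measurable_fun setT U := lawU.1.

Let U' : {mfun T >-> T'} := mfun_Sub (mem_set mU).

Lemma law_ge0_integral (f : T' -> \bar R) : measurable_fun setT f -> (forall y, 0 <= f y)%E ->
  (\int[P]_x f (U x) = \int[nu]_y f y)%E.
Proof.
move=> mf f0; rewrite -(ge0_integral_distribution U')//.
by apply: eq_measure_integral => B mB _; rewrite -lawU.2.
Qed.

Lemma law_integrable (f : T' -> \bar R) : nu.-integrable setT f ->
  P.-integrable setT (f \o U).
Proof.
move=> /integrableP[mf foo]; apply/integrableP; split.
  exact: measurableT_comp mf mU.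
rewrite (law_ge0_integral (f := fun y => `|f y|%E))//.
exact: measurableT_comp.
Qed.

Lemma law_integrableE (f : T' -> \bar R) : measurable_fun setT f -> P.-integrable setT (f \o U) ->
  nu.-integrable setT f.
Proof.
move=> mf /integrableP[_ foo]; apply/integrableP; split=> //.
rewrite -(law_ge0_integral (f := fun y => `|f y|%E))//.
exact: measurableT_comp.
Qed.

Lemma law_integral (f : T' -> \bar R) : nu.-integrable setT f ->
  (\int[P]_x f (U x) = \int[nu]_y f y)%E.
Proof.
move=> intf; have mf := measurable_int _ intf.
transitivity (\int[distribution P U']_y f y)%E.
  by rewrite integral_distribution//; exact: law_integrable.
by apply: eq_measure_integral => B mB _; rewrite -lawU.2.
Qed.

Lemma law_Rintegral (f : T' -> R) : nu.-integrable setT (EFin \o f) ->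
  \int[P]_x f (U x) = \int[nu]_y f y.
Proof. by move=> intf; rewrite /Rintegral -law_integral. Qed.

Lemma law_Lfun2 (f : T' -> R) : measurable_fun setT f ->
  nu.-integrable setT (fun y => (f y ^+ 2)%:E) -> f \o U \in Lfun P 2%:E.
Proof.
move=> mf if2; apply: Lfun2P; first exact: measurableT_comp mf mU.
exact: (law_integrable if2).
Qed.

End transfer.

Definition independent d1 d2 (T1 : measurableType d1) (T2 : measurableType d2)
    (U : T -> T1) (V : T -> T2) :=
  forall A B, measurable A -> measurable B ->
    P ((U @^-1` A) `&` (V @^-1` B)) = (P (U @^-1` A) * P (V @^-1` B))%E.

Lemma independent_comp d1 d2 d3 d4 (T1 : measurableType d1)
    (T2 : measurableType d2) (T3 : measurableType d3) (T4 : measurableType d4)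
    (U : T -> T1) (V : T -> T2) (f : T1 -> T3) (g : T2 -> T4) :
  measurable_fun setT f -> measurable_fun setT g ->
  independent U V -> independent (f \o U) (g \o V).
Proof.
move=> mf mg UV A B mA mB; apply: (UV (f @^-1` A) (g @^-1` B)).
  by rewrite -[f @^-1` A]setTI; exact: mf.
by rewrite -[g @^-1` B]setTI; exact: mg.
Qed.

(** Independence says that the joint law of [F] and [G] is the product of their
    laws; Fubini then factors the integral. *)
Lemma independent_Rintegral (F G : T -> R) : independent F G ->
  P.-integrable setT (EFin \o F) -> P.-integrable setT (EFin \o G) ->
  \int[P]_x (F x * G x) = \int[P]_x F x * \int[P]_x G x.
Proof.
move=> FG iF iG.
have mF : measurable_fun setT F by apply/measurable_EFinP; exact: measurable_int iF.
have mG : measurable_fun setT G by apply/measurable_EFinP; exact: measurable_int iG.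
pose PF := distribution P (mfun_Sub (mem_set mF)).
pose PG := distribution P (mfun_Sub (mem_set mG)).
have lF : has_law F PF by split.
have lG : has_law G PG by split.
have lFG : has_law (fun x => (F x, G x)) (PF \x PG)%E.
  split=> [|B mB]; first exact: measurable_fun_pair.
  have mFG : measurable_fun setT (fun x => (F x, G x)) by exact: measurable_fun_pair.
  apply/esym; apply: (product_measure_unique
    (m' := distribution P (mfun_Sub (mem_set mFG)))) => // A C mA mC; exact: FG.
have iPF : PF.-integrable setT (EFin \o idfun).
  by apply: (law_integrableE lF); [exact/measurable_EFinP/measurable_id|exact: iF].
have iPG : PG.-integrable setT (EFin \o idfun).
  by apply: (law_integrableE lG); [exact/measurable_EFinP/measurable_id|exact: iG].
have -> : \int[P]_x (F x * G x) = \int[(PF \x PG)%E]_z (z.1 * z.2).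
  by rewrite -(law_Rintegral lFG)//; exact: (integrable_tensor iPF iPG).
by rewrite (Rintegral_tensor iPF iPG) -(law_Rintegral lF iPF) -(law_Rintegral lG iPG).
Qed.

End laws.

Section product_spaces.
Context (I : finType) (d : I -> measure_display).
Variables (S : forall i, measurableType (d i)) (R : realType).

(** Boxes form a pi-system that generates the product sigma-algebra. *)
Lemma prod_space_measure_unique (m1 m2 : {measure set (prod_space S) -> \bar R}) :
  (m1 setT < +oo)%E ->
  (forall A, (forall i, measurable (A i)) -> m1 (box A) = m2 (box A)) ->
  forall B, measurable B -> m1 B = m2 B.
Proof.
move=> m1oo m12 B mB.
pose G := [set box A | A in [set A : forall i, set (S i) | forall i, measurable (A i)]].
have GT : G setT.
  by exists (fun=> setT) => //; apply/seteqP; split.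
apply: (measure_unique G (fun=> setT)) => //; last 2 first.
- by apply/seteqP; split=> // x _; exists 0%N.
- by move=> _ [A mA <-]; exact: m12.
- apply/seteqP; split=> [C|C].
    apply: smallest_sub; first exact: smallest_sigma_algebra.
    move=> _ [i _ [A mA <-]]; apply: sub_sigma_algebra; rewrite setTI.
    exists (dfwith (fun=> setT) i A) => [j|].
      by case: dfwithP => // *; exact: measurableT.
    apply/seteqP; split=> [x /(_ i)|x xA j]; first by rewrite dfwithin.
    by case: dfwithP.
  apply: smallest_sub; first exact: sigma_algebra_measurable.
  by move=> _ [A mA <-]; exact: measurable_box.
- move=> _ _ [A mA <-] [A' mA' <-]; exists (fun i => A i `&` A' i).
    by move=> i; exact: measurableI.
  by apply/seteqP; split=> [x xA|x [xA xA'] i]; split=> // i; have [] := xA i.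
Qed.

End product_spaces.

Lemma law_prod_space (I : finType) (d : I -> measure_display)
    (S : forall i, measurableType (d i)) (R : realType)
    (d0 : measure_display) (T : measurableType d0) (P : probability T R)
    (U : T -> prod_space S) (nu : {measure set (prod_space S) -> \bar R}) :
  measurable_fun setT U ->
  (forall A, (forall i, measurable (A i)) ->
    P [set x | forall i, A i (U x i)] = nu (box A)) ->
  has_law P U nu.
Proof.
move=> mU boxE; split=> // B mB.
apply: (prod_space_measure_unique (m1 := distribution P (mfun_Sub (mem_set mU)))) => //.
by rewrite [X in (X < _)%E](_ : _ = 1%E) ?ltry//; exact: probability_setT.
Qed.

(** For a fixed event [E], both sides are finite measures in [A]; they agree on
    boxes, hence everywhere. *)
Lemma prod_space_independent_event (I : finType) (d : I -> measure_display)
    (S : forall i, measurableType (d i)) (R : realType)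
    (d0 : measure_display) (T : measurableType d0) (P : probability T R)
    (U : T -> prod_space S) (E : set T) :
  measurable_fun setT U -> measurable E ->
  (forall A, (forall i, measurable (A i)) ->
    P ((U @^-1` box A) `&` E) = (P (U @^-1` box A) * P E)%E) ->
  forall A, measurable A -> P ((U @^-1` A) `&` E) = (P (U @^-1` A) * P E)%E.
Proof.
move=> mU mE UE A mA.
have p0 : 0 <= fine (P E) by exact: fine_ge0.
pose U' : {mfun T >-> prod_space S} := mfun_Sub (mem_set mU).
pose m1' := pushforward (mrestr P mE) U' : {measure set _ -> \bar R}.
pose m1 := m1' mU.
pose m2 := mscale (NngNum p0) (distribution P U').
have -> : P (U @^-1` A `&` E) = m1 A by [].
have pE : P E = (fine (P E))%:E by rewrite fineK// fin_num_measure.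
have -> : (P (U @^-1` A) * P E)%E = m2 A by rewrite muleC pE.
apply: prod_space_measure_unique => //.
  rewrite /m1/= /pushforward/mrestr/= preimage_setT setTI.
  by rewrite (le_lt_trans (probability_le1 P mE))// ltry.
by move=> A' mA'; rewrite [LHS]UE// muleC [X in (X * _)%E]pE.
Qed.

(** Two applications of the previous lemma, one for each variable. *)
Lemma independent_boxes (I1 I2 : finType) (d1 : I1 -> measure_display)
    (d2 : I2 -> measure_display) (S1 : forall i, measurableType (d1 i))
    (S2 : forall i, measurableType (d2 i)) (R : realType)
    (d0 : measure_display) (T : measurableType d0) (P : probability T R)
    (U : T -> prod_space S1) (V : T -> prod_space S2) :
  measurable_fun setT U -> measurable_fun setT V ->
  (forall A C, (forall i, measurable (A i)) -> (forall i, measurable (C i)) ->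
    P ((U @^-1` box A) `&` (V @^-1` box C)) =
    (P (U @^-1` box A) * P (V @^-1` box C))%E) ->
  independent P U V.
Proof.
move=> mU mV UV A B mA mB.
apply: prod_space_independent_event => //.
  by rewrite -[X in measurable X]setTI; exact: mV.
move=> {mA}A mA; rewrite setIC muleC; apply: prod_space_independent_event => //.
  by rewrite -[X in measurable X]setTI; apply: mU => //; exact: measurable_box.
by move=> C mC; rewrite setIC muleC UV.
Qed.

(** * Splitting a point along a set of coordinates *)

Local Notation glue := Defs.glue.

Section glueing.
Context (I : finType) (d : I -> measure_display).
Variables (S : forall i, measurableType (d i)) (R : realType).
Variable mu : forall i, probability (S i) R.
Implicit Types D : {set I}.

Definition restr D (x : prod_space S) : sub_space S D := fun s => x (val s).

Arguments restr D x : clear implicits.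

Lemma glue_in D (x : sub_space S D) (y : sub_space S (~: D)) i (iD : i \in D) :
  glue x y i = x (exist _ i iD).
Proof.
rewrite /glue; refine (match boolP (i \in D) as a return
  (match a with
   | AltTrue iA => x (exist _ i iA)
   | AltFalse iNA => y (exist _ i (etrans (finset.in_setC i D) iNA))
   end = x (exist _ i iD)) with AltTrue iA => _ | AltFalse iNA => _ end).
  by rewrite (bool_irrelevance iA iD).
by exfalso; rewrite iD in iNA.
Qed.

Lemma glue_out D (x : sub_space S D) (y : sub_space S (~: D)) i (iD : i \in ~: D) :
  glue x y i = y (exist _ i iD).
Proof.
rewrite /glue; refine (match boolP (i \in D) as a return
  (match a with
   | AltTrue iA => x (exist _ i iA)
   | AltFalse iNA => y (exist _ i (etrans (finset.in_setC i D) iNA))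
   end = y (exist _ i iD)) with AltTrue iA => _ | AltFalse iNA => _ end).
  by exfalso; move: (iD); rewrite finset.in_setC iA.
by rewrite (bool_irrelevance (etrans _ _) iD).
Qed.

Lemma glueP D (A : forall i, set (S i)) (x : sub_space S D) (y : sub_space S (~: D)) :
  (forall i, A i (glue x y i)) <->
  (forall s, A (val s) (x s)) /\ (forall s, A (val s) (y s)).
Proof.
split=> [Axy|[Ax Ay] i].
  by split=> -[i iD] /=; have := Axy i; [rewrite glue_in|rewrite glue_out].
case: (boolP (i \in D)) => iD; first by rewrite glue_in; exact: (Ax (exist _ i iD)).
have iD' : i \in ~: D by rewrite finset.in_setC.
by rewrite glue_out; exact: (Ay (exist _ i iD')).
Qed.

Lemma restr_glue D (x : sub_space S D) (y : sub_space S (~: D)) :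
  restr D (glue x y) = x :> sub_space S D.
Proof.
by apply: functional_extensionality_dep => -[i iD]; rewrite /restr glue_in.
Qed.

Lemma measurable_restr D : measurable_fun setT (@restr D).
Proof. by apply: measurable_to_prod => s; exact: measurable_coord. Qed.

Lemma measurable_glue D d' (T : measurableType d') (f : T -> sub_space S D)
    (g : T -> sub_space S (~: D)) :
  measurable_fun setT f -> measurable_fun setT g ->
  measurable_fun setT (fun t => glue (f t) (g t) : prod_space S).
Proof.
move=> mf mg; apply: measurable_to_prod => i.
case: (boolP (i \in D)) => iD.
  under eq_fun do rewrite glue_in.
  exact: (measurableT_comp (@measurable_coord _ _ (fun s : {i | i \in D} => S (val s)) (exist _ i iD)) mf).
have iD' : i \in ~: D by rewrite finset.in_setC.
under eq_fun do rewrite glue_out.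
exact: (measurableT_comp (@measurable_coord _ _ (fun s : {i | i \in ~: D} => S (val s)) (exist _ i iD')) mg).
Qed.

Lemma sub_prob_box D (A : forall i, set (S i)) : (forall i, measurable (A i)) ->
  (sub_prob mu D (box (fun s : {i | i \in D} => A (val s))) =
   \prod_(i in D) mu i (A i))%E.
Proof. by move=> mA; rewrite /sub_prob prod_prob_box// [RHS]big_sub. Qed.

Lemma law_glue D : has_law (sub_prob mu D \x sub_prob mu (~: D))%E
  (fun z => glue z.1 z.2) (prod_prob mu).
Proof.
apply: law_prod_space; first by apply: measurable_glue.
move=> A mA.
have -> : [set z : sub_space S D * sub_space S (~: D) | forall i, A i (glue z.1 z.2 i)] =
    box (fun s : {i | i \in D} => A (val s)) `*` box (fun s : {i | i \in ~: D} => A (val s)).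
  by apply/seteqP; split=> [[x y]/glueP//|[x y] /= xy]; exact/glueP.
etransitivity; first by apply: product_probabilityE; exact: measurable_box.
rewrite /= !sub_prob_box// prod_prob_box//.
rewrite [RHS](bigID (mem D))/=; congr (_ * _)%E.
by apply: eq_bigl => i; rewrite finset.in_setC.
Qed.

Lemma law_restr D : has_law (prod_prob mu) (@restr D) (sub_prob mu D).
Proof.
split=> [|B mB]; first exact: measurable_restr.
have mB' : measurable (@restr D @^-1` B).
  by rewrite -[X in measurable X]setTI; exact: measurable_restr.
rewrite -(law_glue D).2//.
have -> : (fun z : sub_space S D * sub_space S (~: D) => glue z.1 z.2) @^-1`
    (@restr D @^-1` B) = B `*` setT.
  by apply/seteqP; split=> -[x y] /=; rewrite restr_glue//; case.
etransitivity; first exact: product_probabilityE.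
by rewrite probability_setT mule1.
Qed.

(** The model of a pair of points that agree on [D] and are otherwise
    independent: the pair is indexed by [bool * I], so that it is again a point
    of a product space and its law is determined on boxes. *)
Definition twins D (t : sub_space S D * (sub_space S (~: D) * sub_space S (~: D))) :
    prod_space (fun p : bool * I => S p.2) :=
  fun p => glue t.1 (if p.1 then t.2.1 else t.2.2) p.2.

Lemma measurable_twins D : measurable_fun setT (@twins D).
Proof.
apply: measurable_to_prod => -[b i] /=.
have mg : measurable_fun setT (fun t : sub_space S D *
    (sub_space S (~: D) * sub_space S (~: D)) => glue t.1 (if b then t.2.1 else t.2.2)).
  by apply: measurable_glue => //; case: b; exact: measurableT_comp.
exact: (measurableT_comp (@measurable_coord _ _ S i) mg).
Qed.

Definition twins_prob D :
    probability (prod_space (fun p : bool * I => S p.2)) R :=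
  distribution (sub_prob mu D \x (sub_prob mu (~: D) \x sub_prob mu (~: D)))%E
    (mfun_Sub (mem_set (@measurable_twins D))).

Lemma twins_prob_box D (A : forall p : bool * I, set (S p.2)) :
  (forall p, measurable (A p)) ->
  (twins_prob D (box A) = \prod_i
    (if i \in D then mu i (A (true, i) `&` A (false, i))
     else mu i (A (true, i)) * mu i (A (false, i))))%E.
Proof.
move=> mA.
transitivity ((sub_prob mu D \x (sub_prob mu (~: D) \x sub_prob mu (~: D)))%E
    (box (fun s : {i | i \in D} => A (true, val s) `&` A (false, val s)) `*`
    (box (fun s : {i | i \in ~: D} => A (true, val s)) `*`
     box (fun s : {i | i \in ~: D} => A (false, val s))))).
  have -> : box (fun s : {i | i \in D} => A (true, val s) `&` A (false, val s)) `*`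
    (box (fun s : {i | i \in ~: D} => A (true, val s)) `*`
     box (fun s : {i | i \in ~: D} => A (false, val s))) = @twins D @^-1` box A;
    last by [].
  apply/esym/seteqP; split=> [[x [y z]] Axyz|[x [y z]] [Ax [Ay Az]] [b i]].
    have [Ax Ay] := (glueP (fun i => A (true, i)) x y).1 (fun i => Axyz (true, i)).
    have [Ax' Az] := (glueP (fun i => A (false, i)) x z).1 (fun i => Axyz (false, i)).
    split=> [s|]; first by split; [exact: Ax|exact: Ax'].
    by split=> s; [exact: Ay|exact: Az].
  case: b.
    by move: i; apply/(glueP (fun i => A (true, i))); split=> // s; case: (Ax s).
  by move: i; apply/(glueP (fun i => A (false, i))); split=> // s; case: (Ax s).
etransitivity.
  apply: product_probabilityE; first (apply: measurable_box => s;
    by apply: measurableI; [exact: (mA (true, val s))|exact: (mA (false, val s))]).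
  by apply: measurableX; apply: measurable_box => s;
    [exact: (mA (true, val s))|exact: (mA (false, val s))].
rewrite [X in (_ * X)%E](_ : _ = (sub_prob mu (~: D)
      (box (fun s : {i | i \in ~: D} => A (true, val s))) *
    sub_prob mu (~: D) (box (fun s : {i | i \in ~: D} => A (false, val s))))%E); last first.
  by apply: product_probabilityE; apply: measurable_box => s;
    [exact: (mA (true, val s))|exact: (mA (false, val s))].
rewrite (sub_prob_box _ (A := fun i => A (true, i) `&` A (false, i))); last first.
  by move=> i; apply: measurableI; [exact: (mA (true, i))|exact: (mA (false, i))].
rewrite (sub_prob_box _ (A := fun i => A (true, i))); last by move=> i; exact: (mA (true, i)).
rewrite (sub_prob_box _ (A := fun i => A (false, i))); last by move=> i; exact: (mA (false, i)).
rewrite -big_split/= [RHS](bigID (mem D))/=; congr (_ * _)%E.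
  by apply: eq_bigr => i ->.
by apply: eq_big => [i|i]; rewrite finset.in_setC// => /negbTE ->.
Qed.

Section partial_integrals.
Variable psi : prod_space S -> R.
Hypothesis mpsi : measurable_fun setT psi.
Hypothesis ppsi : partially_integrable mu psi.

Lemma integrate_out_complB D c (x : sub_space S D) :
  integrate_out_compl mu (fun z => psi z - c) x = integrate_out_compl mu psi x - c.
Proof.
rewrite /integrate_out_compl (RintegralB measurableT (ppsi x))//.
  by rewrite Rintegral_cst1.
exact: (finite_measure_integrable_cst (sub_prob mu (~: D)) c measurableT).
Qed.

Lemma partially_integrableB c : partially_integrable mu (fun z => psi z - c).
Proof.
move=> D x; have := integrableB measurableT (ppsi x)
  (finite_measure_integrable_cst (sub_prob mu (~: D)) c measurableT).
by congr (integrable _ _ _); apply/funext => y.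
Qed.

Hypothesis ipsi : (prod_prob mu).-integrable setT (EFin \o psi).

Let ipsi_glue D : (sub_prob mu D \x sub_prob mu (~: D))%E.-integrable setT
  (fun z => (psi (glue z.1 z.2))%:E).
Proof. exact: (law_integrable (law_glue D) ipsi). Qed.

Lemma integrate_out_complE D (x : sub_space S D) :
  ((integrate_out_compl mu psi x)%:E = \int[sub_prob mu (~: D)]_y (psi (glue x y))%:E)%E.
Proof. by rewrite fineK//; exact: (integrable_fin_num _ (ppsi x)). Qed.

Lemma integrable_integrate_out_compl D :
  (sub_prob mu D).-integrable setT (EFin \o @integrate_out_compl _ _ _ _ mu D psi).
Proof.
have := integrable_fubini_F (ipsi_glue D).
by congr (integrable _ _ _); apply/funext => x; rewrite /= integrate_out_complE.
Qed.

Lemma Rintegral_integrate_out_compl D :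
  \int[sub_prob mu D]_x integrate_out_compl mu psi x = \int[prod_prob mu]_x psi x.
Proof.
rewrite -(law_Rintegral (law_glue D) ipsi)/Rintegral -integral12_prod_meas1//.
by congr fine; apply: eq_integral => x _; rewrite integrate_out_complE.
Qed.

(** The partial integral is the conditional expectation of [psi] given the
    coordinates in [D], so it may replace [psi] against functions of those. *)
Lemma Rintegral_restr D (h : sub_space S D -> R) :
  (prod_prob mu).-integrable setT (fun x => (psi x * h (restr D x))%:E) ->
  \int[prod_prob mu]_x (psi x * h (restr D x)) =
  \int[sub_prob mu D]_x (integrate_out_compl mu psi x * h x).
Proof.
move=> ih; rewrite -(law_Rintegral (law_glue D) ih)/Rintegral.
have ih' := law_integrable (law_glue D) ih.
rewrite -integral12_prod_meas1//; congr fine; apply: eq_integral => x _.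
rewrite /fubini_F EFinM integrate_out_complE muleC -(integralZl measurableT (ppsi x)).
by apply: eq_integral => y _; rewrite /= restr_glue mulrC EFinM.
Qed.

End partial_integrals.

(** Given the shared coordinates, the two remaining blocks are independent with
    the same law, so the inner integral of the product is a square. *)
Lemma Rintegral_twins (psi : prod_space S -> R) D : partially_integrable mu psi ->
  (twins_prob D).-integrable setT
    (fun t => (psi (fun i => t (true, i)) * psi (fun i => t (false, i)))%:E) ->
  (sub_prob mu D).-integrable setT (fun x => (integrate_out_compl mu psi x ^+ 2)%:E) /\
  \int[twins_prob D]_t (psi (fun i => t (true, i)) * psi (fun i => t (false, i))) =
  \int[sub_prob mu D]_x integrate_out_compl mu psi x ^+ 2.
Proof.
move=> ppsi itwins.
have lt : has_law (sub_prob mu D \x (sub_prob mu (~: D) \x sub_prob mu (~: D)))%E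
    (@twins D) (twins_prob D).
  by split=> //; exact: measurable_twins.
have it := law_integrable lt itwins.
have FE : fubini_F (sub_prob mu (~: D) \x sub_prob mu (~: D))%E
    ((fun t => (psi (fun i => t (true, i)) * psi (fun i => t (false, i)))%:E) \o @twins D)
    = fun x => (integrate_out_compl mu psi x ^+ 2)%:E.
  apply/funext => x; rewrite /fubini_F.
  rewrite expr2 -(Rintegral_tensor (ppsi D x) (ppsi D x)) /Rintegral fineK//.
  apply: integrable_fin_num => //; exact: (integrable_tensor (ppsi D x) (ppsi D x)).
split; first by rewrite -FE; exact: (integrable_fubini_F it).
rewrite -(law_Rintegral lt itwins) /Rintegral -integral12_prod_meas1//.
by rewrite FE.
Qed.

End glueing.
Arguments restr {I d S} D x.

(** * Points that mix coordinates of different sample points *)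
Section sample.
Context (I : finType) (d : I -> measure_display).
Variables (S : forall i, measurableType (d i)) (R : realType).
Variable mu : forall i, probability (S i) R.
Context (d0 : measure_display) (Omega : measurableType d0).
Variable P : probability Omega R.
Variable X : nat -> {mfun Omega >-> prod_space S}.
Hypothesis iidX : iid_with_law P X (prod_prob mu).

Definition mpoint (n : I -> nat) (omega : Omega) : prod_space S :=
  fun i => X (n i) omega i.

Definition agree (n m : I -> nat) : {set I} := [set i | n i == m i].

Lemma measurable_mpoint n : measurable_fun setT (mpoint n).
Proof.
apply: measurable_to_prod => i.
exact: (measurableT_comp (@measurable_coord _ _ S i) (measurable_funPT (X (n i)))).
Qed.

(** A grid of constraints, one for each sample index and coordinate, has the
    product probability; all laws below are read off from this by choosing the
    grid. *)
Lemma prob_cells N (B : nat -> forall i, set (S i)) :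
  (forall j i, measurable (B j i)) ->
  (P [set omega | forall j, (j < N)%N -> forall i, B j i (X j omega i)] =
   \prod_i \prod_(j < N) mu i (B j i))%E.
Proof.
move=> mB.
have -> : [set omega | forall j, (j < N)%N -> forall i, B j i (X j omega i)] =
    \bigcap_(j in [set` iota 0 N]) X j @^-1` box (B j).
  apply/seteqP; split=> [w wB j /=|w wB j jN].
    by rewrite mem_iota add0n => /andP[_]; exact: wB.
  by apply: (wB j); rewrite /= mem_iota.
rewrite iidX.2 ?iota_uniq//; last by move=> j; exact: measurable_box.
rewrite exchange_big/= -[X in iota 0 X]subn0 -[iota _ _]/(index_iota 0 N) big_mkord.
apply: eq_bigr => j _; rewrite -[LHS]/(distribution P (X j) _).
by rewrite iidX.1 ?prod_prob_box//; exact: measurable_box.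
Qed.

Lemma law_mpoint n : has_law P (mpoint n) (prod_prob mu).
Proof.
apply: law_prod_space; first exact: measurable_mpoint.
move=> A mA; pose N := (\max_i n i).+1.
have nN i : (n i < N)%N by rewrite ltnS; exact: leq_bigmax.
pose B j i := if j == n i then A i else setT.
have -> : [set x | forall i, A i (mpoint n x i)] =
    [set omega | forall j, (j < N)%N -> forall i, B j i (X j omega i)].
  apply/seteqP; split=> [w wA j _ i|w wB i].
    by rewrite /B; case: eqP => // ->; exact: wA.
  by have := wB (n i) (nN i) i; rewrite /B eqxx.
rewrite prob_cells; last by move=> j i; rewrite /B; case: ifP.
rewrite /= prod_prob_box//; apply: eq_bigr => i _.
rewrite (bigD1 (Ordinal (nN i)))//= /B eqxx big1 ?mule1// => j jn.
by rewrite ifF ?probability_setT//; apply: contraNF jn => /eqP jn; exact/eqP/val_inj.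
Qed.

(** On a box, the coordinate [i] imposes one constraint on each of two sample
    points when [n i <> m i], and two constraints on the same sample point
    otherwise; this is how [twins] splits the coordinates. *)
Lemma law_twins n m : has_law P (fun omega => (fun p => mpoint (if p.1 then n else m) omega p.2)
   : prod_space (fun p : bool * I => S p.2)) (twins_prob mu (agree n m)).
Proof.
apply: law_prod_space.
  apply: measurable_to_prod => -[b i].
  exact: (measurableT_comp (@measurable_coord _ _ S i)
            (measurable_mpoint (if b then n else m))).
move=> A mA; pose N := maxn (\max_i n i).+1 (\max_i m i).+1.
have nN i : (n i < N)%N by rewrite leq_max ltnS leq_bigmax.
have mN i : (m i < N)%N by rewrite leq_max orbC ltnS leq_bigmax.
pose B (j : nat) (i : I) : set (S i) :=
  (if j == n i then (A (true, i) : set (S i)) else setT) `&`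
  (if j == m i then (A (false, i) : set (S i)) else setT).
have -> : [set x | forall p, A p (mpoint (if p.1 then n else m) x p.2)] =
    [set omega | forall j, (j < N)%N -> forall i, B j i (X j omega i)].
  apply/seteqP; split=> [w wA j _ i|w wB [b i] /=].
    rewrite /B; split; case: eqP => // ->.
    - exact: (wA (true, i)).
    - exact: (wA (false, i)).
  case: b => /=.
    by have [] := wB (n i) (nN i) i; rewrite eqxx.
  by have [_] := wB (m i) (mN i) i; rewrite eqxx.
rewrite prob_cells; last first.
  move=> j i; rewrite /B; apply: measurableI; case: ifP => // _.
    exact: (mA (true, i)).
  exact: (mA (false, i)).
rewrite [RHS](twins_prob_box mu (agree n m) mA); apply: eq_bigr => i _.
have -> : (i \in agree n m) = (n i == m i) by rewrite finset.inE.
have [nm|nm] := eqVneq (n i) (m i).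
  rewrite (bigD1 (Ordinal (nN i)))//= big1 => [|j jn]; first by rewrite mule1 /B -nm !eqxx.
  have jn' : (val j == n i) = false.
    by apply: contraNF jn => /eqP jn; exact/eqP/val_inj.
  by rewrite /B -nm jn' setIT probability_setT.
rewrite (bigD1 (Ordinal (nN i)))//= (bigD1 (Ordinal (mN i)))//=; last first.
  by apply/eqP => -[] /esym/eqP; exact/negP.
rewrite /B !eqxx (negbTE nm) eq_sym (negbTE nm) setIT setTI big1 ?mule1//.
move=> j /andP[jn jm]; rewrite !ifF ?setIT ?probability_setT//.
- by apply: contraNF jm => /eqP jm; apply/eqP/val_inj.
- by apply: contraNF jn => /eqP jn; apply/eqP/val_inj.
Qed.

Section square_integrable.
Variable psi : prod_space S -> R.
Hypothesis psi2 : psi \in Lfun (prod_prob mu) 2%:E.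

Lemma mpoint_Lfun2 n : (fun omega => psi (mpoint n omega)) \in Lfun P 2%:E.
Proof.
apply: (law_Lfun2 (law_mpoint n)); first exact: Lfun2_measurable psi2.
exact: Lfun2_integrableM.
Qed.

Hypothesis ppsi : partially_integrable mu psi.

(** The key second-moment identity: only the set of agreeing coordinates
    matters. The integrability of the squared partial integral comes from the
    pair of points as well, by Fubini. *)
Lemma expectation_mpointM n m :
  (sub_prob mu (agree n m)).-integrable setT
    (fun x => (integrate_out_compl mu psi x ^+ 2)%:E) /\
  \int[P]_omega (psi (mpoint n omega) * psi (mpoint m omega)) =
  \int[sub_prob mu (agree n m)]_x integrate_out_compl mu psi x ^+ 2.
Proof.
have iP := Lfun2_integrableM (mpoint_Lfun2 n) (mpoint_Lfun2 m).
have it : (twins_prob mu (agree n m)).-integrable setT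
    (fun t => (psi (fun i => t (true, i)) * psi (fun i => t (false, i)))%:E).
  apply: (law_integrableE (law_twins n m)) => //.
  have mb b : measurable_fun setT
      (fun t : prod_space (fun p : bool * I => S p.2) => (fun i => t (b, i)) : prod_space S).
    by apply: measurable_to_prod => i; exact: measurable_coord (b, i).
  have mpsi := Lfun2_measurable psi2.
  apply/measurable_EFinP; apply: measurable_funM.
  - exact: (measurableT_comp mpsi (mb true)).
  - exact: (measurableT_comp mpsi (mb false)).
have [i2 E2] := Rintegral_twins ppsi it; split=> //.
by rewrite -E2 -(law_Rintegral (law_twins n m) it).
Qed.

End square_integrable.

Lemma prob_two_boxes n m (A C : forall i, set (S i)) :
  (forall i, measurable (A i)) -> (forall i, measurable (C i)) ->
  (forall i, n i = m i -> C i = setT) ->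
  P ((mpoint n @^-1` box A) `&` (mpoint m @^-1` box C)) =
  (P (mpoint n @^-1` box A) * P (mpoint m @^-1` box C))%E.
Proof.
move=> mA mC CT.
pose AC (p : bool * I) : set (S p.2) := if p.1 then A p.2 else C p.2.
have mAC p : measurable (AC p) by rewrite /AC; case: ifP.
have [_ lawA] := law_mpoint n; have [_ lawC] := law_mpoint m.
rewrite lawA ?lawC; [|exact: measurable_box..].
have [_ /(_ (box AC) (measurable_box mAC))] := law_twins n m.
rewrite twins_prob_box// !prod_prob_box// -big_split/=.
have -> : (fun omega => (fun p => mpoint (if p.1 then n else m) omega p.2)
      : prod_space (fun p : bool * I => S p.2)) @^-1` box AC =
    mpoint n @^-1` box A `&` mpoint m @^-1` box C.
  apply/seteqP; split=> [w ACw|w [Aw Cw] [b i]].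
    by split=> i; [exact: (ACw (true, i))|exact: (ACw (false, i))].
  by case: b; [exact: (Aw i)|exact: (Cw i)].
move=> ->; apply: eq_bigr => i _.
have -> : (i \in agree n m) = (n i == m i) by rewrite finset.inE.
case: eqP => // nm; rewrite /AC/= CT//.
by rewrite setIT probability_setT mule1.
Qed.

Lemma independent_mpoint n m : (forall i, n i <> m i) ->
  independent P (mpoint n) (mpoint m).
Proof.
move=> nm; apply: independent_boxes; [exact: measurable_mpoint..|].
by move=> A C mA mC; apply: prob_two_boxes => // i /nm.
Qed.

(** Two mixed points share randomness only through the coordinates where their
    indices agree. *)
Lemma independent_mpoint_restr (D : {set I}) n m :
  (forall i, i \in D -> n i <> m i) ->
  independent P (mpoint n) (fun omega => restr D (mpoint m omega)).
Proof.
move=> nm; apply: independent_boxes; first exact: measurable_mpoint.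
  exact: (measurableT_comp (@measurable_restr _ _ S D) (measurable_mpoint m)).
move=> A C mA mC.
(* the constraints on D, extended by the trivial one outside D *)
pose C' i : set (S i) := [set y : S i | forall iD : i \in D, C (exist _ i iD) y].
have C'E i : C' i = setT \/ exists iD : i \in D, C' i = C (exist _ i iD).
  have [iD|iD] := pselect (i \in D : Prop); [right|left].
    exists iD; apply/seteqP; split=> [y /(_ iD)//|y Cy iD'].
    by rewrite (bool_irrelevance iD' iD).
  by apply/seteqP; split=> // y _ iD'; case: (iD).
have -> : (fun omega => restr D (mpoint m omega)) @^-1` box C = mpoint m @^-1` box C'.
  apply/seteqP; split=> [w Cw i iD|w Cw [i iD]]; last exact: (Cw i iD).
  exact: (Cw (exist _ i iD)).
apply: prob_two_boxes => // i.
  have [->|[iD ->]] := C'E i; first exact: measurableT.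
  exact: (mC (exist _ i iD)).
by move=> nmi; have [//|[iD _]] := C'E i; have := nm i iD.
Qed.

End sample.

(** * Counting index pairs by their agreement set *)

Section variance_combinatorics.
Context (I : finType) (R : realType).
Implicit Types (c : {set I} -> R).

Lemma prod_if_pow (D : {set I}) (r : R) :
  \prod_i (if i \in D then 1 else r) = r ^+ #|~: D|.
Proof.
rewrite -prodr_const [RHS]big_mkcond/=; apply: eq_bigr => i _.
by rewrite finset.in_setC; case: (i \in D).
Qed.

(** For fixed [m], exactly [(N-1)^|~: D|] indices [n] agree with [m] precisely
    on [D]. The count is done by factoring the indicator over the coordinates
    and distributing the sum over the product. *)
Lemma sum_agree N c (m : I -> 'I_N) :
  \sum_(n : {ffun I -> 'I_N}) c (agree (fun i => n i) (fun i => m i)) =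
  \sum_(D : {set I}) c D * (N.-1)%:R ^+ #|~: D|.
Proof.
have indE (n : {ffun I -> 'I_N}) (D : {set I}) :
    (agree (fun i => n i) (fun i => m i) == D)%:R =
    \prod_i ((n i == m i) == (i \in D))%:R :> R.
  case: (eqVneq _ D) => [<-|nD].
    by rewrite big1// => i _; rewrite finset.inE eqxx.
  have [i hi] : exists i, (n i == m i) != (i \in D).
    apply/existsP; rewrite -negb_forall; apply: contra nD => /forallP h.
    by apply/eqP/setP => i; rewrite finset.inE; exact: (eqP (h i)).
  by rewrite (bigD1 i)//= (negbTE hi) mul0r.
have sumE (a : 'I_N) b :
    \sum_(j < N) ((j == a) == b)%:R = (if b then 1 else (N.-1)%:R) :> R.
  case: b.
    by rewrite (bigD1 a)//= eqxx big1 ?addr0// => j /negbTE ->.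
  rewrite (bigD1 a)//= eqxx add0r (eq_bigr (fun=> 1)); last by move=> j /negbTE ->.
  by rewrite sumr_const cardC1 card_ord.
transitivity (\sum_(n : {ffun I -> 'I_N}) \sum_(D : {set I})
    c D * (agree (fun i => n i) (fun i => m i) == D)%:R).
  apply: eq_bigr => n _; rewrite (bigD1 (agree (fun i => n i) (fun i => m i)))//=.
  by rewrite eqxx mulr1 big1 ?addr0// => D; rewrite eq_sym => /negbTE ->; rewrite mulr0.
rewrite exchange_big/=; apply: eq_bigr => D _; rewrite -mulr_sumr; congr (_ * _).
under eq_bigr do rewrite indE.
rewrite -(bigA_distr_bigA (fun i (j : 'I_N) => ((j == m i) == (i \in D))%:R)).
by under eq_bigr do rewrite sumE; rewrite prod_if_pow.
Qed.

Lemma sum_card1 c : \sum_(D : {set I} | #|D| == 1%N) c D = \sum_k c [set k]%SET.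
Proof.
rewrite -(big_imset c (h := fun k : I => [set k]%SET) (A := predT))/=; last first.
  by move=> k l _ _; exact: finset.set1_inj.
apply: eq_bigl => D; apply/cards1P/imsetP => [[k ->]|[k _ ->]]; exists k => //.
Qed.

(** Exchanging the sums, the coefficient of [c B] on the left is a sum over the
    supersets of [B] that factors over the coordinates: each [i \in B]
    contributes [1/N] and each [i \notin B] contributes [1 - 1/N]. *)
Lemma sum_moebius N c : (0 < N)%N ->
  \sum_(A : {set I}) (N%:R ^+ #|A|)^-1 *
    (\sum_(B : {set I} | B \subset A) (-1) ^+ (#|A| - #|B|) * c B) =
  (N%:R ^+ #|I|)^-1 * \sum_(D : {set I}) c D * (N.-1)%:R ^+ #|~: D|.
Proof.
move=> N0; have N0' : N%:R != 0 :> R by rewrite pnatr_eq0 -lt0n.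
under eq_bigr do rewrite mulr_sumr.
rewrite (exchange_big_dep xpredT)//= mulr_sumr; apply: eq_bigr => B _.
transitivity (c B * \prod_i ((if i \in B then N%:R^-1 else - N%:R^-1) +
    (if i \in B then 0 else 1))).
  rewrite bigA_distr mulr_sumr big_mkcond/=; apply: eq_bigr => A _.
  case: ifPn => [BA|/subsetPn[i iB iA]]; last first.
    by rewrite (bigD1 i)//= (negbTE iA) iB mul0r mulr0.
  rewrite mulrA mulrC; congr (_ * _).
  transitivity (\prod_i ((if i \in A then N%:R^-1 else 1) *
      (if i \in A :\: B then -1 else 1)) : R).
    rewrite big_split/= -!big_mkcond/= !prodr_const exprVn cardsD.
    by move/finset.setIidPr : BA => ->.
  apply: eq_bigr => i _; rewrite finset.inE; case: (boolP (i \in B)) => iB /=.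
    by rewrite (fintype.subsetP BA)// mulr1.
  by case: (i \in A); rewrite ?mulrN1 ?mulr1.
rewrite [RHS]mulrCA; congr (_ * _).
transitivity (\prod_i (N%:R^-1 * (if i \in B then 1 else (N.-1)%:R)) : R).
  apply: eq_bigr => i _; case: ifP => _; rewrite ?addr0 ?mulr1//.
  by rewrite -subn1 natrB// mulrBr mulVf// mulr1 addrC.
by rewrite big_split/= prod_if_pow prodr_const exprVn.
Qed.

End variance_combinatorics.

(** * Unbiasedness and the Hajek projection *)
Section second_moments.
Context d (T : measurableType d) (R : realType) (P : probability T R).
Implicit Types f g : T -> R.

Lemma variance_Rintegral f (m : R) : f \in Lfun P 2%:E -> \int[P]_x f x = m ->
  ('V_P[f] = (\int[P]_x (f x - m) ^+ 2)%:E)%E.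
Proof.
move=> f2 fm; have if1 := Lfun2_integrable f2.
have Ef : ('E_P[f] = m%:E)%E.
  by rewrite unlock -fm fineK//; exact: integrable_fin_num if1.
rewrite /variance unlock Ef/= unlock fineK//.
  by apply: integrable_fin_num => //; have := Lfun2B f2 (Lfun2_cst P m);
    move=> h; have := Lfun2_integrableM h h.
Qed.

Lemma Rintegral_sqrB f g : f \in Lfun P 2%:E -> g \in Lfun P 2%:E ->
  \int[P]_x (f x - g x) ^+ 2 =
  \int[P]_x (f x * f x) - 2 * \int[P]_x (f x * g x) + \int[P]_x (g x * g x).
Proof.
move=> f2 g2; have iff := Lfun2_integrableM f2 f2.
have ifg := Lfun2_integrableM f2 g2; have igg := Lfun2_integrableM g2 g2.
have i2fg : P.-integrable setT (EFin \o (fun x => 2 * (f x * g x))).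
  exact: (integrableZl measurableT _ ifg).
rewrite -(RintegralZl 2 measurableT ifg) -(RintegralB measurableT iff i2fg).
rewrite -(RintegralD measurableT _ igg).
  by apply: eq_Rintegral => x _; ring.
by have := integrableB measurableT iff i2fg.
Qed.

Lemma Rintegral_scaled_sumM (J K : Type) (r : seq J) (s : seq K) (a b : R)
    (f : J -> T -> R) (g : K -> T -> R) :
  (forall j, f j \in Lfun P 2%:E) -> (forall k, g k \in Lfun P 2%:E) ->
  \int[P]_x ((a * \sum_(j <- r) f j x) * (b * \sum_(k <- s) g k x)) =
  a * b * \sum_(j <- r) \sum_(k <- s) \int[P]_x (f j x * g k x).
Proof.
move=> f2 g2; under eq_Rintegral do rewrite mulrACA.
rewrite (RintegralZl (a * b) measurableT) ?Rintegral_sumM//.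
by apply: Lfun2_integrableM; exact: Lfun2_sum.
Qed.

Lemma Lfun2_scaled_sum (J : Type) (r : seq J) (a : R) (f : J -> T -> R) :
  (forall j, f j \in Lfun P 2%:E) ->
  (fun x => a * \sum_(j <- r) f j x) \in Lfun P 2%:E.
Proof. by move=> f2; apply: Lfun2Zl; exact: Lfun2_sum. Qed.

End second_moments.

Section unbiased.
Context (I : finType) (d : I -> measure_display).
Variables (S : forall i, measurableType (d i)) (R : realType).
Variable mu : forall i, probability (S i) R.
Context (d0 : measure_display) (Omega : measurableType d0).
Variable P : probability Omega R.
Variable X : nat -> {mfun Omega >-> prod_space S}.
Hypothesis iidX : iid_with_law P X (prod_prob mu).
Variable psi : prod_space S -> R.
Hypothesis ipsi : (prod_prob mu).-integrable setT (EFin \o psi).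
Variable N : nat.
Hypothesis N0 : (0 < N)%N.

Let N0' : N%:R != 0 :> R. Proof. by rewrite pnatr_eq0 -lt0n. Qed.

Let iY n : P.-integrable setT (EFin \o (psi \o mpoint X n)).
Proof. exact: (law_integrable (law_mpoint iidX n) ipsi). Qed.

Let EY n : \int[P]_omega psi (mpoint X n omega) = mean mu psi.
Proof. exact: (law_Rintegral (law_mpoint iidX n) ipsi). Qed.

Let average (J : finType) (n : J -> I -> nat) (a : R) : a * #|J|%:R = 1 ->
  P.-integrable setT (fun omega => (a * \sum_j psi (mpoint X (n j) omega))%:E) /\
  \int[P]_omega (a * \sum_j psi (mpoint X (n j) omega)) = mean mu psi.
Proof.
move=> aJ.
have iS : P.-integrable setT (fun omega => (\sum_j psi (mpoint X (n j) omega))%:E).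
  have := @integrable_sum _ _ _ P _ measurableT _ (index_enum J) xpredT
    (fun j => EFin \o (psi \o mpoint X (n j))) (fun j _ => iY (n j)).
  by congr (integrable _ _ _); apply/funext => x /=; rewrite sumEFin.
split; first exact: (integrableZl measurableT a iS).
rewrite (RintegralZl a measurableT iS) Rintegral_sum => [|j _]; last exact: iY.
by under eq_bigr do rewrite EY; rewrite sumr_const -mulr_natl mulrA aJ mul1r.
Qed.

Lemma muN_times_unbiased :
  P.-integrable setT (fun omega => (muN_times X N psi omega)%:E) /\
  \int[P]_omega muN_times X N psi omega = mean mu psi.
Proof.
apply: (average (fun (n : {ffun I -> 'I_N}) i => n i : nat)).
by rewrite card_ffun card_ord natrX mulVf// expf_neq0.
Qed.

Lemma muN_unbiased : \int[P]_omega muN X N psi omega = mean mu psi.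
Proof.
by apply: (average (fun (j : 'I_N) _ => j : nat) _).2; rewrite card_ord mulVf.
Qed.

End unbiased.

Section hajek_projection.
Context (I : finType) (d : I -> measure_display).
Variables (S : forall i, measurableType (d i)) (R : realType).
Variable mu : forall i, probability (S i) R.

Definition first_order (k : I) (psi : prod_space S -> R) (x : prod_space S) : R :=
  integrate_out_compl mu psi (restr [set k]%SET x) - mean mu psi.

(** The orthogonal projection of [psi - mu psi] on the sums of functions of
    single coordinates. *)
Definition hajek (psi : prod_space S -> R) (x : prod_space S) : R :=
  \sum_k first_order k psi x.

End hajek_projection.

(** * Second moments of the estimators *)
Section decomposition.
Context (I : finType) (d : I -> measure_display).
Variables (S : forall i, measurableType (d i)) (R : realType).
Variable mu : forall i, probability (S i) R.
Context (d0 : measure_display) (Omega : measurableType d0).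
Variable P : probability Omega R.
Variable X : nat -> {mfun Omega >-> prod_space S}.
Hypothesis iidX : iid_with_law P X (prod_prob mu).
Variable psi : prod_space S -> R.
Hypothesis psi2 : psi \in Lfun (prod_prob mu) 2%:E.
Hypothesis ppsi : partially_integrable mu psi.

Let ctr (x : prod_space S) : R := psi x - mean mu psi.
Let c (D : {set I}) : R := sq_dev mu D psi.

Let ctr2 : ctr \in Lfun (prod_prob mu) 2%:E.
Proof. exact: Lfun2B (Lfun2_cst _ _). Qed.

Let pctr : partially_integrable mu ctr.
Proof. exact: partially_integrableB. Qed.

Let mean_ctr : \int[prod_prob mu]_x ctr x = 0.
Proof.
rewrite (RintegralB measurableT (Lfun2_integrable psi2)) ?Rintegral_cst1 ?subrr//.
exact: (finite_measure_integrable_cst (prod_prob mu) (mean mu psi) measurableT).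
Qed.

Let Y (n : I -> nat) (omega : Omega) : R := ctr (mpoint X n omega).

Let Y2 n : Y n \in Lfun P 2%:E.
Proof. exact: (mpoint_Lfun2 iidX). Qed.

Let EY n : \int[P]_omega Y n omega = 0.
Proof.
by rewrite (law_Rintegral (law_mpoint iidX n) (Lfun2_integrable ctr2)).
Qed.

(* centring psi centres its partial integrals, so c is their second moment *)
Let cE D : c D = \int[sub_prob mu D]_x integrate_out_compl mu ctr x ^+ 2.
Proof.
by apply: eq_Rintegral => x _; rewrite integrate_out_complB.
Qed.

Let EYY n m : \int[P]_omega (Y n omega * Y m omega) = c (agree n m).
Proof. by rewrite cE; exact: (expectation_mpointM iidX ctr2 pctr n m).2. Qed.

Let c_ge0 D : 0 <= c D.
Proof. by apply: Rintegral_ge0 => x _; exact: sqr_ge0. Qed.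

(* agreement on no coordinate means independence, hence zero covariance *)
Let c_set0 : c finset.set0 = 0.
Proof.
have <- : agree (fun=> 0%N) (fun=> 1%N) = finset.set0 :> {set I}.
  by apply/setP => i; rewrite !finset.inE.
rewrite -EYY independent_Rintegral ?EY ?mulr0//; try exact: Lfun2_integrable.
have mctr := Lfun2_measurable ctr2.
by apply: (independent_comp mctr mctr); exact: (independent_mpoint iidX).
Qed.

Let c_setT : c [set: I]%SET = sigma2 mu psi.
Proof.
have <- : agree (fun=> 0%N) (fun=> 0%N) = [set: I]%SET.
  by apply/setP => i; rewrite !finset.inE.
rewrite -EYY; exact: (law_Rintegral (law_mpoint iidX (fun=> 0%N)) (Lfun2_integrableM ctr2 ctr2)).
Qed.

Let g (k : I) : sub_space S [set k]%SET -> R := @integrate_out_compl _ _ _ _ mu [set k]%SET ctr.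

Let first_orderE k : first_order mu k psi = (fun x => g (restr [set k]%SET x)).
Proof. by apply/funext => x; rewrite /first_order -integrate_out_complB. Qed.

Let ig k : (sub_prob mu [set k]%SET).-integrable setT (EFin \o @g k).
Proof. exact: (integrable_integrate_out_compl pctr (Lfun2_integrable ctr2)). Qed.

Let mg k : measurable_fun setT (@g k).
Proof. by apply/measurable_EFinP; exact: measurable_int (ig k). Qed.

Let ig2 k : (sub_prob mu [set k]%SET).-integrable setT (fun x => (g x ^+ 2)%:E).
Proof.
have := (expectation_mpointM iidX ctr2 pctr (fun=> 0%N) (fun i => i != k : nat)).1.
suff -> : agree (fun=> 0%N) (fun i => i != k : nat) = [set k]%SET by [].
by apply/setP => i; rewrite !finset.inE; case: (i == k).
Qed.

Let h2 k : first_order mu k psi \in Lfun (prod_prob mu) 2%:E.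
Proof.
have := law_Lfun2 (law_restr mu [set k]%SET) (@mg k) (ig2 k).
by rewrite first_orderE.
Qed.

Let Eg k : \int[prod_prob mu]_x first_order mu k psi x = 0.
Proof.
rewrite first_orderE (law_Rintegral (law_restr mu [set k]%SET) (ig k)).
by rewrite (Rintegral_integrate_out_compl pctr (Lfun2_integrable ctr2)).
Qed.

(* the k-th summand of the projection, at the j-th sample point *)
Let H k j (omega : Omega) : R := first_order mu k psi (X j omega).

Let H2 k j : H k j \in Lfun P 2%:E.
Proof. exact: (mpoint_Lfun2 iidX (h2 k) (fun=> j)). Qed.

Let EH k j : \int[P]_omega H k j omega = 0.
Proof.
by rewrite (law_Rintegral (law_mpoint iidX (fun=> j)) (Lfun2_integrable (h2 k))) Eg.
Qed.

(* H k j only reads the k-th coordinate, so X j may be replaced by any mixed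
   point whose k-th index is j *)
Let H_mpoint k n omega : H k (n k) omega = first_order mu k psi (mpoint X n omega).
Proof.
rewrite /H !first_orderE; congr g; apply: functional_extensionality_dep => -[i iD].
rewrite /restr/=/mpoint; move: (iD); rewrite finset.inE => /eqP ik.
by rewrite ik.
Qed.

(* the mixed point n and the k-th coordinate of X j are independent when n k != j *)
Let E_independent (f : prod_space S -> R) n k j :
  f \in Lfun (prod_prob mu) 2%:E -> n k != j ->
  \int[P]_omega (f (mpoint X n omega) * H k j omega) = 0.
Proof.
move=> f2 nkj.
rewrite independent_Rintegral ?EH ?mulr0//.
- rewrite (_ : H k j = @g k \o (fun omega => restr [set k]%SET (mpoint X (fun=> j) omega))).
    apply: (independent_comp (f := f) (g := @g k) (Lfun2_measurable f2) (@mg k)).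
    apply: (independent_mpoint_restr iidX) => i; rewrite finset.inE => /eqP ->.
    exact/eqP.
  by rewrite /H first_orderE.
- exact: (Lfun2_integrable (mpoint_Lfun2 iidX f2 n)).
- exact: Lfun2_integrable.
Qed.

Let EYH n k j : \int[P]_omega (Y n omega * H k j omega) =
  (n k == j)%:R * c [set k]%SET.
Proof.
case: (eqVneq (n k) j) => [<-|nkj]; last by rewrite mul0r E_independent.
rewrite mul1r; under eq_Rintegral do rewrite H_mpoint.
rewrite (law_Rintegral (law_mpoint iidX n) (Lfun2_integrableM ctr2 (h2 k))).
have ih := Lfun2_integrableM ctr2 (h2 k); move: ih; rewrite first_orderE => ih.
rewrite (Rintegral_restr pctr ih).
by rewrite cE; apply: eq_Rintegral => x _; rewrite expr2.
Qed.

Let EHH k i l j : \int[P]_omega (H k i omega * H l j omega) =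
  ((k == l) && (i == j))%:R * c [set k]%SET.
Proof.
case: (boolP ((k == l) && (i == j))) => [/andP[/eqP <- /eqP <-]|klij].
  rewrite mul1r (law_Rintegral (law_mpoint iidX (fun=> i)) (Lfun2_integrableM (h2 k) (h2 k))).
  rewrite first_orderE (law_Rintegral (law_restr mu [set k]%SET) (ig2 k)).
  by rewrite cE.
(* off k, any index other than j makes the second factor independent *)
pose n x := if x == k then i else j.+1.
have nk : n k = i by rewrite /n eqxx.
under eq_Rintegral do rewrite -[X in H k X]nk H_mpoint.
rewrite (E_independent (h2 k)) ?mul0r//.
move: klij; rewrite /n [l == k]eq_sym.
by case: (eqVneq k l) => //= _ _; rewrite neq_ltn ltnSn orbT.
Qed.

Let EYhajek n j : \int[P]_omega (Y n omega * hajek mu psi (X j omega)) =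
  \sum_k (n k == j)%:R * c [set k]%SET.
Proof.
under eq_Rintegral do rewrite mulr_sumr.
rewrite Rintegral_sum => [|k _]; last exact: (Lfun2_integrableM (Y2 n) (H2 k j)).
by apply: eq_bigr => k _; rewrite EYH.
Qed.

Let Ehajek2 i j : \int[P]_omega (hajek mu psi (X i omega) * hajek mu psi (X j omega)) =
  (i == j)%:R * sigma2_times mu psi.
Proof.
have -> := @Rintegral_sumM _ _ _ P _ _ (index_enum I) (index_enum I) xpredT xpredT
  (fun k => H k i) (fun l => H l j) (fun k _ => H2 k i) (fun l _ => H2 l j).
rewrite /sigma2_times mulr_sumr; apply: eq_bigr => k _.
rewrite (bigD1 k)//= EHH eqxx/= big1 ?addr0// => l lk.
by rewrite EHH eq_sym (negbTE lk) mul0r.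
Qed.

Lemma Lfun2_hajek : hajek mu psi \in Lfun (prod_prob mu) 2%:E.
Proof. exact: (Lfun2_sum _ (fun k _ => h2 k)). Qed.

Lemma Rintegral_hajek : \int[prod_prob mu]_x hajek mu psi x = 0.
Proof.
rewrite Rintegral_sum => [|k _]; last exact: (Lfun2_integrable (h2 k)).
by rewrite big1.
Qed.

(** The summands of the projection depend on different coordinates and are
    centred, so their cross terms vanish. *)
Lemma Rintegral_hajek_sqr :
  \int[prod_prob mu]_x hajek mu psi x ^+ 2 = sigma2_times mu psi.
Proof.
have := Ehajek2 0%N 0%N; rewrite eqxx mul1r => <-.
by rewrite -(law_Rintegral (law_mpoint iidX (fun=> 0%N))
  (Lfun2_integrableM Lfun2_hajek Lfun2_hajek)).
Qed.

(** The covariance of [psi] with its projection is the variance of the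
    projection; the difference of the variances is a second moment. *)
Lemma sigma2_times_le : sigma2_times mu psi <= sigma2 mu psi.
Proof.
have X2 : (fun omega => hajek mu psi (X 0%N omega)) \in Lfun P 2%:E.
  exact: (mpoint_Lfun2 iidX Lfun2_hajek (fun=> 0%N)).
have := Rintegral_sqrB (Y2 (fun=> 0%N)) X2.
rewrite EYY EYhajek Ehajek2 eqxx mul1r.
have -> : agree (fun=> 0%N) (fun=> 0%N) = [set: I]%SET.
  by apply/setP => i; rewrite !finset.inE.
rewrite c_setT; under eq_bigr do rewrite mul1r.
rewrite -/(sigma2_times mu psi) => E.
have : 0 <= sigma2 mu psi - 2 * sigma2_times mu psi + sigma2_times mu psi.
  by rewrite -E; apply: Rintegral_ge0 => w _; exact: sqr_ge0.
lra.
Qed.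

Section sample_size.
Variable N : nat.
Hypothesis N0 : (0 < N)%N.

Let N0' : N%:R != 0 :> R. Proof. by rewrite pnatr_eq0 -lt0n. Qed.

(* centred product average M, centred standard average A, and the value V of
   both E M^2 and E (M A) *)
Let M omega := muN_times X N psi omega - mean mu psi.
Let A omega := muN X N psi omega - mean mu psi.

Let ME omega : M omega = (N%:R ^+ #|I|)^-1 *
  \sum_(n : {ffun I -> 'I_N}) Y (fun i => n i) omega.
Proof.
rewrite /M/muN_times /Y/ctr sumrB sumr_const mulrBr card_ffun card_ord.
by rewrite -[mean mu psi *+ _]mulr_natl natrX mulKf// expf_neq0.
Qed.

Let AE omega : A omega = N%:R^-1 * \sum_(j < N) Y (fun=> j : nat) omega.
Proof.
rewrite /A/muN /Y/ctr sumrB sumr_const mulrBr card_ord.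
by rewrite -[mean mu psi *+ _]mulr_natl mulKf.
Qed.

Let V := (N%:R ^+ #|I|)^-1 * \sum_(D : {set I}) c D * (N.-1)%:R ^+ #|~: D| : R.

Let M2 : M \in Lfun P 2%:E.
Proof. by rewrite (funext ME); exact: Lfun2_scaled_sum. Qed.

Let A2 : A \in Lfun P 2%:E.
Proof. by rewrite (funext AE); exact: Lfun2_scaled_sum. Qed.

Let sum_c (m : I -> 'I_N) :
  \sum_(n : {ffun I -> 'I_N}) \int[P]_omega
    (Y (fun i => n i) omega * Y (fun i => m i) omega) = N%:R ^+ #|I| * V.
Proof.
under eq_bigr do rewrite EYY.
by rewrite sum_agree mulrA mulfV ?mul1r// expf_neq0.
Qed.

Let EMM : \int[P]_omega (M omega * M omega) = V.
Proof.
under eq_Rintegral do rewrite !ME.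
rewrite Rintegral_scaled_sumM// exchange_big/=.
under eq_bigr do rewrite sum_c.
rewrite sumr_const card_ffun card_ord -[_ * V *+ _]mulr_natl natrX.
by rewrite -mulrA mulKf ?mulKf// expf_neq0.
Qed.

(* the constant index j plays the role of m in sum_agree, whence the same V *)
Let EMA : \int[P]_omega (M omega * A omega) = V.
Proof.
under eq_Rintegral do rewrite ME AE.
rewrite Rintegral_scaled_sumM// exchange_big/=.
under eq_bigr do rewrite (sum_c (fun=> _)).
rewrite sumr_const card_ord -[_ * V *+ _]mulr_natl.
by rewrite -mulrA mulKf ?mulKf// expf_neq0.
Qed.

Let EAA : \int[P]_omega (A omega * A omega) = N%:R^-1 * sigma2 mu psi.
Proof.
under eq_Rintegral do rewrite !AE.
rewrite Rintegral_scaled_sumM//.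
have -> : \sum_(j < N) \sum_(k < N) \int[P]_omega
    (Y (fun=> j : nat) omega * Y (fun=> k : nat) omega) = N%:R * sigma2 mu psi.
  rewrite mulr_natl -[in RHS](card_ord N) -sumr_const; apply: eq_bigr => j _.
  rewrite (bigD1 j)//= EYY big1 => [|k kj].
    rewrite addr0 -c_setT; congr c.
    by apply/setP => i; rewrite !finset.inE eqxx.
  rewrite EYY -c_set0; congr c; apply/setP => i; rewrite !finset.inE.
  by apply: contraNF kj => /eqP jk; exact/eqP/val_inj.
by rewrite -mulrA mulKf.
Qed.

Lemma Lfun2_muN_times : muN_times X N psi \in Lfun P 2%:E.
Proof.
have -> : muN_times X N psi = (fun omega => M omega + mean mu psi).
  by apply/funext => w; rewrite subrK.
exact: Lfun2D (Lfun2_cst _ _).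
Qed.

Lemma Lfun2_muN : muN X N psi \in Lfun P 2%:E.
Proof.
have -> : muN X N psi = (fun omega => A omega + mean mu psi).
  by apply/funext => w; rewrite subrK.
exact: Lfun2D (Lfun2_cst _ _).
Qed.

Let var_timesE : var_times mu N psi = V.
Proof.
rewrite /V -sum_moebius// /var_times [RHS](bigD1 finset.set0)//=.
rewrite [X in _ = X + _](_ : _ = 0) ?add0r// big1 ?mulr0// => B.
by rewrite finset.subset0 => /eqP ->; rewrite c_set0 mulr0.
Qed.

Lemma variance_muN_times : ('V_P[muN_times X N psi] = (var_times mu N psi)%:E)%E.
Proof.
rewrite (variance_Rintegral Lfun2_muN_times (muN_times_unbiased iidX (Lfun2_integrable psi2) N0).2).
by rewrite var_timesE -EMM.
Qed.

Lemma variance_muN : ('V_P[muN X N psi] = (N%:R^-1 * sigma2 mu psi)%:E)%E.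
Proof.
rewrite (variance_Rintegral Lfun2_muN (muN_unbiased iidX (Lfun2_integrable psi2) N0)).
by rewrite -EAA.
Qed.

(** As [E M^2 = E (M A)], the difference of the variances is [E (M - A)^2]. *)
Lemma var_times_le : var_times mu N psi <= N%:R^-1 * sigma2 mu psi.
Proof.
rewrite var_timesE -EAA -subr_ge0.
suff -> : \int[P]_omega (A omega * A omega) - V = \int[P]_omega (M omega - A omega) ^+ 2.
  by apply: Rintegral_ge0 => w _; exact: sqr_ge0.
by rewrite Rintegral_sqrB// EMM EMA; ring.
Qed.

Let Hj (p : 'I_N * I) (omega : Omega) : R := H p.2 p.1 omega.

Let muN_hajekE omega : muN X N (hajek mu psi) omega = N%:R^-1 * \sum_p Hj p omega.
Proof. by rewrite /muN; congr (_ * _); rewrite pair_big. Qed.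

Lemma Lfun2_remainder :
  (fun omega => M omega - muN X N (hajek mu psi) omega) \in Lfun P 2%:E.
Proof.
by apply: Lfun2B => //; rewrite (funext muN_hajekE); apply: Lfun2_scaled_sum => p; exact: H2.
Qed.

(** The average [G] of the projection satisfies [E (M G) = E G^2], so the left
    side is [V - sigma2_times / N]. The term of [V] for a set [D] is at most
    [c D / N^|D|]; it vanishes for [D] empty, the singletons add up to at most
    [sigma2_times / N], and the other sets contribute at most [c D / N^2]. *)
Lemma remainder_sqr_le :
  \int[P]_omega (M omega - muN X N (hajek mu psi) omega) ^+ 2 <=
  (\sum_(D : {set I}) sq_dev mu D psi) / N%:R ^+ 2.
Proof.
have Hj2 p : Hj p \in Lfun P 2%:E by exact: H2.
have G2 : muN X N (hajek mu psi) \in Lfun P 2%:E.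
  by rewrite (funext muN_hajekE); exact: Lfun2_scaled_sum.
rewrite (Rintegral_sqrB M2 G2) EMM.
have -> : \int[P]_omega (M omega * muN X N (hajek mu psi) omega) =
    N%:R^-1 * sigma2_times mu psi.
  under eq_Rintegral do rewrite ME muN_hajekE.
  rewrite Rintegral_scaled_sumM//.
  rewrite (eq_bigr (fun=> sigma2_times mu psi)) => [|n _].
    rewrite sumr_const card_ffun card_ord -[sigma2_times _ _ *+ _]mulr_natl natrX.
    by rewrite [X in X * _]mulrC -mulrA mulKf// expf_neq0.
  under eq_bigr do rewrite EYH.
  rewrite -(pair_bigA _ (fun (j : 'I_N) k => (n k == j :> nat)%:R * c [set k]%SET))/=.
  rewrite exchange_big/=; apply: eq_bigr => k _; rewrite -mulr_suml.
  by rewrite (bigD1 (n k))//= eqxx big1 ?addr0 ?mul1r// => j; rewrite -val_eqE eq_sym/= => /negbTE ->.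
have -> : \int[P]_omega (muN X N (hajek mu psi) omega * muN X N (hajek mu psi) omega) =
    N%:R^-1 * sigma2_times mu psi.
  under eq_Rintegral do rewrite !muN_hajekE.
  rewrite Rintegral_scaled_sumM//.
  rewrite (eq_bigr (fun p => c [set p.2]%SET)) => [|p _].
    rewrite -(pair_bigA _ (fun (j : 'I_N) k => c [set k]%SET))/= sumr_const card_ord.
    by rewrite -[(\sum_j _) *+ _]mulr_natl -mulrA mulKf.
  rewrite (bigD1 p)//= EHH !eqxx mul1r big1 ?addr0// => q qp.
  rewrite EHH; case: (boolP (_ && _)) => [/andP[/eqP p2 /eqP p1]|]; last by rewrite mul0r.
  case/eqP: qp; rewrite [p]surjective_pairing [q]surjective_pairing p2.
  by congr pair; apply/val_inj.
suff VE : V <= N%:R^-1 * sigma2_times mu psi + (\sum_(D : {set I}) c D) / N%:R ^+ 2.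
  rewrite -/c in VE *; lra.
have q0 : 0 <= N%:R^-1 :> R by rewrite invr_ge0 ler0n.
have q1 : N%:R^-1 <= 1 :> R by rewrite invf_le1 ?ltr0n// ler1n.
rewrite [sigma2_times _ _](_ : _ = \sum_(D : {set I} | #|D| == 1%N) c D); last first.
  by rewrite sum_card1.
rewrite /V mulr_sumr [X in _ <= _ * X + _]big_mkcond/= mulr_sumr mulr_suml -big_split/=.
apply: ler_sum => D _.
have -> : (N%:R ^+ #|I|)^-1 = N%:R^-1 ^+ #|D| * N%:R^-1 ^+ #|~: D| :> R.
  by rewrite -exprD cardsC exprVn.
have le1 : N%:R^-1 ^+ #|~: D| * (N.-1)%:R ^+ #|~: D| <= 1 :> R.
  rewrite -exprMn exprn_ile1 ?mulr_ge0//.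
  by rewrite mulrC ler_pdivrMr ?ltr0n// mul1r ler_nat leq_pred.
have {le1} : N%:R^-1 ^+ #|D| * N%:R^-1 ^+ #|~: D| * (c D * (N.-1)%:R ^+ #|~: D|) <=
    N%:R^-1 ^+ #|D| * c D :> R.
  rewrite mulrACA -[leRHS]mulr1 ler_wpM2l// ?mulr_ge0// exprn_ge0//.
move/le_trans; apply; rewrite -exprVn [c D * _]mulrC.
case: (eqVneq #|D| 1%N) => [->|D1].
  by rewrite expr1 lerDl mulr_ge0// exprn_ge0.
rewrite mulr0 add0r.
have [D0|D0] := posnP #|D|.
  by move/eqP: D0; rewrite cards_eq0 => /eqP ->; rewrite [c _]c_set0 !mulr0.
rewrite ler_wpM2r// ler_wiXn2l//.
by case: #|D| D0 D1 => // -[].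
Qed.

End sample_size.

End decomposition.

(** * Almost sure convergence from second moments *)

Section almost_sure.
Context d (T : measurableType d) (R : realType) (P : probability T R).

(** Telescoping: [1/(m+1)^2 <= 1/m - 1/(m+1)]. *)
Lemma sum_inv_sqr_le n : \sum_(k < n) (k.+1%:R ^+ 2)^-1 <= 2 :> R.
Proof.
suff H m : \sum_(k < m.+1) (k.+1%:R ^+ 2)^-1 <= 2 - m.+1%:R^-1 :> R.
  case: n => [|n]; first by rewrite big_ord0.
  by rewrite (le_trans (H n))// gerBl.
elim: m => [|m ih].
  by rewrite big_ord_recr big_ord0/= add0r expr1n invr1; lra.
rewrite big_ord_recr/= (le_trans (lerD ih (lexx _)))//.
have m1 : (m.+1%:R : R) > 0 by rewrite ltr0n.
have -> : m.+2%:R = m.+1%:R + 1 :> R by rewrite -natr1.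
move: (m.+1%:R) m1 => x m1.
have x0 : x != 0 by rewrite gt_eqF.
have x1 : x + 1 != 0 by rewrite gt_eqF// addr_gt0.
rewrite -subr_ge0.
have -> : 2 - (x + 1)^-1 - (2 - x^-1 + ((x + 1) ^+ 2)^-1) = (x * (x + 1) ^+ 2)^-1.
  by field; rewrite ?x0 ?x1.
by rewrite invr_ge0 mulr_ge0 ?exprn_ge0// ?addr_ge0// ltW.
Qed.

(** The series of the squares is integrable by monotone convergence, so it is
    almost surely finite and its terms tend to [0]. *)
Lemma ae_cvg0_sqr_summable (Z : nat -> T -> R) (C : R) :
  (forall n, Z n \in Lfun P 2%:E) ->
  (forall n, \int[P]_x Z n.+1 x ^+ 2 <= C / n.+1%:R ^+ 2) ->
  {ae P, forall x, Z n x @[n --> \oo] --> (0 : R)}.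
Proof.
move=> Z2 ZC.
have C0 : 0 <= C.
  have := ZC 0%N; rewrite expr1n divr1; apply: le_trans.
  by apply: Rintegral_ge0 => x _; exact: sqr_ge0.
pose f n x := (Z n.+1 x ^+ 2)%:E.
have f0 n x : (0 <= f n x)%E by rewrite lee_fin sqr_ge0.
have if_ n : P.-integrable setT (f n) := Lfun2_integrableM (Z2 n.+1) (Z2 n.+1).
have mf n : measurable_fun setT (f n) := measurable_int _ (if_ n).
have mS : measurable_fun setT (fun x => \sum_(0 <= n <oo) f n x)%E.
  exact: ge0_emeasurable_sum.
have iS : P.-integrable setT (fun x => \sum_(0 <= n <oo) f n x)%E.
  apply/integrableP; split=> //.
  under eq_integral do rewrite gee0_abs ?nneseries_ge0//.
  rewrite integral_nneseries//; apply: (@le_lt_trans _ _ (C * 2)%:E); last exact: ltry.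
  apply: lime_le; first by apply: is_cvg_nneseries => n _ _; exact: integral_ge0.
  apply: nearW => n.
  rewrite (@eq_bigr _ _ _ _ _ _ _ (fun i => (\int[P]_x Z i.+1 x ^+ 2)%:E)); last first.
    by move=> i _; rewrite fineK//; exact: (integrable_fin_num _ (if_ i)).
  rewrite sumEFin lee_fin big_mkord.
  apply: (@le_trans _ _ (\sum_(i < n) C / i.+1%:R ^+ 2)).
    by apply: ler_sum => i _; exact: ZC.
  by rewrite -mulr_sumr ler_wpM2l// sum_inv_sqr_le.
have := integrable_ae measurableT iS; apply: filterS => x /(_ I) Sfin.
have bd n : \sum_(0 <= k < n) Z k.+1 x ^+ 2 <= fine (\sum_(0 <= n <oo) f n x)%E.
  rewrite -lee_fin fineK// -sumEFin.
  exact: (nneseries_lim_ge n (fun k _ _ => f0 k x)).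
have cv : cvgn (series (fun k => Z k.+1 x ^+ 2)).
  apply: nondecreasing_is_cvgn.
    by apply/nondecreasing_seqP => n; rewrite seriesSr lerDl sqr_ge0.
  by exists (fine (\sum_(0 <= n <oo) f n x)%E) => _ [n _ <-]; exact: bd.
have := cvg_series_cvg_0 cv => Z0.
rewrite -(cvg_shiftS (fun n => Z n x)) /=.
apply/cvgr0Pnorm_lt => e e0.
have e20 : 0 < e ^+ 2 by rewrite exprn_gt0.
move/cvgr0Pnorm_lt: Z0 => /(_ _ e20); apply: filterS => n.
rewrite ger0_norm ?sqr_ge0// -(real_normK (num_real (Z n.+1 x))) => ltZ.
by rewrite -(ltr_pXn2r (n := 2))// ?nnegrE// ltW.
Qed.

Lemma exists_sqrt_floor m : exists n : nat, (n ^ 2 <= m < n.+1 ^ 2)%N.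
Proof.
elim: m => [|m [n /andP[nm mn]]]; first by exists 0%N.
have [mn'|mn'] := ltnP m.+1 (n.+1 ^ 2); first by exists n; rewrite mn' andbT ltnW.
by exists n.+1; rewrite mn'/= (leq_ltn_trans mn)// ltn_sqr.
Qed.

Variables (xi : nat -> T -> R) (v : R).
Hypothesis xi2 : forall j, xi j \in Lfun P 2%:E.
Hypothesis xi_orth : forall i j, \int[P]_x (xi i x * xi j x) = (i == j)%:R * v.

Let v_ge0 : 0 <= v.
Proof.
have := xi_orth 0 0; rewrite eqxx mul1r => <-.
by apply: Rintegral_ge0 => x _; rewrite -expr2 sqr_ge0.
Qed.

Let nxi j : T -> R := fun x => `|xi j x|.

Let nxi2 j : nxi j \in Lfun P 2%:E.
Proof.
apply: Lfun2P; first exact: measurableT_comp (Lfun2_measurable (xi2 j)).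
have := Lfun2_integrableM (xi2 j) (xi2 j).
by congr (integrable _ _ _); apply/funext => x; rewrite /nxi real_normK ?num_real.
Qed.

Let Enxi i j : \int[P]_x (nxi i x * nxi j x) <= v.
Proof.
have iij := Lfun2_integrableM (nxi2 i) (nxi2 j).
have iii := Lfun2_integrableM (xi2 i) (xi2 i).
have ijj := Lfun2_integrableM (xi2 j) (xi2 j).
have -> : v = 2^-1 * (\int[P]_x (xi i x * xi i x) + \int[P]_x (xi j x * xi j x)).
  by rewrite !xi_orth !eqxx !mul1r; lra.
rewrite -(RintegralD measurableT iii ijj).
have iD : P.-integrable setT (EFin \o (fun x => xi i x * xi i x + xi j x * xi j x)).
  by have := integrableD measurableT iii ijj.
rewrite -(RintegralZl _ measurableT iD).
apply: le_Rintegral => //; first by have := integrableZl measurableT 2^-1 iD.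
move=> x _; rewrite /nxi -2!expr2 -(real_normK (num_real (xi i x))).
rewrite -(real_normK (num_real (xi j x))).
have := sqr_ge0 (`|xi i x| - `|xi j x|); nra.
Qed.

(** Along [N = n^2] the second moment of the average is [v / n^2], which is
    summable. Between [n^2] and [(n+1)^2] the sum changes by at most the sum [D]
    of the [2n+1] next absolute values, and [(D / n^2)^2] has integral
    [O(1/n^2)] too. *)
Lemma slln_orthogonal :
  {ae P, forall x, N%:R^-1 * \sum_(j < N) xi j x @[N --> \oo] --> (0 : R)}.
Proof.
pose Z (N : nat) (x : T) : R := (N%:R ^+ 2)^-1 * \sum_(j < N ^ 2) xi j x.
pose D (N : nat) (x : T) : R := (N%:R ^+ 2)^-1 * \sum_(j < N.*2.+1) nxi (N ^ 2 + j)%N x.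
have Z2 N : Z N \in Lfun P 2%:E by exact: Lfun2_scaled_sum.
have D2 N : D N \in Lfun P 2%:E by exact: Lfun2_scaled_sum.
have EZ n : \int[P]_x Z n.+1 x ^+ 2 <= v / n.+1%:R ^+ 2.
  rewrite /Z; under eq_Rintegral do rewrite expr2.
  rewrite Rintegral_scaled_sumM//.
  rewrite (eq_bigr (fun=> v)) => [|j _].
    rewrite sumr_const card_ord -[v *+ _]mulr_natl natrX -mulrA mulKf ?expf_neq0//.
    by rewrite mulrC.
  rewrite (bigD1 j)//= xi_orth eqxx mul1r big1 ?addr0// => k kj.
  by rewrite xi_orth eq_sym -val_eqE/= in kj *; rewrite (negbTE kj) mul0r.
have ED n : \int[P]_x D n.+1 x ^+ 2 <= (9 * v) / n.+1%:R ^+ 2.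
  rewrite /D; under eq_Rintegral do rewrite expr2.
  rewrite Rintegral_scaled_sumM//.
  set q := n.+1%:R ^+ 2; set L := n.+1.*2.+1.
  have q0 : 0 < q by rewrite exprn_gt0.
  have qq : 0 <= q^-1 / q by rewrite mulr_ge0// invr_ge0 ltW.
  apply: (@le_trans _ _ (q^-1 / q * (L%:R ^+ 2 * v))).
    rewrite (ler_wpM2l qq)//.
    apply: (@le_trans _ _ (\sum_(j < L) \sum_(k < L) v)).
      by apply: ler_sum => j _; apply: ler_sum => k _; exact: Enxi.
    by rewrite !sumr_const card_ord -mulrnA -[v *+ _]mulr_natl natrM expr2.
  have Lq : L%:R ^+ 2 <= 9 * q :> R.
    have -> : 9 * q = (3 * n.+1%:R) ^+ 2 by rewrite exprMn; congr (_ * _); ring.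
    rewrite ler_pXn2r ?nnegrE ?mulr_ge0// -natrM ler_nat /L -addnn.
    by rewrite !mulSn mul0n addn0 addnA -addn1 leq_add2l.
  apply: (@le_trans _ _ (q^-1 / q * (9 * q * v))).
    by rewrite (ler_wpM2l qq)// ler_wpM2r.
  rewrite le_eqVlt; apply/orP; left; apply/eqP; field.
  by rewrite gt_eqF.
have aeZ := ae_cvg0_sqr_summable Z2 EZ; have aeD := ae_cvg0_sqr_summable D2 ED.
apply: filterS2 aeZ aeD => x Zx Dx.
apply/cvgr0Pnorm_lt => e e0.
have e20 : 0 < e / 2 by rewrite divr_gt0.
move/cvgr0Pnorm_lt: Zx => /(_ _ e20) [n1 _ Zx].
move/cvgr0Pnorm_lt: Dx => /(_ _ e20) [n2 _ Dx].
exists ((maxn 1 (maxn n1 n2)) ^ 2)%N => // m /= nm.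
have [n /andP[nlem mltn]] := exists_sqrt_floor m.
have : (maxn 1 (maxn n1 n2) <= n)%N.
  rewrite leqNgt; apply/negP => nlt; have := leq_trans mltn (leq_trans _ nm).
  by rewrite leq_sqr nlt ltnn => /(_ isT).
rewrite !geq_max => /and3P[n0 n1n n2n].
have {Zx}Zx := Zx n n1n; have {Dx}Dx := Dx n n2n.
have n20 : 0 < (n ^ 2)%:R :> R by rewrite ltr0n expn_gt0 n0.
have m0 : 0 < m%:R :> R by rewrite (lt_le_trans n20)// ler_nat.
pose k := (m - n ^ 2)%N.
have mE : m = (n ^ 2 + k)%N by rewrite subnKC.
have kL : (k <= n.*2.+1)%N.
  rewrite leq_subLR; apply: (leq_trans (ltnW mltn)).
  by rewrite -addn1 sqrnD exp1n muln1 mul2n -addnA add1n.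
have splitE : \sum_(j < m) xi j x = \sum_(j < n ^ 2) xi j x + \sum_(j < k) xi (n ^ 2 + j)%N x.
  by rewrite mE big_split_ord.
have tail : `|\sum_(j < k) xi (n ^ 2 + j)%N x| <= \sum_(j < n.*2.+1) nxi (n ^ 2 + j)%N x.
  rewrite (le_trans (ler_norm_sum _ _ _))// (big_ord_widen _ (fun j => `|xi (n ^ 2 + j)%N x|) kL).
  by rewrite big_mkcond/=; apply: ler_sum => j _; rewrite /nxi; case: ifP.
have le1 : `|m%:R^-1 * \sum_(j < m) xi j x| <= (n%:R ^+ 2)^-1 * `|\sum_(j < m) xi j x|.
  by rewrite normrM ger0_norm ?invr_ge0 ?(ltW m0)// ler_wpM2r// -natrX lef_pV2 ?posrE// ler_nat.
rewrite (le_lt_trans le1)// splitE.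
have q0 : 0 <= (n%:R ^+ 2)^-1 :> R by rewrite invr_ge0 exprn_ge0.
apply: (@le_lt_trans _ _ (`|Z n x| + `|D n x|)); last by rewrite [ltRHS]splitr ltrD.
rewrite /Z /D !normrM (ger0_norm q0) -mulrDr ler_wpM2l// (le_trans (ler_normD _ _))// lerD2l.
by rewrite (le_trans tail)// ler_norm.
Qed.

End almost_sure.

(** * Taylor estimates for the heat kernel *)

Section calculus.
Context (R : realType).
Implicit Types (f g : R -> R) (x h : R).

Lemma derive1_add f g x (a b : R) : is_derive x 1 f a -> is_derive x 1 g b ->
  is_derive x 1 (fun y => f y + g y) (a + b).
Proof. exact: is_deriveD. Qed.

Lemma derive1_mul f g x (a b : R) : is_derive x 1 f a -> is_derive x 1 g b ->
  is_derive x 1 (fun y => f y * g y) (a * g x + f x * b).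
Proof.
move=> fa gb; apply: (@is_derive_eq _ _ _ _ _ _ _ _ (is_deriveM fa gb)).
by rewrite -[f x *: b]/(f x * b) -[g x *: a]/(g x * a); ring.
Qed.

Lemma derive1_expR f x a : is_derive x 1 f a ->
  is_derive x 1 (fun y => expR (f y)) (a * expR (f x)).
Proof.
move=> fa; have := is_derive1_comp (is_derive_expR (f x)) fa.
by rewrite mulrC.
Qed.

Lemma derive1_cst (c : R) x : is_derive x 1 (fun=> c) 0.
Proof. exact: is_derive_cst. Qed.

Lemma derive1_id x : is_derive x 1 (fun y => y) 1.
Proof. exact: is_derive_id. Qed.

Lemma derive1_inv x : x != 0 -> is_derive x 1 (fun y => y^-1) (- (x^-1 * x^-1)).
Proof.
move=> x0; apply: (@is_derive_eq _ _ _ _ _ _ _ _ (is_deriveV (f := id) x0 (is_derive_id x 1))).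
by rewrite /GRing.scale/= mulr1 expr2 invfM.
Qed.

Section taylor.
Variable D : R -> Prop.
Hypothesis convexD : forall a b c, D a -> D b -> a <= c <= b -> D c.

(** The mean value theorem on a convex domain, for increments of either sign;
    the domain is a half-line for the time variable and the line for space. *)
Lemma mvt f f' x h : (forall y, D y -> is_derive y 1 f (f' y)) -> D x -> D (x + h) ->
  exists c, [/\ D c, `|c - x| <= `|h| & f (x + h) - f x = f' c * h].
Proof.
move=> df Dx Dxh.
have cf a b : D a -> D b -> {within `[a, b], continuous f}.
  move=> Da Db; apply: derivable_within_continuous => y; rewrite in_itv/= => ayb.
  by have [] := df y (convexD Da Db ayb).
have [h0|h0] := leP 0 h.
  have xxh : x <= x + h by rewrite lerDl.
  have [|c|c] := @MVT_segment _ f f' _ _ xxh; last 2 first.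
  - exact: cf.
  - rewrite in_itv/= => /andP[xc cxh] ->; exists c; split.
    + by apply: (convexD Dx Dxh); rewrite xc.
    + by rewrite !ger0_norm// ?subr_ge0// lerBlDl.
    + by congr (_ * _); rewrite addrAC subrr add0r.
  move=> y /subset_itv_oo_cc; rewrite in_itv/= => yx; exact: df (convexD Dx Dxh yx).
have xxh : x + h <= x by rewrite gerDl ltW.
have [|c|c] := @MVT_segment _ f f' _ _ xxh; last 2 first.
- exact: cf.
- rewrite in_itv/= => /andP[xc cxh] E; exists c; split.
  + by apply: (convexD Dxh Dx); rewrite xc.
  + by rewrite (ler0_norm (x := c - x)) ?subr_le0// (ler0_norm (ltW h0)); lra.
  + by rewrite -[LHS]opprB E -mulrN; congr (_ * _); ring.
move=> y /subset_itv_oo_cc; rewrite in_itv/= => yx; exact: df (convexD Dxh Dx yx).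
Qed.

Lemma taylor1 f f' f'' M x h :
  (forall y, D y -> is_derive y 1 f (f' y)) ->
  (forall y, D y -> is_derive y 1 f' (f'' y)) ->
  (forall y, D y -> `|f'' y| <= M) -> D x -> D (x + h) ->
  `|f (x + h) - f x - h * f' x| <= M * h ^+ 2.
Proof.
move=> df df' fM Dx Dxh.
have [c [Dc ch ->]] := mvt df Dx Dxh.
have Dxc : D (x + (c - x)) by rewrite addrC subrK.
have [e [De eh]] := mvt df' Dx Dxc; rewrite [x + _]addrC subrK => E.
rewrite [h * _]mulrC -mulrBl E normrM -[h ^+ 2]real_normK ?num_real// expr2 mulrA.
rewrite ler_wpM2r// normrM ler_pM//; exact: fM.
Qed.

Lemma taylor2 f f' f'' f''' M x h :
  (forall y, D y -> is_derive y 1 f (f' y)) ->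
  (forall y, D y -> is_derive y 1 f' (f'' y)) ->
  (forall y, D y -> is_derive y 1 f'' (f''' y)) ->
  (forall y, D y -> `|f''' y| <= M) -> D x -> D (x + h) ->
  `|f (x + h) - f x - h * f' x - h ^+ 2 / 2 * f'' x| <= M * (h ^+ 2 * `|h|).
Proof.
move=> df df' df'' fM Dx Dxh.
(* apply the mean value theorem to f minus its second-order Taylor polynomial *)
pose g y := f y + ((y - x) * (- f' x) + (y - x) * ((y - x) * (- (f'' x / 2)))).
pose g' y := f' y - f' x - (y - x) * f'' x.
have dyx (y : R) : is_derive y 1 (fun y => y - x) (1 + 0).
  exact: (derive1_add (derive1_id y) (derive1_cst _ y)).
have dg y : D y -> is_derive y 1 g (g' y).
  move=> Dy; apply: (@is_derive_eq _ _ _ _ _ _ _ _ (derive1_add (df y Dy)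
    (derive1_add (derive1_mul (dyx y) (derive1_cst _ _))
      (derive1_mul (dyx y) (derive1_mul (dyx y) (derive1_cst _ _)))))).
  by rewrite /g'; field.
have [c [Dc ch E]] := mvt dg Dx Dxh.
have -> : f (x + h) - f x - h * f' x - h ^+ 2 / 2 * f'' x = g' c * h.
  by rewrite -E /g; field.
have Dxc : D (x + (c - x)) by rewrite addrC subrK.
have := taylor1 df' df'' fM Dx Dxc; rewrite [x + _]addrC subrK -/(g' c) => Tc.
rewrite normrM mulrA ler_wpM2r// (le_trans Tc)// ler_wpM2l//.
  exact: le_trans (fM _ Dx).
by rewrite -(real_normK (num_real (c - x))) -(real_normK (num_real h)) ler_pXn2r// nnegrE.
Qed.

End taylor.

End calculus.

Section heat_kernel.
Context (R : realType).
Implicit Types (s t x h : R).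

(** [t^(-1/2) exp (- x^2 / (2t))] for [t > 0], the heat kernel without its factor
    [(2 pi)^(-1/2)]; the power of [t] is inside the exponential, which makes the
    time derivative as easy as the space derivatives. *)
Definition heat t x : R := expR (- (ln t / 2) - x ^+ 2 / (2 * t)).

(** [heat1], [heat2], [heat3] are the space derivatives, and the heat equation
    [d/dt heat = heat2 / 2] makes [heat4] the second time derivative. They are
    written as polynomials times [heat], with products instead of powers, in the
    form the derivation rules above produce. *)
Definition heat1 t x : R := - (t^-1 * x) * heat t x.
Definition heat2 t x : R := (t^-1 * t^-1 * (x * x) - t^-1) * heat t x.
Definition heat3 t x : R :=
  (3 * (t^-1 * t^-1) * x - t^-1 * t^-1 * t^-1 * (x * x * x)) * heat t x.
Definition heat4 t x : R :=
  2^-1 * (2^-1 * (t^-1 * t^-1 * t^-1 * t^-1) * (x * x * x * x)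
    - 3 * (t^-1 * t^-1 * t^-1) * (x * x) + 3 / 2 * (t^-1 * t^-1)) * heat t x.

Let heatE t : 0 < t ->
  heat t = fun x => expR (- (ln t / 2) + x * x * (- (t^-1 / 2))).
Proof.
by move=> t0; apply/funext => x; congr expR; rewrite expr2; field; rewrite gt_eqF.
Qed.

Lemma heat_ge0 t x : 0 <= heat t x. Proof. exact: expR_ge0. Qed.

Lemma derive_heat t x : 0 < t -> is_derive x 1 (heat t) (heat1 t x).
Proof.
move=> t0; rewrite {1}heatE//.
apply: (@is_derive_eq _ _ _ _ _ _ _ _ (derive1_expR (derive1_add (derive1_cst _ x)
  (derive1_mul (derive1_mul (derive1_id x) (derive1_id x)) (derive1_cst _ x))))).
by rewrite /heat1 heatE//; congr (_ * _); field; rewrite gt_eqF.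
Qed.

Lemma derive_heat1 t x : 0 < t -> is_derive x 1 (heat1 t) (heat2 t x).
Proof.
move=> t0; rewrite [heat1 t](_ : _ = fun x => x * (- t^-1) * heat t x); last first.
  by apply/funext => y; rewrite /heat1; ring.
apply: (@is_derive_eq _ _ _ _ _ _ _ _ (derive1_mul
  (derive1_mul (derive1_id x) (derive1_cst _ x)) (derive_heat x t0))).
by rewrite /heat1 /heat2; ring.
Qed.

Lemma derive_heat2 t x : 0 < t -> is_derive x 1 (heat2 t) (heat3 t x).
Proof.
move=> t0; rewrite [heat2 t](_ : _ = fun x => (x * x * (t^-1 * t^-1) + - t^-1) * heat t x); last first.
  by apply/funext => y; rewrite /heat2; ring.
apply: (@is_derive_eq _ _ _ _ _ _ _ _ (derive1_mul
  (derive1_add (derive1_mul (derive1_mul (derive1_id x) (derive1_id x)) (derive1_cst _ x))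
    (derive1_cst _ x)) (derive_heat x t0))).
by rewrite /heat1 /heat3; ring.
Qed.

Lemma derive_heat_time t x : 0 < t ->
  is_derive t 1 (fun t => heat t x) (2^-1 * heat2 t x).
Proof.
move=> t0; have t0' : t != 0 by rewrite gt_eqF.
rewrite [fun t => _](_ : _ = fun t => expR (ln t * - 2^-1 + t^-1 * (- (x * x / 2)))); last first.
  apply/funext => u; congr expR; rewrite expr2 invfM; ring.
apply: (@is_derive_eq _ _ _ _ _ _ _ _ (derive1_expR (derive1_add
  (derive1_mul (is_derive1_ln t0) (derive1_cst _ t))
  (derive1_mul (derive1_inv t0') (derive1_cst _ t))))).
rewrite /heat2 mulrA; congr (_ * _); first by field.
by congr expR; rewrite expr2 invfM; ring.
Qed.

Lemma derive_heat2_time t x : 0 < t ->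
  is_derive t 1 (fun t => 2^-1 * heat2 t x) (heat4 t x).
Proof.
move=> t0; have t0' : t != 0 by rewrite gt_eqF.
rewrite [fun t => _](_ : _ = fun t => (t^-1 * t^-1 * (x * x / 2) + t^-1 * - 2^-1) * heat t x); last first.
  by apply/funext => u; rewrite /heat2; ring.
apply: (@is_derive_eq _ _ _ _ _ _ _ _ (derive1_mul (derive1_add
  (derive1_mul (derive1_mul (derive1_inv t0') (derive1_inv t0')) (derive1_cst _ t))
  (derive1_mul (derive1_inv t0') (derive1_cst _ t))) (derive_heat_time x t0))).
by rewrite /heat2 /heat4; field.
Qed.

(** With [z = x^2 / (2t)], the factors [z e^-z] and [z^2 e^-z] are bounded,
    because [e^z >= 1 + z] and [e^z >= 1 + z^2 / 2]. *)
Lemma heat_moments s t x : 0 < s -> s <= t -> let E := expR (- (ln s / 2)) in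
  [/\ heat t x <= E, x ^+ 2 / (2 * t) * heat t x <= E &
      (x ^+ 2 / (2 * t)) ^+ 2 * heat t x <= 2 * E].
Proof.
move=> s0 st E; have t0 : 0 < t := lt_le_trans s0 st.
set z := x ^+ 2 / (2 * t).
have z0 : 0 <= z by rewrite mulr_ge0 ?sqr_ge0// invr_ge0 mulr_ge0// ltW.
have Et : expR (- (ln t / 2)) <= E.
  by rewrite ler_expR lerN2 ler_pM2r// ler_ln// posrE.
have -> : heat t x = expR (- (ln t / 2)) * expR (- z) by rewrite -expRD.
have Et0 := expR_ge0 (- (ln t / 2)).
have ez : expR (- z) * expR z = 1 by rewrite -expRD addNr expR0.
have ez0 := expR_gt0 (- z).
have z1 := expR_ge1Dx z.
have z2 := expR_ge1Dxn 1 z0; rewrite /= in z2.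
have ez1 : expR (- z) <= 1 by nra.
have ez2 : z * expR (- z) <= 1 by nra.
have ez3 : z ^+ 2 * expR (- z) <= 2.
  have : 1 + z ^+ 2 / 2 <= expR z by [].
  nra.
by split; rewrite ?mulrA; nra.
Qed.

(** Each derivative is a combination of the products [q^i z^j heat] with
    [q = 1/t <= 1/s], up to odd powers of [x], which [1 +- x + x^2 >= 0]
    bounds by even ones. *)
Lemma heat_bounds s : 0 < s -> exists2 C, 0 <= C & forall t x, s <= t ->
  [/\ heat t x <= C, `|heat1 t x| <= C, `|heat2 t x| <= C, `|heat3 t x| <= C &
      `|heat4 t x| <= C].
Proof.
move=> s0; pose E := expR (- (ln s / 2)); pose Q := s^-1.
have E0 : 0 <= E by exact: expR_ge0.
have Q0 : 0 <= Q by rewrite invr_ge0 ltW.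
have QE0 : 0 <= Q * E by exact: mulr_ge0.
have QQE0 : 0 <= Q * Q * E by rewrite !mulr_ge0.
exists (20 * (E + Q * E + Q * Q * E)); first by lra.
move=> t x st; have t0 : 0 < t := lt_le_trans s0 st.
have [A0 A1 A2] := heat_moments x s0 st; rewrite -/E in A0 A1 A2.
have e0 := heat_ge0 t x; set e := heat t x in A0 A1 A2 e0 *.
pose q := t^-1.
have q0 : 0 <= q by rewrite invr_ge0 ltW.
have qQ : q <= Q by rewrite lef_pV2.
have zE : x ^+ 2 / (2 * t) = x ^+ 2 * q / 2 by rewrite /q; field; rewrite gt_eqF.
rewrite zE in A1 A2; set z := x ^+ 2 * q / 2 in A1 A2.
have z0 : 0 <= z by rewrite /z mulr_ge0// mulr_ge0 ?sqr_ge0.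
have A10 : 0 <= z * e by exact: mulr_ge0.
have A20 : 0 <= z ^+ 2 * e by rewrite mulr_ge0 ?sqr_ge0.
have qA0 : q * e <= Q * E by exact: ler_pM.
have qA1 : q * (z * e) <= Q * E by exact: ler_pM.
have qA2 : q * (z ^+ 2 * e) <= Q * (2 * E) by exact: ler_pM.
have qq0 : 0 <= q * q by exact: mulr_ge0.
have qqQ : q * q <= Q * Q by exact: ler_pM.
have qqA0 : q * q * e <= Q * Q * E by exact: ler_pM.
have qqA1 : q * q * (z * e) <= Q * Q * E by exact: ler_pM.
have qqA2 : q * q * (z ^+ 2 * e) <= Q * Q * (2 * E) by exact: ler_pM.
have qe0 : 0 <= q * e by exact: mulr_ge0.
have qA10 : 0 <= q * (z * e) by exact: mulr_ge0.
have qA20 : 0 <= q * (z ^+ 2 * e) by exact: mulr_ge0.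
have qqA00 : 0 <= q * q * e by exact: mulr_ge0.
have qqA10 : 0 <= q * q * (z * e) by exact: mulr_ge0.
have qqA20 : 0 <= q * q * (z ^+ 2 * e) by exact: mulr_ge0.
have u0 : 0 <= q * e * (1 + x + x ^+ 2) by rewrite mulr_ge0//; nra.
have u'0 : 0 <= q * e * (1 - x + x ^+ 2) by rewrite mulr_ge0//; nra.
have qu0 : 0 <= q * (q * e * (1 + x + x ^+ 2)) by exact: mulr_ge0.
have qu'0 : 0 <= q * (q * e * (1 - x + x ^+ 2)) by exact: mulr_ge0.
have zqu0 : 0 <= z * q * (q * e * (1 + x + x ^+ 2)) by rewrite mulr_ge0// mulr_ge0.
have zqu'0 : 0 <= z * q * (q * e * (1 - x + x ^+ 2)) by rewrite mulr_ge0// mulr_ge0.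
have x2q : x ^+ 2 * q = 2 * z by rewrite /z; field.
have uE : q * e * (1 + x + x ^+ 2) = q * e + q * x * e + 2 * (z * e).
  by rewrite mulrA -x2q; ring.
have u'E : q * e * (1 - x + x ^+ 2) = q * e - q * x * e + 2 * (z * e).
  by rewrite mulrA -x2q; ring.
rewrite uE in u0 qu0 zqu0; rewrite u'E in u'0 qu'0 zqu'0.
split.
- lra.
- rewrite /heat1 -/q -/e ler_norml; apply/andP; split; lra.
- have -> : heat2 t x = 2 * (q * (z * e)) - q * e.
    by rewrite /heat2 -/q -/e /z; field.
  rewrite ler_norml; apply/andP; split; lra.
- have -> : heat3 t x = 3 * (q * (q * x * e)) - 2 * (z * q * (q * x * e)).
    by rewrite /heat3 -/q -/e /z; field.
  rewrite ler_norml; apply/andP; split; lra.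
- have -> : heat4 t x = q * q * (z ^+ 2 * e) - 3 * (q * q * (z * e)) + 3 / 4 * (q * q * e).
    by rewrite /heat4 -/q -/e /z; field.
  rewrite ler_norml; apply/andP; split; lra.
Qed.

(** The error [h^2 min(1, |h|)] combines the second-order estimate, for small
    [h], with the first-order one: it is integrable when [h^2] is. *)
Definition taylor_bound s C :=
  forall t, s <= t -> forall x,
  [/\ heat t x <= C, `|heat1 t x| <= C & `|heat2 t x| <= C] /\
  [/\ forall h, `|heat t (x + h) - heat t x| <= C * `|h|,
    forall h, `|heat t (x + h) - heat t x - h * heat1 t x - h ^+ 2 / 2 * heat2 t x| <=
      C * (h ^+ 2 * Num.min 1 `|h|) &
    forall h, 0 <= h -> `|heat (t + h) x - heat t x - h / 2 * heat2 t x| <= C * h ^+ 2].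

Lemma heat_taylor s : 0 < s -> exists2 C, 0 <= C & taylor_bound s C.
Proof.
move=> s0; have [C C0 HC] := heat_bounds s0.
exists (2 * C) => [|t st x]; first by rewrite mulr_ge0.
have t0 : 0 < t := lt_le_trans s0 st.
have [b0 b1 b2 b3 b4] := HC t x st.
have convT (a b c : R) : True -> True -> a <= c <= b -> True by [].
split; first by split; lra.
split.
- move=> h; have [y _|c [_ _ ->]] := @mvt R (fun=> True) convT (heat t) (heat1 t) x h _ I I.
    exact: derive_heat.
  by rewrite normrM ler_wpM2r//; have [_ + _ _ _] := HC t c st; lra.
- move=> h.
  have T1 := @taylor1 R _ convT (heat t) (heat1 t) (heat2 t) C x h
    (fun y _ => derive_heat y t0) (fun y _ => derive_heat1 y t0)
    (fun y _ => let: And5 _ _ b _ _ := HC t y st in b) I I.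
  have T2 := @taylor2 R _ convT (heat t) (heat1 t) (heat2 t) (heat3 t) C x h
    (fun y _ => derive_heat y t0) (fun y _ => derive_heat1 y t0)
    (fun y _ => derive_heat2 y t0)
    (fun y _ => let: And5 _ _ _ b _ := HC t y st in b) I I.
  have h20 := sqr_ge0 h.
  have Ch0 : 0 <= C * h ^+ 2 by exact: mulr_ge0.
  have Chh0 : 0 <= C * (h ^+ 2 * `|h|) by rewrite mulr_ge0// mulr_ge0.
  rewrite minEle; case: ifP => _; last by lra.
  rewrite mulr1 (le_trans (ler_normB _ _))//.
  have : `|h ^+ 2 / 2 * heat2 t x| <= C * h ^+ 2.
    rewrite normrM ger0_norm ?divr_ge0// mulrC.
    by have := ler_wpM2r h20 b2; have := normr_ge0 (heat2 t x); nra.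
  lra.
- move=> h h0.
  have convs (a b c : R) : s <= a -> s <= b -> a <= c <= b -> s <= c.
    by move=> sa _ /andP[ac _]; exact: le_trans ac.
  have pos y : s <= y -> 0 < y := lt_le_trans s0.
  have sth : s <= t + h by rewrite (le_trans st)// lerDl.
  have := @taylor1 R _ convs (fun t => heat t x) (fun t => 2^-1 * heat2 t x)
    (fun t => heat4 t x) C t h
    (fun y sy => derive_heat_time x (pos y sy)) (fun y sy => derive_heat2_time x (pos y sy))
    (fun y sy => let: And5 _ _ _ _ b := HC y x sy in b) st sth.
  rewrite mulrA => T; rewrite (le_trans T)// ler_wpM2r ?sqr_ge0//; lra.
Qed.

End heat_kernel.

(** * The central limit theorem tested on heat kernels *)

Section lindeberg.
Context d (T : measurableType d) (R : realType) (P : probability T R).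

Lemma measurable_heat t : measurable_fun setT (@heat R t).
Proof.
apply: measurableT_comp => //; apply: measurable_funB => //.
by apply: measurable_funM => //; exact: measurable_funX.
Qed.

Lemma measurable_heat1 t : measurable_fun setT (@heat1 R t).
Proof.
apply: measurable_funM; last exact: measurable_heat.
by apply: measurableT_comp => //; exact: measurable_funM.
Qed.

Lemma measurable_heat2 t : measurable_fun setT (@heat2 R t).
Proof.
apply: measurable_funM; last exact: measurable_heat.
apply: measurable_funB => //; apply: measurable_funM => //.
exact: measurable_funM.
Qed.

Lemma Lfun2_bounded (f : T -> R) (C : R) : measurable_fun setT f ->
  (forall x, `|f x| <= C) -> f \in Lfun P 2%:E.
Proof.
move=> mf fC; apply: Lfun2P => //.
apply: (@le_integrable _ _ _ P setT measurableT _ (fun=> (C ^+ 2)%:E)).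
- by apply/measurable_EFinP; exact: measurable_funX.
- move=> x _; rewrite !abse_EFin lee_fin !ger0_norm ?sqr_ge0//.
  by rewrite -(real_normK (num_real (f x))) ler_pXn2r// nnegrE// (le_trans _ (fC x)).
- exact: (finite_measure_integrable_cst P (C ^+ 2) measurableT).
Qed.

Lemma integrable_mul_bounded (f g : T -> R) (C : R) :
  P.-integrable setT (EFin \o f) -> measurable_fun setT g ->
  (forall x, `|g x| <= C) -> P.-integrable setT (fun x => (f x * g x)%:E).
Proof.
move=> intf mg gC.
have mf : measurable_fun setT f by apply/measurable_EFinP; exact: measurable_int intf.
apply: (@le_integrable _ _ _ P setT measurableT _ (fun x => (C * f x)%:E)).
- by apply/measurable_EFinP; exact: measurable_funM.
- move=> x _; rewrite !abse_EFin lee_fin !normrM mulrC ler_wpM2r//.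
  by rewrite (le_trans (gC x))// ler_norm.
- by have := integrableZl measurableT C intf.
Qed.

Variable nu : {measure set R -> \bar R}.
Variable xi : nat -> T -> R.
Hypothesis lawxi : forall n, has_law P (xi n) nu.
Hypothesis inu2 : nu.-integrable setT (fun y => (y ^+ 2)%:E).
Hypothesis centered : \int[nu]_y y = 0.
Hypothesis xi_indep : forall n, independent P (fun x => \sum_(j < n) xi j x) (xi n).

Let v := \int[nu]_y y ^+ 2.

Let xi2 n : xi n \in Lfun P 2%:E.
Proof. by apply: (law_Lfun2 (lawxi n) (f := idfun)); [exact: measurable_id|exact: inu2]. Qed.

Let mxi n : measurable_fun setT (xi n) := Lfun2_measurable (xi2 n).

Let v0 : 0 <= v. Proof. by apply: Rintegral_ge0 => y _; exact: sqr_ge0. Qed.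

Let inu1 : nu.-integrable setT (fun y : R => y%:E).
Proof.
have mid : measurable_fun setT (fun y : R => y%:E) by exact/measurable_EFinP/measurable_id.
exact: (law_integrableE (lawxi 0) mid (Lfun2_integrable (xi2 0))).
Qed.

Let Exi n : \int[P]_x xi n x = 0.
Proof. by rewrite (law_Rintegral (lawxi n) inu1). Qed.

Let Exi2 n : \int[P]_x xi n x ^+ 2 = v.
Proof. by rewrite (law_Rintegral (lawxi n) inu2). Qed.

Let S n x := \sum_(j < n) xi j x.

Let S2 n : S n \in Lfun P 2%:E.
Proof.
exact: (@Lfun2_sum _ _ _ P _ (index_enum _) xpredT (fun j : 'I_n => xi j) (fun j _ => xi2 j)).
Qed.

Let trunc (r : R) y := y ^+ 2 * Num.min 1 `|r * y|.

Let mtrunc r : measurable_fun setT (trunc r).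
Proof.
apply: measurable_funM; first exact: measurable_funX.
by apply: measurable_minr => //; apply: measurableT_comp => //; exact: measurable_funM.
Qed.

Let trunc_le r y : `|trunc r y| <= y ^+ 2.
Proof.
rewrite normrM ger0_norm ?sqr_ge0// ler_piMr ?sqr_ge0//.
rewrite ger0_norm; last by rewrite le_min ler01 normr_ge0.
by rewrite ge_min lexx.
Qed.

Let itrunc r : nu.-integrable setT (fun y => (trunc r y)%:E).
Proof.
apply: (@le_integrable _ _ _ nu setT measurableT _ (fun y => (y ^+ 2)%:E)) => //.
  by apply/measurable_EFinP; exact: mtrunc.
move=> y _; rewrite !abse_EFin lee_fin (le_trans (trunc_le r y))//.
exact: ler_norm.
Qed.

(** Expanding around [y = r * S k - a], the new summand contributes
    [r xi heat1 + (r xi)^2 / 2 heat2] and the shorter time contributes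
    [- r^2 v / 2 heat2]. By independence the first term has mean [0] and the
    others cancel, as [xi] has mean [0] and variance [v]; the Taylor errors
    remain. *)
Lemma lindeberg_step s C a r t k : 0 < s ->
  taylor_bound s C ->
  s <= t ->
  `|\int[P]_x heat t (r * S k.+1 x - a) - \int[P]_x heat (t + r ^+ 2 * v) (r * S k x - a)| <=
  C * (r ^+ 2 * \int[nu]_y trunc r y) + C * (r ^+ 2 * v) ^+ 2.
Proof.
move=> s0 HC st; set delta := r ^+ 2 * v.
have delta0 : 0 <= delta by rewrite mulr_ge0 ?sqr_ge0.
have std : s <= t + delta by rewrite (le_trans st)// lerDl.
pose y x := r * S k x - a.
have mS : measurable_fun setT (S k) := Lfun2_measurable (S2 k).
have my : measurable_fun setT y by apply: measurable_funB => //; exact: measurable_funM.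
have yE x : r * S k.+1 x - a = y x + r * xi k x.
  by rewrite /y /S big_ord_recr/=; ring.
pose f0 x := heat t (y x + r * xi k x).
pose f1 x := heat (t + delta) (y x).
pose f2 x := (r * xi k x) * heat1 t (y x).
pose f3 x := (r ^+ 2 * xi k x ^+ 2 - delta) * (2^-1 * heat2 t (y x)).
have nheat u z : s <= u -> `|heat u z| <= C.
  by move=> su; rewrite ger0_norm ?heat_ge0//; have [[]] := HC u su z.
have f0L : f0 \in Lfun P 2%:E.
  apply: (Lfun2_bounded (C := C)) => [|x]; last exact: nheat.
  apply: measurableT_comp; first exact: measurable_heat.
  by apply: measurable_funD => //; exact: measurable_funM.
have f1L : f1 \in Lfun P 2%:E.
  apply: (Lfun2_bounded (C := C)) => [|x]; last exact: nheat.
  by apply: measurableT_comp => //; exact: measurable_heat.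
have h1L : (fun x => heat1 t (y x)) \in Lfun P 2%:E.
  apply: (Lfun2_bounded (C := C)) => [|x]; last by have [[]] := HC t st (y x).
  by apply: measurableT_comp => //; exact: measurable_heat1.
have h2L : (fun x => 2^-1 * heat2 t (y x)) \in Lfun P 2%:E.
  apply: Lfun2Zl; apply: (Lfun2_bounded (C := C)) => [|x]; last by have [[]] := HC t st (y x).
  by apply: measurableT_comp => //; exact: measurable_heat2.
have i2 : P.-integrable setT (EFin \o f2).
  exact: (Lfun2_integrableM (Lfun2Zl r (xi2 k)) h1L).
have ixi2 : P.-integrable setT (EFin \o (fun x => r ^+ 2 * xi k x ^+ 2 - delta)).
  have i1 : P.-integrable setT (EFin \o (fun x => r ^+ 2 * xi k x ^+ 2)).
    by have := integrableZl measurableT (r ^+ 2) (Lfun2_integrableM (xi2 k) (xi2 k)).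
  by have := integrableB measurableT i1 (finite_measure_integrable_cst P delta measurableT).
have h2C x : `|2^-1 * heat2 t (y x)| <= C.
  have [[_ _ b2] _] := HC t st (y x).
  by rewrite normrM ger0_norm//; have := normr_ge0 (heat2 t (y x)); lra.
have i3 : P.-integrable setT (EFin \o f3).
  exact: (integrable_mul_bounded ixi2 (Lfun2_measurable h2L) h2C).
have E2 : \int[P]_x f2 x = 0.
  rewrite /f2; under eq_Rintegral do rewrite mulrC.
  have ind : independent P (fun x => heat1 t (y x)) (fun x => r * xi k x).
    apply: (independent_comp (f := fun z => heat1 t (r * z - a)) (g := fun z => r * z)
      _ _ (@xi_indep k)).
      apply: measurableT_comp; first exact: measurable_heat1.
      by apply: measurable_funB => //; exact: measurable_funM.
    exact: measurable_funM.
  rewrite (independent_Rintegral ind (Lfun2_integrable h1L) (Lfun2_integrable (Lfun2Zl r (xi2 k)))).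
  by rewrite (RintegralZl r measurableT (Lfun2_integrable (xi2 k))) Exi !mulr0.
have E3 : \int[P]_x f3 x = 0.
  rewrite /f3; under eq_Rintegral do rewrite mulrC.
  have ind : independent P (fun x => 2^-1 * heat2 t (y x)) (fun x => r ^+ 2 * xi k x ^+ 2 - delta).
    have mf : measurable_fun setT (fun z : R => 2^-1 * heat2 t (r * z - a)).
      apply: measurable_funM => //; apply: measurableT_comp; first exact: measurable_heat2.
      by apply: measurable_funB => //; exact: measurable_funM.
    have mg : measurable_fun setT (fun z : R => r ^+ 2 * z ^+ 2 - delta).
      by apply: measurable_funB => //; apply: measurable_funM => //; exact: measurable_funX.
    exact: (independent_comp mf mg (@xi_indep k)).
  rewrite (independent_Rintegral ind (Lfun2_integrable h2L) ixi2).
  have i1 := Lfun2_integrableM (xi2 k) (xi2 k).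
  have i1' : P.-integrable setT (EFin \o (fun x => r ^+ 2 * xi k x ^+ 2)).
    by have := integrableZl measurableT (r ^+ 2) i1.
  rewrite (RintegralB measurableT i1' (finite_measure_integrable_cst P delta measurableT)).
  rewrite (RintegralZl (r ^+ 2) measurableT i1) Rintegral_cst1 Exi2 /delta.
  by rewrite subrr mulr0.
have i0 := Lfun2_integrable f0L; have i1 := Lfun2_integrable f1L.
have i01 : P.-integrable setT (EFin \o (fun x => f0 x - f1 x)).
  by have := integrableB measurableT i0 i1.
have i012 : P.-integrable setT (EFin \o (fun x => f0 x - f1 x - f2 x)).
  by have := integrableB measurableT i01 i2.
have iW : P.-integrable setT (EFin \o (fun x => f0 x - f1 x - f2 x - f3 x)).
  by have := integrableB measurableT i012 i3.
have -> : \int[P]_x heat t (r * S k.+1 x - a) - \int[P]_x heat (t + delta) (r * S k x - a) =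
    \int[P]_x (f0 x - f1 x - f2 x - f3 x).
  rewrite (RintegralB measurableT i012 i3) (RintegralB measurableT i01 i2).
  rewrite (RintegralB measurableT i0 i1) E2 E3 !subr0; congr (_ - _).
  by apply: eq_Rintegral => x _; rewrite yE.
have itr : P.-integrable setT (EFin \o (fun x => trunc r (xi k x))).
  exact: (law_integrable (lawxi k) (itrunc r)).
have itr' : P.-integrable setT (EFin \o (fun x => C * r ^+ 2 * trunc r (xi k x))).
  by have := integrableZl measurableT (C * r ^+ 2) itr.
have icst := finite_measure_integrable_cst P (C * delta ^+ 2) measurableT.
apply: (@le_trans _ _ (\int[P]_x (C * r ^+ 2 * trunc r (xi k x) + C * delta ^+ 2))); last first.
  rewrite (RintegralD measurableT itr' icst) Rintegral_cst1 lerD2r.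
  rewrite (RintegralZl _ measurableT itr) (law_Rintegral (lawxi k) (itrunc r)).
  by rewrite -mulrA lexx.
apply: (le_trans (le_normr_Rintegral measurableT iW)).
apply: le_Rintegral => //.
- by have := integrable_abse iW.
- by have := integrableD measurableT itr' icst.
move=> x _; have [_ [_ tay _]] := HC t st (y x).
have [_ [_ _ tim]] := HC t st (y x).
have {tay} := tay (r * xi k x); have {tim} := tim delta delta0.
rewrite /f0 /f1 /f2 /f3 /trunc.
set h0 := heat t (y x); set h1 := heat1 t (y x); set h2 := heat2 t (y x).
set k0 := heat t _; set k1 := heat _ _; set m := Num.min _ _ => tim tay.
have -> : k0 - k1 - r * xi k x * h1 - (r ^+ 2 * xi k x ^+ 2 - delta) * (2^-1 * h2) =
    (k0 - h0 - r * xi k x * h1 - (r * xi k x) ^+ 2 / 2 * h2) - (k1 - h0 - delta / 2 * h2).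
  by field.
rewrite (le_trans (ler_normB _ _))// lerD//.
by rewrite (le_trans tay)// exprMn !mulrA.
Qed.

Let rt n : R := (Num.sqrt n.+1%:R)^-1.

Let rt_sqr n : rt n ^+ 2 = n.+1%:R^-1.
Proof. by rewrite exprVn sqr_sqrtr. Qed.

Let rt0 : rt n @[n --> \oo] --> (0 : R).
Proof.
have -> : rt = Num.sqrt \o @harmonic R.
  by apply/funext => n; rewrite /rt /= sqrtrV.
rewrite -[X in _ --> X](@sqrtr0 R).
by apply: continuous_cvg; [exact: sqrt_continuous|exact: cvg_harmonic].
Qed.

Let trunc_cvg0 : \int[nu]_y trunc (rt n) y @[n --> \oo] --> (0 : R).
Proof.
have [|||||_ _] := @dominated_convergence _ _ _ nu setT measurableT
  (fun n y => (trunc (rt n) y)%:E) (fun=> 0%:E) (fun y => (y ^+ 2)%:E).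
- by move=> n; apply/measurable_EFinP; exact: mtrunc.
- exact: measurable_cst.
- apply: aeW => y _; apply/fine_cvgP; split; first exact: nearW.
  have : (y ^+ 2 * `|y|) * rt n @[n --> \oo] --> (y ^+ 2 * `|y|) * 0.
    by apply: cvgMr.
  rewrite mulr0 => cv0; apply/norm_cvg0P.
  apply: (@squeeze_cvgr _ _ _ _ (fun=> 0) (fun n => (y ^+ 2 * `|y|) * rt n)) => //.
    apply: nearW => n; rewrite normr_ge0/= /trunc normrM ger0_norm ?sqr_ge0//.
    rewrite -mulrA ler_wpM2l ?sqr_ge0// ger0_norm; last by rewrite le_min ler01 normr_ge0.
    have r0 : 0 <= rt n by rewrite invr_ge0 sqrtr_ge0.
    by rewrite ge_min; apply/orP; right; rewrite normrM mulrC (ger0_norm r0).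
  exact: cvg_cst.
- exact: inu2.
- by apply: aeW => y n _; rewrite abse_EFin lee_fin; exact: trunc_le.
rewrite integral0 => cv.
have cv' : (fun n => \int[nu]_y (trunc (rt n) y)%:E)%E n @[n --> \oo] --> (0 : R)%:E := cv.
exact: fine_cvg cv'.
Qed.

(** Telescope over the [N] steps from [heat s] at the full sum to
    [heat (s + v)] at the empty sum, with [r = 1 / sqrt N]: the errors add up to
    [C \int y^2 min(1, |y| / sqrt N)], which tends to [0] by dominated
    convergence, plus [C v^2 / N]. *)
Lemma heat_clt s a : 0 < s ->
  \int[P]_x heat s ((Num.sqrt N%:R)^-1 * \sum_(j < N) xi j x - a) @[N --> \oo]
    --> heat (s + v) a.
Proof.
move=> s0; have [C C0 HC] := heat_taylor s0.
rewrite -(cvg_shiftS (fun N => \int[P]_x heat s ((Num.sqrt N%:R)^-1 * \sum_(j < N) xi j x - a)))/=.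
(* the sequence is shifted by one, so that the sample size n.+1 is positive *)
have bound n : `|heat (s + v) a - \int[P]_x heat s (rt n * S n.+1 x - a)| <=
    C * \int[nu]_y trunc (rt n) y + C * v ^+ 2 * n.+1%:R^-1.
  pose N := n.+1; pose delta := rt n ^+ 2 * v.
  have delta0 : 0 <= delta by rewrite mulr_ge0 ?sqr_ge0.
  pose t k : R := s + (N - k)%:R * delta.
  pose b k := \int[P]_x heat (t k) (rt n * S k x - a).
  have bN : b N = \int[P]_x heat s (rt n * S n.+1 x - a).
    by rewrite /b /t subnn mul0r addr0.
  have bO : b 0%N = heat (s + v) a.
    rewrite /b /t subn0 /delta rt_sqr mulrA mulfV ?mul1r ?pnatr_eq0//.
    under eq_Rintegral do rewrite /S big_ord0 mulr0 sub0r.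
    by rewrite Rintegral_cst1 /heat sqrrN.
  rewrite -bO -bN distrC -telescope_sumr// (le_trans (ler_norm_sum _ _ _))//.
  apply: (@le_trans _ _ (\sum_(0 <= k < N)
      (C * (rt n ^+ 2 * \int[nu]_y trunc (rt n) y) + C * delta ^+ 2))).
    rewrite big_nat [leRHS]big_nat; apply: ler_sum => k /andP[_ kN].
    have tk : t k = t k.+1 + rt n ^+ 2 * v.
      by rewrite /t -(subnSK kN) -natr1 /delta; ring.
    rewrite /b tk; apply: (lindeberg_step a (rt n) k s0 HC).
    by rewrite /t lerDl mulr_ge0.
  rewrite sumr_const_nat subn0 -mulr_natl /delta rt_sqr.
  rewrite le_eqVlt; apply/orP; left; apply/eqP; rewrite /N; field.
  by rewrite nat1r pnatr_eq0.
apply/cvgrPdist_le => e e0.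
have : C * \int[nu]_y trunc (rt n) y + C * v ^+ 2 * n.+1%:R^-1 @[n --> \oo] --> (0 : R).
  rewrite -[X in _ --> X](addr0 (0 : R)); apply: cvgD.
    by rewrite -[X in _ --> X](mulr0 C); apply: cvgMr.
  by rewrite -[X in _ --> X](mulr0 (C * v ^+ 2)); apply: cvgMr; exact: cvg_harmonic.
move/cvgrPdist_le => /(_ e e0); apply: filterS => n.
by rewrite sub0r normrN => /(le_trans (ler_norm _)); exact: le_trans (bound n).
Qed.

End lindeberg.

Section slutsky.
Context d (T : measurableType d) (R : realType) (P : probability T R).

(** The kernel is Lipschitz, so a perturbation that is small in quadratic mean
    does not change the limit. *)
Lemma heat_cvg_perturb s a (l : R) (Y Z : nat -> T -> R) : 0 < s ->
  (forall n, Y n \in Lfun P 2%:E) -> (forall n, Z n \in Lfun P 2%:E) ->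
  \int[P]_x (Z n x - Y n x) ^+ 2 @[n --> \oo] --> (0 : R) ->
  \int[P]_x heat s (Y n x - a) @[n --> \oo] --> l ->
  \int[P]_x heat s (Z n x - a) @[n --> \oo] --> l.
Proof.
move=> s0 Y2 Z2 ZY Yl; have [C C0 HC] := heat_taylor s0.
have iheat (U : nat -> T -> R) n : U n \in Lfun P 2%:E ->
    P.-integrable setT (EFin \o (fun x => heat s (U n x - a))).
  move=> U2; apply: Lfun2_integrable; apply: (@Lfun2_bounded _ _ _ P _ C) => [|x].
    apply: measurableT_comp; first exact: measurable_heat.
    by apply: measurable_funB => //; exact: Lfun2_measurable U2.
  by rewrite ger0_norm ?heat_ge0//; have [[]] := HC s (lexx s) (U n x - a).
(* |z| <= eps + z^2/eps turns the bound on the second moment into one on the first *)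
have close n eps : 0 < eps -> `|\int[P]_x heat s (Z n x - a) - \int[P]_x heat s (Y n x - a)| <=
    C * (eps + eps^-1 * \int[P]_x (Z n x - Y n x) ^+ 2).
  move=> eps0.
  have iZY := Lfun2_integrableM (Lfun2B (Z2 n) (Y2 n)) (Lfun2B (Z2 n) (Y2 n)).
  have iZY' : P.-integrable setT (EFin \o (fun x => C / eps * (Z n x - Y n x) ^+ 2)).
    by have := integrableZl measurableT (C / eps) iZY.
  have icst := finite_measure_integrable_cst P (C * eps) measurableT.
  have iH : P.-integrable setT (EFin \o (fun x => heat s (Z n x - a) - heat s (Y n x - a))).
    by have := integrableB measurableT (iheat _ _ (Z2 n)) (iheat _ _ (Y2 n)).
  rewrite -(RintegralB measurableT (iheat _ _ (Z2 n)) (iheat _ _ (Y2 n))).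
  apply: (le_trans (le_normr_Rintegral measurableT iH)).
  have -> : C * (eps + eps^-1 * \int[P]_x (Z n x - Y n x) ^+ 2) =
      \int[P]_x (C * eps + C / eps * (Z n x - Y n x) ^+ 2).
    rewrite (RintegralD measurableT icst iZY') Rintegral_cst1.
    by rewrite (RintegralZl _ measurableT iZY) mulrDr mulrA.
  apply: le_Rintegral => //.
  - by have := integrable_abse iH.
  - by have := integrableD measurableT icst iZY'.
  move=> x _; have [_ [lip _ _]] := HC s (lexx s) (Y n x - a).
  have := lip (Z n x - Y n x).
  have -> : Y n x - a + (Z n x - Y n x) = Z n x - a by ring.
  move/le_trans; apply; rewrite -mulrA -mulrDr ler_wpM2l//.
  rewrite -(real_normK (num_real (Z n x - Y n x))); set z := `|_|.
  have z0 : 0 <= z by exact: normr_ge0.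
  rewrite -(ler_pM2l eps0) mulrDr mulrA mulfV ?gt_eqF// mul1r.
  have := sqr_ge0 (eps - z); nra.
suff D0 : \int[P]_x heat s (Z n x - a) - \int[P]_x heat s (Y n x - a) @[n --> \oo] --> (0 : R).
  rewrite -[l]add0r (_ : (fun n => \int[P]_x heat s (Z n x - a)) = (fun n =>
    (\int[P]_x heat s (Z n x - a) - \int[P]_x heat s (Y n x - a)) +
    \int[P]_x heat s (Y n x - a))); last by apply/funext => n; rewrite subrK.
  exact: cvgD D0 Yl.
apply/cvgr0Pnorm_le => e e0.
pose eps := e / (2 * (C + 1)).
have C1 : 0 < C + 1 by rewrite ltr_wpDl.
have eps0 : 0 < eps by rewrite divr_gt0// mulr_gt0.
have : \forall n \near \oo, `|\int[P]_x (Z n x - Y n x) ^+ 2| <= eps ^+ 2.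
  by move/cvgr0Pnorm_le: ZY; apply; rewrite exprn_gt0.
apply: filterS => n small; apply: (le_trans (close n _ eps0)).
apply: (@le_trans _ _ ((C + 1) * (eps + eps))).
  apply: ler_pM => //; first by rewrite addr_ge0 ?(ltW eps0)// mulr_ge0 ?invr_ge0 ?(ltW eps0)//;
    apply: Rintegral_ge0 => x _; exact: sqr_ge0.
    by rewrite lerDl.
  rewrite lerD2l -(ler_pM2l eps0) mulrA mulfV ?gt_eqF// mul1r -expr2.
  exact: le_trans (ler_norm _) small.
rewrite /eps le_eqVlt; apply/orP; left; apply/eqP; field.
by rewrite gt_eqF.
Qed.

End slutsky.

(** * From heat kernels to convergence in distribution *)

Section gaussian_heat.
Context (R : realType).
Local Notation lambda := (@lebesgue_measure R).

(** The factor that turns [heat t] into a probability density. *)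
Definition heat_factor : R := (Num.sqrt (pi *+ 2))^-1.

Lemma heat_factor_gt0 : 0 < heat_factor.
Proof. by rewrite invr_gt0 sqrtr_gt0 pmulrn_lgt0 ?pi_gt0. Qed.

Lemma sqrt_expR_ln (t : R) : 0 < t -> Num.sqrt t = expR (ln t / 2).
Proof.
move=> t0; have -> : t = expR (ln t / 2) ^+ 2.
  by rewrite expr2 -expRD -splitr lnK.
by rewrite sqrtr_sqr ger0_norm ?expR_ge0// lnXn ?expR_gt0// expRK -mulr_natl; congr expR; field.
Qed.

Lemma normal_pdf_heat (m t x : R) : 0 < t ->
  normal_pdf m (Num.sqrt t) x = heat_factor * heat t (x - m).
Proof.
move=> t0; have st0 : Num.sqrt t != 0 by rewrite gt_eqF// sqrtr_gt0.
rewrite normal_pdfE// -[LHS]/(normal_peak _ * normal_fun _ _ _) /normal_peak /normal_fun sqr_sqrtr ?(ltW t0)//.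
rewrite -mulrnAr sqrtrM ?(ltW t0)// invfM /heat expRD expRN -sqrt_expR_ln// mulrA.
congr (_ * _); first by rewrite mulrC.
by congr expR; rewrite -mulr_natl mulNr.
Qed.

Lemma integral_heat (m t : R) : 0 < t ->
  (\int[lambda]_x (heat_factor * heat t (x - m))%:E = 1)%E.
Proof.
move=> t0; rewrite -(integral_normal_pdf m (Num.sqrt t)).
by apply: eq_integral => x _; rewrite normal_pdf_heat.
Qed.

Lemma integrable_heat (m t : R) : 0 < t ->
  lambda.-integrable setT (fun x => (heat_factor * heat t (x - m))%:E).
Proof.
move=> t0; have := integrable_normal_pdf m (Num.sqrt t).
by congr (integrable _ _ _); apply/funext => x; rewrite normal_pdf_heat.
Qed.

Lemma Rintegral_heat (m t : R) : 0 < t ->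
  \int[lambda]_x (heat_factor * heat t (x - m)) = 1.
Proof. by move=> t0; rewrite /Rintegral integral_heat. Qed.

Lemma integral_normal_prob (m sigma : R) (f : measurableTypeR R -> \bar R) :
  (normal_prob m sigma).-integrable setT f ->
  (\int[normal_prob m sigma]_x f x = \int[lambda]_x (f x * (normal_pdf m sigma x)%:E))%E.
Proof.
move=> intf; have dom := normal_prob_dominates m sigma.
have mf := measurable_int _ intf.
have mp : measurable_fun setT (fun x : measurableTypeR R => (normal_pdf m sigma x)%:E).
  by apply/measurable_EFinP; exact: measurable_normal_pdf.
rewrite -(Radon_Nikodym_change_of_variables dom)//=.
have mfp := emeasurable_funM mf mp.
apply: ae_eq_integral => //; first by apply: emeasurable_funM.
apply: ae_eqe_mul2l; rewrite Radon_NikodymE//=.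
case: cid => /= h [h1 h2 h3]; apply: integral_ae_eq => //=.
by move=> A _ mA; rewrite -h3.
Qed.

(** Completing the square. *)
Lemma heat_mul (s v a x : R) : 0 < s -> 0 < v ->
  heat s (x - a) * heat v x =
  heat (s + v) a * heat (s * v / (s + v)) (x - a * v / (s + v)).
Proof.
move=> s0 v0; have sv0 : 0 < s + v by exact: addr_gt0.
rewrite /heat -!expRD; congr expR.
have -> : ln (s * v / (s + v)) = ln s + ln v - ln (s + v).
  by rewrite lnM ?posrE ?mulr_gt0 ?invr_gt0// lnM ?posrE// lnV ?posrE.
by field; rewrite !gt_eqF.
Qed.

Lemma heat_sym (s a x : R) : heat s (x - a) = heat s (a - x).
Proof. by rewrite /heat -[x - a]opprB sqrrN. Qed.

(** The semigroup property of the heat kernel; [v = 0] is the point mass at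
    [0]. *)
Lemma Rintegral_gaussian_heat (s v a : R) : 0 < s -> 0 <= v ->
  \int[gaussian 0 v]_x heat s (x - a) = heat (s + v) a.
Proof.
move=> s0; have [C C0 HC] := heat_taylor s0.
rewrite le_eqVlt => /predU1P[<-|v0].
  rewrite /gaussian eqxx /Rintegral integral_dirac//.
    by rewrite diracT mul1e/= addr0 sub0r /heat sqrrN.
  apply/measurable_EFinP; apply: measurableT_comp; first exact: measurable_heat.
  exact: measurable_funB.
rewrite /gaussian gt_eqF//.
have iheat : (normal_prob 0 (Num.sqrt v)).-integrable setT (fun x => (heat s (x - a))%:E).
  apply: (@Lfun2_integrable _ _ _ (normal_prob 0 (Num.sqrt v) : probability _ R) (fun x => heat s (x - a))).
  apply: (@Lfun2_bounded _ _ _ _ _ C) => [|x].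
    apply: measurableT_comp; first exact: measurable_heat.
    exact: measurable_funB.
  by rewrite ger0_norm ?heat_ge0//; have [[]] := HC s (lexx s) (x - a).
rewrite /Rintegral integral_normal_prob//.
have sv0 : 0 < s + v by exact: addr_gt0.
have tau0 : 0 < s * v / (s + v) by rewrite divr_gt0// mulr_gt0.
transitivity (fine (\int[lambda]_x ((heat (s + v) a)%:E *
    (heat_factor * heat (s * v / (s + v)) (x - a * v / (s + v)))%:E))%E).
  congr fine; apply: eq_integral => x _; rewrite normal_pdf_heat// -!EFinM subr0; congr EFin.
  by rewrite mulrCA heat_mul// mulrCA.
by rewrite integralZl ?integral_heat ?mule1//; exact: integrable_heat.
Qed.

Lemma continuous_heat (t : R) : 0 < t -> continuous (@heat R t).
Proof.
move=> t0 x; have [dx _] := derive_heat x t0.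
by apply: differentiable_continuous; exact/derivable1_diffP.
Qed.

(** The value of the kernel at its centre determines the variance. *)
Lemma heat0_inj (v w : R) : 0 <= v -> 0 <= w -> heat (1 + v) 0 = heat (1 + w) 0 -> v = w.
Proof.
move=> v0 w0; rewrite /heat expr0n/= !mul0r !subr0 => /expR_inj /oppr_inj.
move=> /(mulIf _) E; have {E} : ln (1 + v) = ln (1 + w).
  by apply: E; rewrite invr_neq0.
by move=> /ln_inj; rewrite !posrE !ltr_pwDl// => /(_ isT isT) /addrI.
Qed.

End gaussian_heat.

Section weak_convergence.
Context (R : realType).
Local Notation lambda := (@lebesgue_measure R).
Local Notation kappa := (@heat_factor R).

(** Compactness gives one modulus for the points of [[-(M+1), M+1]]; of two
    points at distance less than [1], either one is there or both are beyond
    [M], where [f] vanishes. *)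
Lemma uniform_continuity_compact_support (f : R -> R) (M : R) : continuous f ->
  (forall x, M < `|x| -> f x = 0) ->
  forall e, 0 < e -> exists2 delta, 0 < delta &
    forall x y, `|x - y| < delta -> `|f x - f y| < e.
Proof.
move=> cf f0 e e0.
have /compact_near_coveringP cov := @segment_compact R (- (M + 1)) (M + 1).
pose Q (dl x : R) := forall y, `|x - y| < dl -> `|f x - f y| < e.
have : \forall dl \near 0^'+, `[- (M + 1), M + 1]%classic `<=` Q dl.
  apply: cov => x _.
  have e20 : 0 < e / 2 by rewrite divr_gt0.
  have /cvgrPdist_lt/(_ _ e20)[r /= r0 fr] := cf x.
  have r20 : 0 < r / 2 by rewrite divr_gt0.
  exists (ball x (r / 2), [set dl | dl < r / 2]) => /=.
    by split; [exact: nbhsx_ballx|exact: nbhs_right_lt].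
  move=> [x' dl]/= [xx' dlr] y x'y.
  have fx' : `|f x - f x'| < e / 2.
    by apply: fr; rewrite /ball/= (lt_trans xx')// gtr_pMr// invf_lt1// ltr1n.
  have fy : `|f x - f y| < e / 2.
    apply: fr; rewrite /ball/= -(subrKA x') (le_lt_trans (ler_normD _ _))//.
    by rewrite [ltRHS]splitr ltrD// (lt_trans x'y).
  rewrite -(subrKA (f x)) (le_lt_trans (ler_normD _ _))// [ltRHS]splitr ltrD//.
  by rewrite distrC.
move=> [r /= r0 Hr].
pose dl := Num.min (r / 2) 1.
have dl0 : 0 < dl by rewrite lt_min ltr01 divr_gt0.
have dlr : dl < r.
  by rewrite gt_min; apply/orP; left; rewrite gtr_pMr// invf_lt1// ltr1n.
exists dl => // x y xy.
have [xM|xM] := leP `|x| (M + 1).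
  apply: (Hr dl) xy => //=; first by rewrite sub0r normrN gtr0_norm.
  by rewrite in_itv/= -ler_norml.
have dl1 : dl <= 1 by rewrite ge_min lexx orbT.
rewrite !f0 ?subrr ?normr0//.
  have := ler_distD y x 0; rewrite !subr0 => h.
  have := lt_le_trans xy dl1; lra.
by rewrite (lt_trans _ xM)// ltrDl.
Qed.

Lemma heat_boundE s : 0 < s -> exists2 C : R, 0 <= C & forall x, `|heat s x| <= C.
Proof.
move=> s0; have [C C0 HC] := heat_taylor s0; exists C => // x.
by rewrite ger0_norm ?heat_ge0//; have [[]] := HC s (lexx s) x.
Qed.

Lemma integrable_heat_comp d (T : measurableType d) (Q : probability T R)
    (Y : T -> R) s a : measurable_fun setT Y -> 0 < s ->
  Q.-integrable setT (EFin \o (fun x => heat s (Y x - a))).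
Proof.
move=> mY s0; have [C C0 HC] := heat_boundE s0.
apply: Lfun2_integrable; apply: (@Lfun2_bounded _ _ _ _ _ C) => // .
apply: measurableT_comp; first exact: measurable_heat.
exact: measurable_funB.
Qed.

Section smoothing.
Variables (f : R -> R) (M B : R).
Hypothesis cf : continuous f.
Hypothesis f0 : forall x, M < `|x| -> f x = 0.
Hypothesis fB : forall x, `|f x| <= B.

Let mf : measurable_fun setT f := continuous_measurable_fun cf.

Lemma integrable_compact_support : lambda.-integrable setT (EFin \o f).
Proof.
apply: (@le_integrable _ _ _ lambda setT measurableT _
  (fun x => (B * \1_(`[- M, M]%classic) x)%:E)).
- exact/measurable_EFinP.
- move=> x _; rewrite !abse_EFin lee_fin indicE.
  case: (boolP (x \in _)) => [_|]; first by rewrite mulr1 (le_trans (fB x))// ler_norm.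
  rewrite notin_setE/= in_itv/= -ler_norml => /negP; rewrite -ltNge => /f0 ->.
  by rewrite normr0 mulr0 normr0.
- by have := integrableZl measurableT B (@integrable_indic_itv R (- M) M true false).
Qed.

(** The convolution of [f] with the Gaussian density of variance [s]. *)
Definition smooth (s x : R) : R := \int[lambda]_a (f a * (kappa * heat s (x - a))).

(** This absorbs [x^2] into a wider kernel, with a factor of order [s]: with
    [z = x^2 / (4s)], it amounts to [z e^-z <= 1]. *)
Lemma heat_sqr_le (s x : R) : 0 < s -> x ^+ 2 * heat s x <= 8 * s * heat (2 * s) x.
Proof.
move=> s0; have s20 : 0 < 2 * s by exact: mulr_gt0.
pose z := x ^+ 2 / (4 * s).
have z0 : 0 <= z by rewrite divr_ge0 ?sqr_ge0// mulr_ge0// ltW.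
have -> : heat s x = expR (ln 2 / 2) * expR (- z) * heat (2 * s) x.
  rewrite /heat -!expRD; congr expR; rewrite lnM ?posrE// /z.
  by field; rewrite gt_eqF.
have h0 := heat_ge0 (2 * s) x.
have l2 : expR (ln 2 / 2) <= 2 :> R.
  rewrite -[leRHS]lnK ?posrE// ler_expR ler_pdivrMr// ler_peMr//.
    by rewrite ln_ge0// ler1n.
  by rewrite ler1n.
have zz : z * expR (- z) <= 1.
  by rewrite expRN ler_pdivrMr ?expR_gt0// mul1r (le_trans _ (expR_ge1Dx z))// lerDr.
have -> : x ^+ 2 = 4 * s * z by rewrite /z; field; rewrite gt_eqF.
rewrite [leLHS](_ : _ = 4 * s * (expR (ln 2 / 2) * (z * expR (- z))) * heat (2 * s) x); last by ring.
rewrite ler_wpM2r// [leRHS](_ : _ = 4 * s * (2 * 1)); last by ring.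
rewrite ler_wpM2l ?mulr_ge0 ?(ltW s0)//.
by rewrite ler_pM ?expR_ge0// mulr_ge0// expR_ge0.
Qed.

Let B0 : 0 <= B := le_trans (normr_ge0 (f 0)) (fB 0).

Let ismooth s x : 0 < s ->
  lambda.-integrable setT (fun a => (f a * (kappa * heat s (x - a)))%:E).
Proof.
move=> s0; apply: (@le_integrable _ _ _ lambda setT measurableT _
  (fun a => (B * (kappa * heat s (a - x)))%:E)).
- apply/measurable_EFinP; apply: measurable_funM => //; apply: measurable_funM => //.
  apply: measurableT_comp; first exact: measurable_heat.
  exact: measurable_funB.
- move=> a _; rewrite !abse_EFin lee_fin heat_sym !normrM ler_wpM2r//.
  by rewrite (le_trans (fB a))// ler_norm.
- by have := integrableZl measurableT B (integrable_heat x s0).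
Qed.

(** Chebyshev's idea: [|f a - f x| <= e/2 + K (a - x)^2] everywhere, and the
    Gaussian second moment is [O(s)]. *)
Lemma smooth_close (e : R) : 0 < e ->
  exists2 s, 0 < s & forall x, `|smooth s x - f x| <= e.
Proof.
move=> e0; have e20 : 0 < e / 2 by rewrite divr_gt0.
have [dl dl0 fdl] := uniform_continuity_compact_support cf f0 e20.
pose K := 2 * B / dl ^+ 2.
have K0 : 0 <= K by apply: divr_ge0; [exact: mulr_ge0|exact: sqr_ge0].
pose s := e / (16 * (K + 1)).
have K1 : 0 < K + 1 by rewrite ltr_wpDl.
have s0 : 0 < s by rewrite divr_gt0// mulr_gt0.
have s20 : 0 < 2 * s by exact: mulr_gt0.
exists s => // x.
have fx a : `|f a - f x| <= e / 2 + K * (a - x) ^+ 2.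
  have [ax|ax] := ltP `|a - x| dl.
    by rewrite (le_trans (ltW (fdl _ _ ax)))// lerDl mulr_ge0// sqr_ge0.
  apply: (@le_trans _ _ (2 * B)).
    by rewrite (le_trans (ler_normB _ _))// mulr2n mulrDl mul1r lerD.
  rewrite -[leLHS]add0r lerD ?(ltW e20)// /K mulrAC ler_pdivlMr ?exprn_gt0//.
  rewrite ler_wpM2l ?mulr_ge0// -(real_normK (num_real (a - x))) ler_pXn2r// nnegrE ltW//.
have ih := integrable_heat x s0; have ih2 := integrable_heat x s20.
have ifx : lambda.-integrable setT (EFin \o (fun a => f x * (kappa * heat s (a - x)))).
  by have := integrableZl measurableT (f x) ih.
have ibd1 : lambda.-integrable setT (EFin \o (fun a => e / 2 * (kappa * heat s (a - x)))).
  by have := integrableZl measurableT (e / 2) ih.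
have ibd2 : lambda.-integrable setT (EFin \o (fun a => K * (8 * s) * (kappa * heat (2 * s) (a - x)))).
  by have := integrableZl measurableT (K * (8 * s)) ih2.
have iD : lambda.-integrable setT (EFin \o (fun a =>
    f a * (kappa * heat s (x - a)) - f x * (kappa * heat s (a - x)))).
  by have := integrableB measurableT (ismooth x s0) ifx.
have -> : smooth s x - f x = \int[lambda]_a
    (f a * (kappa * heat s (x - a)) - f x * (kappa * heat s (a - x))).
  rewrite (RintegralB measurableT (ismooth x s0) ifx).
  by rewrite (RintegralZl (f x) measurableT ih) Rintegral_heat// mulr1.
apply: (le_trans (le_normr_Rintegral measurableT iD)).
apply: (@le_trans _ _ (\int[lambda]_a (e / 2 * (kappa * heat s (a - x)) +
    K * (8 * s) * (kappa * heat (2 * s) (a - x))))).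
  apply: le_Rintegral => //.
  - by have := integrable_abse iD.
  - by have := integrableD measurableT ibd1 ibd2.
  move=> a _; rewrite heat_sym -mulrBl normrM.
  have k0 := heat_factor_gt0 R; have h0 := heat_ge0 s (a - x).
  rewrite (ger0_norm (mulr_ge0 (ltW k0) h0)).
  apply: (@le_trans _ _ ((e / 2 + K * (a - x) ^+ 2) * (kappa * heat s (a - x)))).
    by rewrite ler_wpM2r// mulr_ge0// ltW.
  rewrite mulrDl lerD2l.
  rewrite [leLHS](_ : _ = K * kappa * ((a - x) ^+ 2 * heat s (a - x))); last by ring.
  rewrite [leRHS](_ : _ = K * kappa * (8 * s * heat (2 * s) (a - x))); last by ring.
  apply: ler_wpM2l; first exact: mulr_ge0 K0 (ltW k0).
  exact: heat_sqr_le.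
rewrite (RintegralD measurableT ibd1 ibd2) (RintegralZl _ measurableT ih).
rewrite (RintegralZl _ measurableT ih2) !Rintegral_heat// !mulr1.
have : K * (8 * s) <= (K + 1) * (8 * s).
  apply: ler_wpM2r; first by apply: mulr_ge0 => //; exact: ltW.
  by rewrite lerDl.
have -> : (K + 1) * (8 * s) = e / 2 by rewrite /s; field; rewrite gt_eqF.
lra.
Qed.

Section fubini.
Context d (T : measurableType d) (Q : probability T R) (Y : T -> R).
Hypothesis mY : measurable_fun setT Y.
Variable s : R.
Hypothesis s0 : 0 < s.

Let F (z : T * R) : R := f z.2 * (kappa * heat s (Y z.1 - z.2)).

Let mF : measurable_fun setT F.
Proof.
apply: measurable_funM; first exact: (measurableT_comp mf measurable_snd).
apply: measurable_funM => //; apply: measurableT_comp; first exact: measurable_heat.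
by apply: measurable_funB => //; exact: measurableT_comp.
Qed.

Let iF : (Q \x lambda)%E.-integrable setT (EFin \o F).
Proof.
have [C C0 HC] := heat_boundE s0.
have iC : Q.-integrable setT (EFin \o (fun=> kappa * C)).
  exact: (finite_measure_integrable_cst Q (kappa * C) measurableT).
apply: (le_integrable measurableT _ _ (integrable_tensor iC integrable_compact_support)).
  exact/measurable_EFinP.
move=> [x a] _; rewrite !abse_EFin lee_fin /F/= !normrM mulrC ler_wpM2r// ler_wpM2l//.
by rewrite (le_trans (HC _))// ler_norm.
Qed.

Let iheatY a : Q.-integrable setT (EFin \o (fun x => heat s (Y x - a))).
Proof. exact: integrable_heat_comp. Qed.

Let GE : fubini_G Q (EFin \o F) =
  EFin \o (fun a => f a * (kappa * \int[Q]_x heat s (Y x - a))).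
Proof.
apply/funext => a; rewrite /fubini_G /=.
transitivity (\int[Q]_x (f a * kappa * heat s (Y x - a))%:E)%E.
  by apply: eq_integral => x _; rewrite /F/= mulrA.
rewrite mulrA -(RintegralZl _ measurableT (iheatY a)) fineK//.
apply: integrable_fin_num => //.
by have := integrableZl measurableT (f a * kappa) (iheatY a).
Qed.

Let FE : fubini_F lambda (EFin \o F) = EFin \o (fun x => smooth s (Y x)).
Proof.
apply/funext => x; rewrite /fubini_F /= /smooth /Rintegral fineK//.
exact: (integrable_fin_num measurableT (ismooth (Y x) s0)).
Qed.

Lemma measurable_smooth_fubini :
  measurable_fun setT (fun a => f a * (kappa * \int[Q]_x heat s (Y x - a))).
Proof.
have mG : measurable_fun setT (EFin \o (fun a => f a * (kappa * \int[Q]_x heat s (Y x - a)))).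
  by rewrite -GE; exact: measurable_fubini_G iF.
by apply/measurable_EFinP; exact: mG.
Qed.

Lemma integrable_smooth : Q.-integrable setT (EFin \o (fun x => smooth s (Y x))).
Proof. by have := integrable_fubini_F iF; rewrite FE. Qed.

(** The expectation of a smoothed function is an average of expectations of
    heat kernels. *)
Lemma smooth_fubini : \int[Q]_x smooth s (Y x) =
  \int[lambda]_a (f a * (kappa * \int[Q]_x heat s (Y x - a))).
Proof.
rewrite /Rintegral -[X in fine X = _]/(\int[Q]_x (EFin \o (fun x => smooth s (Y x))) x)%E -FE.
rewrite integral12_prod_meas1// -integral21_prod_meas1//.
transitivity (fine (\int[lambda]_a fubini_G Q (EFin \o F) a)%E); first by [].
by rewrite GE.
Qed.

End fubini.

End smoothing.

Section convergence.
Context d (T : measurableType d) (P : probability T R) (Y : nat -> T -> R).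
Variable nu : probability (measurableTypeR R) R.
Hypothesis mY : forall N, measurable_fun setT (Y N).
Hypothesis heatY : forall s a, 0 < s ->
  \int[P]_x heat s (Y N x - a) @[N --> \oo] --> \int[nu]_x heat s (x - a).

(** Dominated convergence in the centre [a] of the kernel. *)
Lemma cvg_smooth (f : R -> R) (M B s : R) : continuous f ->
  (forall x, M < `|x| -> f x = 0) -> (forall x, `|f x| <= B) -> 0 < s ->
  \int[P]_x smooth f s (Y N x) @[N --> \oo] --> \int[nu]_x smooth f s x.
Proof.
move=> cf f0 fB s0.
have mid : measurable_fun setT (fun x : measurableTypeR R => x : R) by exact: measurable_id.
rewrite (smooth_fubini cf f0 fB nu mid s0).
have -> : (fun N => \int[P]_x smooth f s (Y N x)) = (fun N =>
    \int[lambda]_a (f a * (kappa * \int[P]_x heat s (Y N x - a)))).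
  by apply/funext => N; rewrite (smooth_fubini cf f0 fB P (mY N) s0).
have [C C0 HC] := heat_boundE s0.
have intf := integrable_compact_support cf f0 fB.
have [|||||iG _ cv] := @dominated_convergence _ _ _ lambda setT measurableT
  (fun N a => (f a * (kappa * \int[P]_x heat s (Y N x - a)))%:E)
  (fun a => (f a * (kappa * \int[nu]_x heat s (x - a)))%:E)
  (fun a => (kappa * C * `|f a|)%:E).
- by move=> N; apply/measurable_EFinP; exact: (measurable_smooth_fubini cf f0 fB P (mY N) s0).
- by apply/measurable_EFinP; exact: (measurable_smooth_fubini cf f0 fB nu mid s0).
- apply: aeW => a _; apply: cvg_EFin; first exact: nearW.
  by apply: cvgMr; apply: cvgMr; exact: heatY.
- by have := integrableZl measurableT (kappa * C) (integrable_abse intf).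
- apply: aeW => a N _; rewrite abse_EFin lee_fin !normrM mulrC ler_wpM2r//.
  have k0 := heat_factor_gt0 R; rewrite (gtr0_norm k0) ler_wpM2l ?(ltW k0)//.
  have iH : P.-integrable setT (EFin \o (fun x => heat s (Y N x - a))).
    exact: integrable_heat_comp.
  rewrite (le_trans (le_normr_Rintegral measurableT iH))// -[leRHS](Rintegral_cst1 P).
  apply: le_Rintegral => //; first by have := integrable_abse iH.
  exact: (finite_measure_integrable_cst P C measurableT).
have cv' : (\int[lambda]_a (f a * (kappa * \int[P]_x heat s (Y N x - a)))%:E)%E @[N --> \oo]
    --> (\int[lambda]_a (f a * (kappa * \int[nu]_x heat s (x - a))))%:E.
  by rewrite fineK//; exact: (integrable_fin_num measurableT iG).
exact: fine_cvg cv'.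
Qed.

Lemma cvg_compact_support (f : R -> R) (M B : R) : continuous f ->
  (forall x, M < `|x| -> f x = 0) -> (forall x, `|f x| <= B) ->
  \int[P]_x f (Y N x) @[N --> \oo] --> \int[nu]_x f x.
Proof.
move=> cf f0 fB; apply/cvgrPdist_le => e e0.
have e30 : 0 < e / 3 by rewrite divr_gt0.
have [s s0 fs] := smooth_close cf f0 fB e30.
have close d' (T' : measurableType d') (Q : probability T' R) (Z : T' -> R) :
    measurable_fun setT Z ->
    `|\int[Q]_x smooth f s (Z x) - \int[Q]_x f (Z x)| <= e / 3.
  move=> mZ; have isf := integrable_smooth cf f0 fB Q mZ s0.
  have iff : Q.-integrable setT (EFin \o (fun x => f (Z x))).
    apply: Lfun2_integrable; apply: (@Lfun2_bounded _ _ _ _ _ B) => //.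
    by apply: measurableT_comp => //; exact: continuous_measurable_fun.
  rewrite -(RintegralB measurableT isf iff).
  have iD : Q.-integrable setT (EFin \o (fun x => smooth f s (Z x) - f (Z x))).
    by have := integrableB measurableT isf iff.
  rewrite (le_trans (le_normr_Rintegral measurableT iD))// -[leRHS](Rintegral_cst1 Q).
  apply: le_Rintegral => //; first by have := integrable_abse iD.
  exact: (finite_measure_integrable_cst Q (e / 3) measurableT).
have mid : measurable_fun setT (fun x : measurableTypeR R => x : R) by exact: measurable_id.
have cnu := close _ _ nu _ mid.
have /cvgrPdist_le/(_ _ e30) := cvg_smooth cf f0 fB s0.
apply: filterS => N; move: cnu; have := close _ _ P _ (mY N).
set a := \int[P]_x _; set b := \int[P]_x _; set c := \int[nu]_x _; set g := \int[nu]_x _.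
rewrite !ler_norml => /andP[? ?] /andP[? ?] /andP[? ?]; apply/andP; split; lra.
Qed.

Definition cutoff (M x : R) : R := Num.max 0 (Num.min 1 (M + 1 - `|x|)).

Lemma continuous_cutoff M : continuous (cutoff M).
Proof.
move=> x; have c1 : {for x, continuous ((fun=> 1) \min (fun y : R => M + 1 - `|y|))}.
  apply: continuous_min; first exact: cvg_cst.
  by apply: cvgB; [exact: cvg_cst|exact: norm_continuous].
by apply: (@continuous_max _ _ (fun=> 0) _ x _ c1); exact: cvg_cst.
Qed.

Lemma cutoff_ge0 M x : 0 <= cutoff M x.
Proof. by rewrite le_max lexx. Qed.

Lemma cutoff_le1 M x : cutoff M x <= 1.
Proof. by rewrite ge_max ler01 ge_min lexx. Qed.

Lemma cutoff_out M x : M + 1 < `|x| -> cutoff M x = 0.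
Proof.
move=> Mx; apply/max_idPl; rewrite ge_min; apply/orP; right.
by rewrite subr_le0 ltW.
Qed.

Lemma cutoff_in M x : `|x| <= M -> cutoff M x = 1.
Proof.
move=> xM; rewrite /cutoff (min_idPl _) ?(max_idPr _)//.
by lra.
Qed.

Lemma norm_cutoff_le1 M x : `|cutoff M x| <= 1.
Proof. by rewrite ger0_norm ?cutoff_ge0// cutoff_le1. Qed.

Let mid : measurable_fun setT (fun x : measurableTypeR R => x : R).
Proof. exact: measurable_id. Qed.

Lemma cvg_Rintegral_cutoff : \int[nu]_x cutoff n%:R x @[n --> \oo] --> (1 : R).
Proof.
have [|||||_ _ cv] := @dominated_convergence _ _ _ nu setT measurableT
  (fun n x => (cutoff n%:R x)%:E) (fun=> 1%E) (fun=> 1%E).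
- by move=> n; apply/measurable_EFinP; apply: continuous_measurable_fun; exact: continuous_cutoff.
- exact: measurable_cst.
- apply: aeW => x _; apply: cvg_near_cst.
  near=> n; rewrite cutoff_in//.
  by near: n; exact: nbhs_infty_ger.
- exact: (finite_measure_integrable_cst nu 1 measurableT).
- by apply: aeW => x n _; rewrite abse_EFin lee_fin norm_cutoff_le1.
have cv' : (\int[nu]_x (cutoff n%:R x)%:E)%E @[n --> \oo] --> 1%:E.
  suff <- : (\int[nu]__ 1)%E = 1%:E by [].
  by rewrite integral_cst// mul1e; exact: probability_setT.
exact: fine_cvg cv'.
Unshelve. all: by end_near. Qed.

(** The truncation error is controlled by the mass where the cutoff is less
    than [1]. *)
Lemma cutoff_close d' (T' : measurableType d') (Q : probability T' R) (Z : T' -> R)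
    (f : R -> R) (B M : R) : measurable_fun setT Z -> continuous f ->
  (forall x, `|f x| <= B) ->
  `|\int[Q]_x f (Z x) - \int[Q]_x (f (Z x) * cutoff M (Z x))| <=
    B * (1 - \int[Q]_x cutoff M (Z x)).
Proof.
move=> mZ cf fB.
have B0 : 0 <= B := le_trans (normr_ge0 (f 0)) (fB 0).
have bnd (g : R -> R) C : continuous g -> (forall x, `|g x| <= C) ->
    Q.-integrable setT (EFin \o (fun x => g (Z x))).
  move=> cg gC; apply: Lfun2_integrable; apply: (@Lfun2_bounded _ _ _ _ _ C) => //.
  by apply: measurableT_comp => //; exact: continuous_measurable_fun.
have i1 := bnd _ _ cf fB.
have ic := bnd _ _ (@continuous_cutoff M) (norm_cutoff_le1 M).
have i2 : Q.-integrable setT (EFin \o (fun x => f (Z x) * cutoff M (Z x))).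
  apply: (bnd (fun x => f x * cutoff M x) B) => x.
    by apply: continuousM; [exact: cf|exact: continuous_cutoff].
  by rewrite normrM -[leRHS]mulr1 ler_pM// norm_cutoff_le1.
have i3 : Q.-integrable setT (EFin \o (fun x => 1 - cutoff M (Z x))).
  by have := integrableB measurableT (finite_measure_integrable_cst Q 1 measurableT) ic.
have i4 : Q.-integrable setT (EFin \o (fun x => f (Z x) - f (Z x) * cutoff M (Z x))).
  by have := integrableB measurableT i1 i2.
rewrite -(RintegralB measurableT i1 i2).
rewrite (le_trans (le_normr_Rintegral measurableT i4))//.
rewrite -[X in X - _](Rintegral_cst1 Q 1).
rewrite -(RintegralB measurableT (finite_measure_integrable_cst Q 1 measurableT) ic).
rewrite -(RintegralZl B measurableT i3).
apply: le_Rintegral => //; first by have := integrable_abse i4.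
  by have := integrableZl measurableT B i3.
move=> x _; rewrite -{1}[f _]mulr1 -mulrBr normrM.
rewrite [in leLHS](@ger0_norm _ (1 - _)) ?subr_ge0 ?cutoff_le1//.
by rewrite ler_wpM2r// subr_ge0 cutoff_le1.
Qed.

(** No tightness is assumed: the cutoff is itself a compactly supported test
    function, so its integrals against the [Y N] converge, and mass escaping to
    infinity would contradict that the limit is a probability. *)
Lemma heat_cvg_in_distribution : cvg_in_distribution P Y nu.
Proof.
move=> f cf [B fB].
have B0 : 0 <= B := le_trans (normr_ge0 (f 0)) (fB 0).
have bnd d' (T' : measurableType d') (Q : probability T' R) (Z : T' -> R) :
    measurable_fun setT Z -> Q.-integrable setT (EFin \o (fun x => f (Z x))).
  move=> mZ; apply: Lfun2_integrable; apply: (@Lfun2_bounded _ _ _ _ _ B) => //.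
  by apply: measurableT_comp => //; exact: continuous_measurable_fun.
have -> : (\int[nu]_x (f x)%:E)%E = (\int[nu]_x f x)%:E.
  by rewrite fineK// (integrable_fin_num measurableT (bnd _ _ nu _ mid)).
have -> : (fun N => 'E_P[f \o Y N]%E) = EFin \o (fun N => \int[P]_x f (Y N x)).
  apply/funext => N; rewrite /= unlock fineK//.
  by rewrite (integrable_fin_num measurableT (bnd _ _ P _ (mY N))).
apply: cvg_EFin; first exact: nearW.
apply/cvgrPdist_le => e e0.
(* the truncation errors are at most B eta for nu and 2 B eta for Y N *)
pose eta := e / (4 * (B + 1)).
have B1 : 0 < B + 1 by rewrite ltr_wpDl.
have eta0 : 0 < eta by rewrite divr_gt0// mulr_gt0.
have Beta : B * (2 * eta) <= e / 2.
  rewrite /eta [leLHS](_ : _ = (B / (B + 1)) * (e / 2)).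
    by rewrite ler_piMl ?divr_ge0 ?(ltW e0)// ler_pdivrMr// mul1r lerDl.
  by field; rewrite gt_eqF.
have /cvgrPdist_le/(_ _ eta0)[n _ /(_ n (leqnn n)) cn] := cvg_Rintegral_cutoff.
pose M : R := n%:R.
have fM0 x : M + 1 < `|x| -> f x * cutoff M x = 0.
  by move=> h; rewrite cutoff_out// mulr0.
have fMB x : `|f x * cutoff M x| <= B.
  by rewrite normrM -[leRHS]mulr1 ler_pM// norm_cutoff_le1.
have cfM : continuous (fun x => f x * cutoff M x).
  by move=> x; apply: continuousM; [exact: cf|exact: continuous_cutoff].
have e40 : 0 < e / 4 by rewrite divr_gt0.
have /cvgrPdist_le/(_ _ e40) H1 := cvg_compact_support cfM fM0 fMB.
have /cvgrPdist_le/(_ _ eta0) H2 :=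
  cvg_compact_support (@continuous_cutoff M) (@cutoff_out M) (norm_cutoff_le1 M).
near=> N.
have h1 : `|\int[nu]_x (f x * cutoff M x) - \int[P]_x (f (Y N x) * cutoff M (Y N x))| <= e / 4.
  by near: N.
have h2 : `|\int[nu]_x cutoff M x - \int[P]_x cutoff M (Y N x)| <= eta by near: N.
have h3 := cutoff_close P M (mY N) cf fB.
have h4 := cutoff_close nu M mid cf fB.
move: cn h1 h2 h3 h4; rewrite -/M.
set a := \int[nu]_x cutoff M x; set b := \int[P]_x cutoff M _.
set u := \int[nu]_x f x; set u' := \int[nu]_x _; set v := \int[P]_x f _; set v' := \int[P]_x _.
move=> cn h1 h2 h3 h4.
have a1 : 1 - a <= eta by rewrite (le_trans (ler_norm _)).
have b1 : 1 - b <= 2 * eta.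
  have := le_trans (ler_norm _) h2; lra.
have {}h3 : `|v - v'| <= e / 2.
  by rewrite (le_trans h3)// (le_trans _ Beta)// ler_wpM2l.
have {}h4 : `|u - u'| <= e / 4.
  rewrite (le_trans h4)// (le_trans (ler_wpM2l B0 a1))//.
  move: Beta; rewrite mulrCA; lra.
rewrite -[X in u - X]/v; move: h1 h3 h4; rewrite !ler_norml => /andP[? ?] /andP[? ?] /andP[? ?].
by apply/andP; split; lra.
Unshelve. all: by end_near. Qed.

End convergence.

End weak_convergence.

(** * Limit theorems for i.i.d. samples *)

Section iid.
Context (R : realType) (d0 : measure_display) (Omega : measurableType d0)
  (P : probability Omega R) (d : measure_display) (T : measurableType d)
  (X : nat -> {mfun Omega >-> T}) (nu : probability T R).
Hypothesis iidX : iid_with_law P X nu.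

Lemma law_iid n : has_law P (X n) nu.
Proof. by split=> [//|B mB]; exact: iidX.1. Qed.

Lemma independent_iid i j : i != j -> independent P (X i) (X j).
Proof.
move=> ij A B mA mB; pose C n := if n == i then A else B.
have := iidX.2 [:: i; j] C; rewrite /= inE ij/= => /(_ isT).
have mC n : measurable (C n) by rewrite /C; case: ifP.
move=> /(_ mC); rewrite !big_cons big_nil mule1 /C eqxx eq_sym (negPf ij) => <-.
congr (P _); apply/seteqP; split=> [x [Ax Bx] n /=|x CX].
  by rewrite !inE => /orP[]/eqP ->; rewrite ?eqxx// eq_sym (negPf ij).
split; first by have := CX i; rewrite /= inE eqxx; exact.
by have := CX j; rewrite /= !inE eqxx orbT eq_sym (negPf ij); exact.
Qed.

(** The past is gathered in one point of a product space, so that independence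
    is checked on boxes, where it is the assumed product rule. *)
Lemma independent_past n : independent P
  (fun omega => (fun j : 'I_n => X j omega) : prod_space (fun=> T)) (X n).
Proof.
move=> A B mA mB; apply: prod_space_independent_event => //.
- by apply: measurable_to_prod => j; exact: measurable_funP.
- by rewrite -[X in measurable X]setTI; exact: measurable_funP.
move=> {mA}A mA.
pose C m : set T := if insub m is Some j then A j else B.
have mC m : measurable (C m) by rewrite /C; case: insub.
have CE (j : 'I_n) : C j = A j by rewrite /C valK.
have CB : C n = B by rewrite /C insubF// ltnn.
have AE : (fun omega => (fun j : 'I_n => X j omega) : prod_space (fun=> T)) @^-1` box A =
    \bigcap_(m in [set` iota 0 n]) X m @^-1` C m.
  apply/seteqP; split=> [x Ax m /=|x Cx j].
    by rewrite mem_iota => mn; rewrite (CE (Ordinal mn)); exact: (Ax (Ordinal mn)).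
  by rewrite -CE; apply: Cx; rewrite /= mem_iota/=.
have -> : (fun omega => (fun j : 'I_n => X j omega) : prod_space (fun=> T)) @^-1` box A `&`
    X n @^-1` B = \bigcap_(m in [set` iota 0 n.+1]) X m @^-1` C m.
  rewrite AE -CB; apply/seteqP; split=> [x [Cx Cnx] m /=|x Cx].
    rewrite -[_ :: _]/(iota 0 n.+1) mem_iota => /andP[_].
    rewrite add0n ltnS leq_eqVlt => /predU1P[->//|mn].
    by apply: Cx; rewrite /= mem_iota.
  split=> [m /=|]; last by apply: (Cx n); rewrite /= -[_ :: _]/(iota 0 n.+1) mem_iota/= ltnSn.
  rewrite mem_iota => /andP[_ mn]; apply: (Cx m).
  by rewrite /= -[_ :: _]/(iota 0 n.+1) mem_iota/= ltnW.
rewrite AE !iidX.2 ?iota_uniq// -addn1 iotaD big_cat/= big_seq1.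
by rewrite CB.
Qed.

Section statistic.
Variable h : T -> R.
Hypothesis h2 : h \in Lfun nu 2%:E.
Hypothesis h0 : \int[nu]_x h x = 0.

Let mh : measurable_fun setT h := Lfun2_measurable h2.

Lemma Lfun2_iid n : h \o X n \in Lfun P 2%:E.
Proof. by apply: (law_Lfun2 (law_iid n)) => //; exact: Lfun2_integrable_sqr. Qed.

Lemma iid_slln :
  {ae P, forall omega, N%:R^-1 * \sum_(j < N) h (X j omega) @[N --> \oo] --> (0 : R)}.
Proof.
apply: (@slln_orthogonal _ _ _ P (fun j => h \o X j) (\int[nu]_x h x ^+ 2)) => [n|i j].
  exact: Lfun2_iid.
have ih := Lfun2_integrable h2.
have [->|ij] := eqVneq i j.
  rewrite mul1r; apply: (law_Rintegral (law_iid j) (f := fun x => h x * h x)).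
  exact: Lfun2_integrableM.
rewrite mul0r (@independent_Rintegral _ _ _ P (h \o X i) (h \o X j)).
- by rewrite (law_Rintegral (law_iid i) ih) h0 mul0r.
- by apply: independent_comp => //; exact: independent_iid.
- exact: Lfun2_integrable (Lfun2_iid i).
- exact: Lfun2_integrable (Lfun2_iid j).
Qed.

(** The central limit theorem for statistics of general random elements, by
    transfer to the real law of [h]. *)
Lemma iid_heat_clt s a : 0 < s ->
  \int[P]_x heat s ((Num.sqrt N%:R)^-1 * \sum_(j < N) h (X j x) - a) @[N --> \oo] -->
  heat (s + \int[nu]_x h x ^+ 2) a.
Proof.
move=> s0; pose H : {mfun T >-> R} := mfun_Sub (mem_set mh).
have lawh : has_law nu h (distribution nu H) by split.
have mid : measurable_fun setT (fun y : R => y) by exact: measurable_id.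
have ih := Lfun2_integrable h2.
have ih2 : (distribution nu H).-integrable setT (fun y => (y ^+ 2)%:E).
  apply: (law_integrableE lawh).
    by apply/measurable_EFinP; exact: measurable_funX.
  by apply: (Lfun2_integrable_sqr h2).
have ih1 : (distribution nu H).-integrable setT (EFin \o id).
  by apply: (law_integrableE lawh); [exact/measurable_EFinP|exact: ih].
rewrite [X in s + X](law_Rintegral lawh (f := fun y => y ^+ 2))//.
apply: (@heat_clt _ _ _ P (distribution nu H) (fun j => h \o X j)) => //.
- move=> n; split; first exact: measurableT_comp.
  move=> B mB; apply: (iidX.1 n); rewrite -[X in measurable X]setTI.
  exact: mh.
- by rewrite -(law_Rintegral lawh ih1).
- move=> n; have := @independent_past n.
  apply: (independent_comp (f := fun x : prod_space (fun _ : 'I_n => T) => \sum_(j < n) h (x j))) => //.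
  apply: measurable_sum => j; apply: measurableT_comp => //.
  exact: measurable_coord.
Qed.

End statistic.
End iid.

Section asymptotic_variance.
Context (R : realType) (d : measure_display) (T : measurableType d) (P : probability T R).

Lemma gaussian_limit_unique (Y : nat -> T -> R) (v v' : R) : 0 <= v -> 0 <= v' ->
  cvg_in_distribution P Y (gaussian 0 v) -> cvg_in_distribution P Y (gaussian 0 v') ->
  v = v'.
Proof.
move=> v0 v0' Yv Yv'; have [C C0 HC] := heat_boundE (@ltr01 R).
have c1 : continuous (@heat R 1) by exact: continuous_heat.
have b1 : exists M, forall x, `|@heat R 1 x| <= M by exists C.
have E := cvg_unique (@ereal_hausdorff R) (Yv _ c1 b1) (Yv' _ c1 b1).
have GE (u : R) : 0 <= u -> heat (1 + u) 0 = fine (\int[gaussian 0 u]_x (heat 1 x)%:E)%E.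
  move=> u0; rewrite -(Rintegral_gaussian_heat 0 (@ltr01 R) u0) /Rintegral.
  by congr fine; apply: eq_integral => x _; rewrite subr0.
apply: (heat0_inj v0 v0').
apply: (etrans (GE _ v0)).
apply: (etrans _ (esym (GE _ v0'))).
by apply: (congr1 fine); exact: (E _).
Qed.

Lemma asymptotic_varianceE (Y : nat -> T -> R) (c v : R) : 0 <= v ->
  cvg_in_distribution P (scaled_error Y c) (gaussian 0 v) ->
  asymptotic_variance P Y c = v.
Proof.
move=> v0 Yv; rewrite /asymptotic_variance.
case: xgetP => [u _ [u0 Yu]|/(_ v)[]//].
exact: gaussian_limit_unique Yu Yv.
Qed.

End asymptotic_variance.

(** * Change of measure *)
Section change_of_measure.
Context (R : realType) (d : measure_display) (T : measurableType d)
  (mu : probability T R) (gamma : {finite_measure set T -> \bar R})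
  (w : {mfun T >-> R}) (phi : T -> R).
Hypothesis gamma_ac : gamma `<< mu.
Hypothesis wE : ae_eq mu setT (EFin \o w)
  (Radon_Nikodym (charge_of_finite_measure gamma) mu).
Hypothesis phi_int : gamma.-integrable setT (EFin \o phi).

Let f := Radon_Nikodym_SigmaFinite.f gamma mu.

Let wf : ae_eq mu setT (EFin \o w) f.
Proof.
apply: (ae_eq_trans wE); apply: ae_eq_sym.
exact: ae_eq_Radon_Nikodym_SigmaFinite.
Qed.

Let mphi : measurable_fun setT phi.
Proof. by apply/measurable_EFinP; exact: measurable_int phi_int. Qed.

(** The version [f] of the Radon-Nikodym derivative is nonnegative, so that
    [|w * phi| = |phi| * f] almost everywhere. *)
Lemma integrable_density : mu.-integrable setT (EFin \o (w \* phi)).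
Proof.
have mwphi : measurable_fun setT (EFin \o (w \* phi)).
  by apply/measurable_EFinP; exact: measurable_funM.
have /integrableP[mabs foo] : mu.-integrable setT ((abse \o (EFin \o phi)) \* f)%E.
  apply: Radon_Nikodym_SigmaFinite.integrableM => //; first by move=> x; exact: abse_ge0.
  exact: integrable_abse.
apply/integrableP; split => //.
suff -> : (\int[mu]_x `|(EFin \o (w \* phi)%R) x| =
    \int[mu]_x `|((abse \o (EFin \o phi)) \* f) x|)%E by [].
apply: ae_eq_integral => //; [exact: measurableT_comp|exact: measurableT_comp|].
apply: filterS wf => x /(_ I) /= wfx _.
have f0 := Radon_Nikodym_SigmaFinite.f_ge0 gamma_ac x.
by rewrite -abse_EFin EFinM -wfx -EFinM !abse_EFin !normrM normr_id mulrC.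
Qed.

Lemma integral_density : (\int[mu]_x ((w \* phi) x)%:E = \int[gamma]_x (phi x)%:E)%E.
Proof.
rewrite -(Radon_Nikodym_change_of_variables gamma_ac)//=.
have mwphi := measurable_int _ integrable_density.
have mphi' := measurable_int _ phi_int.
apply: ae_eq_integral => //.
  by apply: emeasurable_funM => //; exact: measurable_int (Radon_Nikodym_integrable _).
by apply: filterS wE => x /(_ I) /= <- _; rewrite -EFinM mulrC.
Qed.

End change_of_measure.

(** * Limits of the estimators *)

Section estimator_limits.
Context (I : finType) (d : I -> measure_display) (S : forall i, measurableType (d i))
  (R : realType) (mu : forall i, probability (S i) R)
  (d0 : measure_display) (Omega : measurableType d0) (P : probability Omega R)
  (X : nat -> {mfun Omega >-> prod_space S}).
Hypothesis iidX : iid_with_law P X (prod_prob mu).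
Variable psi : prod_space S -> R.
Hypothesis psi2 : psi \in Lfun (prod_prob mu) 2%:E.
Hypothesis ppsi : partially_integrable mu psi.
Local Notation m := (mean mu psi).
Local Notation h := (hajek mu psi).

Let h2 := Lfun2_hajek iidX psi2 ppsi.
Let h0 := Rintegral_hajek iidX psi2 ppsi.

Lemma muN_times_strongly_consistent :
  {ae P, forall omega, muN_times X N psi omega @[N --> \oo] --> m}.
Proof.
(* the remainder, set to 0 for N = 0, which the moment estimates exclude *)
pose Z N omega := if N is 0%N then 0 else muN_times X N psi omega - m - muN X N h omega.
have : {ae P, forall omega, Z n omega @[n --> \oo] --> (0 : R)}.
  apply: (@ae_cvg0_sqr_summable _ _ _ P Z (\sum_D sq_dev mu D psi)) => [[|n]|n].
  - exact: Lfun2_cst.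
  - exact: Lfun2_remainder.
  - exact: remainder_sqr_le.
apply: filterS2 (iid_slln iidX h2 h0) => omega cvh cvZ.
have : Z N omega + N%:R^-1 * \sum_(j < N) h (X j omega) + m @[N --> \oo] --> 0 + 0 + m.
  by apply: cvgD; [exact: cvgD|exact: cvg_cst].
rewrite !add0r; apply: cvg_trans; apply: near_eq_cvg.
near=> N; have : (0 < N)%N by near: N; exact: nbhs_infty_gt.
by rewrite /Z; move: (N) => [//|k] _; rewrite /muN subrK subrK.
Unshelve. all: by end_near. Qed.

(** It holds for [N = 0] too, as both sides vanish. *)
Lemma sqrt_natVM (N : nat) : Num.sqrt N%:R * N%:R^-1 = (Num.sqrt N%:R)^-1 :> R.
Proof.
case: N => [|N]; first by rewrite sqrtr0 invr0 mul0r.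
rewrite -{2}[N.+1%:R](@sqr_sqrtr _ N.+1%:R)//.
by rewrite expr2 invfM mulrA divff ?mul1r// gt_eqF// sqrtr_gt0.
Qed.

(** The remainder scaled by [sqrt N] has second moment at most [C / N], so the
    limit is that of the average of the projection. *)
Lemma muN_times_clt :
  cvg_in_distribution P (scaled_error (fun N => muN_times X N psi) m)
    (gaussian 0 (sigma2_times mu psi)).
Proof.
pose C := \sum_D sq_dev mu D psi.
have s0 : 0 <= sigma2_times mu psi.
  by rewrite -(Rintegral_hajek_sqr iidX psi2 ppsi); apply: Rintegral_ge0 => x _; exact: sqr_ge0.
have Z2 N : scaled_error (fun N => muN_times X N psi) m N \in Lfun P 2%:E.
  case: N => [|N].
    suff -> : scaled_error (fun N => muN_times X N psi) m 0 = fun=> 0 by exact: Lfun2_cst.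
    by apply/funext => x; rewrite /scaled_error sqrtr0 mul0r.
  by apply: Lfun2Zl; apply: Lfun2B; [exact: (Lfun2_muN_times iidX)|exact: Lfun2_cst].
apply: heat_cvg_in_distribution => [N|s a sgt0]; first exact: Lfun2_measurable (Z2 N).
rewrite Rintegral_gaussian_heat//.
apply: (heat_cvg_perturb sgt0 (Y := fun N x => (Num.sqrt N%:R)^-1 * \sum_(j < N) h (X j x))) => //.
- move=> N; apply: Lfun2Zl; apply: Lfun2_sum => j _.
  exact: (Lfun2_iid iidX h2).
- apply/cvgrPdist_le => e e0; near=> N.
  have N0 : (0 < N)%N by near: N; exact: nbhs_infty_gt.
  have NR0 : 0 < N%:R :> R by rewrite ltr0n.
  have -> : \int[P]_x (scaled_error (fun N => muN_times X N psi) m N x -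
      (Num.sqrt N%:R)^-1 * \sum_(j < N) h (X j x)) ^+ 2 =
      N%:R * \int[P]_x (muN_times X N psi x - m - muN X N h x) ^+ 2.
    have i2 := Lfun2_integrable_sqr (Lfun2_remainder iidX psi2 ppsi N0).
    rewrite -(RintegralZl N%:R measurableT i2); apply: eq_Rintegral => x _.
    rewrite /scaled_error -sqrt_natVM -mulrA -mulrBr exprMn sqr_sqrtr//.
  rewrite sub0r normrN ger0_norm; last first.
    by rewrite mulr_ge0//; apply: Rintegral_ge0 => x _; exact: sqr_ge0.
  apply: (@le_trans _ _ (N%:R * (C / N%:R ^+ 2))).
    by rewrite ler_wpM2l//; exact: remainder_sqr_le.
  rewrite [leLHS](_ : _ = C / N%:R); last by field; rewrite gt_eqF.
  rewrite ler_pdivrMr// -ler_pdivrMl//.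
  by near: N; exact: nbhs_infty_ger.
- rewrite -(Rintegral_hajek_sqr iidX psi2 ppsi).
  exact: (iid_heat_clt iidX h2 h0).
Unshelve. all: by end_near. Qed.

Lemma muN_clt :
  cvg_in_distribution P (scaled_error (fun N => muN X N psi) m)
    (gaussian 0 (sigma2 mu psi)).
Proof.
have c2 : (fun x => psi x - m) \in Lfun (prod_prob mu) 2%:E.
  by apply: Lfun2B => //; exact: Lfun2_cst.
have c0 : \int[prod_prob mu]_x (psi x - m) = 0.
  rewrite (RintegralB measurableT (Lfun2_integrable psi2)
    (finite_measure_integrable_cst (prod_prob mu) m measurableT)).
  by rewrite Rintegral_cst1 subrr.
have E N : scaled_error (fun N => muN X N psi) m N =
    fun x => (Num.sqrt N%:R)^-1 * \sum_(j < N) (psi (X j x) - m).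
  apply/funext => x; rewrite /scaled_error /muN -sqrt_natVM -mulrA.
  case: N => [|N]; first by rewrite sqrtr0 !mul0r.
  congr (_ * _); rewrite sumrB sumr_const card_ord -[m *+ _]mulr_natl mulrBr.
  by rewrite mulrA mulVf ?mul1r// pnatr_eq0.
apply: heat_cvg_in_distribution => [N|s a sgt0].
  rewrite E; apply: measurable_funM => //; apply: measurable_sum => j.
  by apply: (measurableT_comp (Lfun2_measurable c2)).
rewrite Rintegral_gaussian_heat//; last by apply: Rintegral_ge0 => x _; exact: sqr_ge0.
under eq_fun do rewrite E.
exact: (iid_heat_clt iidX c2 c0).
Qed.

End estimator_limits.

Theorem corollary2 (R : realType) (K : nat) (K_gt1 : (1 < K)%N)
    (d : 'I_K -> measure_display) (S : forall k, measurableType (d k))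
    (mu : forall k, probability (S k) R)
    (d0 : measure_display) (Omega : measurableType d0)
    (P : probability Omega R) (X : nat -> {mfun Omega >-> prod_space S})
    (iidX : iid_with_law P X (prod_prob mu))
    (gamma : {finite_measure set (prod_space S) -> \bar R})
    (gamma_ac : gamma `<< prod_prob mu)
    (w : {mfun prod_space S >-> R})
    (wE : ae_eq (prod_prob mu) setT (EFin \o w)
            (Radon_Nikodym (charge_of_finite_measure gamma) (prod_prob mu)))
    (phi : prod_space S -> R)
    (phi_int : gamma.-integrable setT (EFin \o phi)) :
  (forall N : nat, (0 < N)%N ->
     'E_P[gammaN_times X w N phi] = \int[gamma]_x (phi x)%:E)%E /\
  let wphi : prod_space S -> R := w \* phi in
  (wphi \in Lfun (prod_prob mu) 2%:E ->
   partially_integrable mu wphi ->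
   let gamma_phi := \int[gamma]_x phi x in
   let est_times := fun N => gammaN_times X w N phi in
   let est := fun N => gammaN X w N phi in
   let avar_times := asymptotic_variance P est_times gamma_phi in
   let avar := asymptotic_variance P est gamma_phi in
   [/\ {ae P, forall omega, est_times N omega @[N --> \oo] --> gamma_phi},
       cvg_in_distribution P (scaled_error est_times gamma_phi)
         (gaussian 0 avar_times),
       (forall N : nat, (0 < N)%N ->
          [/\ 'V_P[est_times N] = 'V_P[muN_times X N wphi],
              'V_P[muN_times X N wphi] <= 'V_P[muN X N wphi],
              'V_P[muN X N wphi] = 'V_P[est N] &
              'V_P[muN_times X N wphi]
                = (var_times mu N wphi)%:E])%E,
       cvg_in_distribution P (scaled_error est gamma_phi) (gaussian 0 avar) &
       [/\ avar_times = sigma2_times mu wphi,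
           sigma2_times mu wphi <= sigma2 mu wphi &
           sigma2 mu wphi = avar]]).
Proof.
set rhs := mean mu (w \* phi).
have iwphi := integrable_density gamma_ac wE phi_int.
have meanE : (\int[gamma]_x (phi x)%:E)%E = (mean mu (w \* phi))%:E.
  rewrite -(integral_density gamma_ac wE phi_int) /mean /Rintegral fineK//.
  exact: integrable_fin_num iwphi.
split=> [N N0|wphi psi2 ppsi gamma_phi est_times est avar_times avar].
  have [iN EN] := muN_times_unbiased iidX iwphi N0.
  rewrite meanE -EN unlock /Rintegral fineK//.
  exact: integrable_fin_num iN.
have gE : gamma_phi = mean mu wphi by rewrite /gamma_phi /Rintegral meanE.
have clt_times := muN_times_clt iidX psi2 ppsi.
have clt := muN_clt iidX psi2.
rewrite -gE in clt_times clt.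
have s2t : 0 <= sigma2_times mu wphi.
  by rewrite -(Rintegral_hajek_sqr iidX psi2 ppsi); apply: Rintegral_ge0 => x _; exact: sqr_ge0.
have s2le := sigma2_times_le iidX psi2 ppsi.
have avartE : avar_times = sigma2_times mu wphi := asymptotic_varianceE s2t clt_times.
have avarE : avar = sigma2 mu wphi := asymptotic_varianceE (le_trans s2t s2le) clt.
split.
- by rewrite gE; exact: muN_times_strongly_consistent.
- rewrite avartE; exact: clt_times.
- move=> N N0; have vt := variance_muN_times iidX psi2 ppsi N0.
  split; [exact: erefl| |exact: erefl|exact: vt].
  rewrite vt (variance_muN iidX psi2 ppsi N0) lee_fin.
  exact: (var_times_le iidX psi2 ppsi N0).
- rewrite avarE; exact: clt.
- by split.
Qed.
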